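(* Let $X$ be a Hausdorff space with Borel $\sigma$-algebra $\mathcal{O}(X)$, let $\mathcal{H}$ be a separable complex Hilbert space, and let $\nu:\mathcal{O}(X)\to\mathcal{B}(\mathcal{H})$ be a nonatomic positive operator-valued measure such that the Radon-Nikodým derivative $\frac{d\nu}{d\nu_\rho}$ exists for a full-rank density operator $\rho$ on $\mathcal{H}$. If integration against $\nu$ is classically non-injective, then the set $\mathcal{R}_\nu=\{\nu(E): E\in\mathcal{O}(X)\}$ is a weak$^*$-compact convex set in $\mathcal{B}(\mathcal{H})$.
   Context: $\mathcal{B}(\mathcal{H})$ is the algebra of bounded operators on $\mathcal{H}$, with predual the trace class operators $\mathcal{T}(\mathcal{H})$ (pairing $\langle s,A\rangle=\mathrm{Tr}(sA)$); the weak$^*$ (ultraweak) topology on $\mathcal{B}(\mathcal{H})$ is the one induced by this predual. $S(\mathcal{H})\subset\mathcal{T}(\mathcal{H})$ is the set of positive operators of trace $1$ (states, or density operators); $\rho\in S(\mathcal{H})$ is full-rank if it is injective. A positive operator-valued measure (POVM) is a map $\nu:\mathcal{O}(X)\to\mathcal{B}(\mathcal{H})$ with $\nu(E)\ge 0$ for all $E$, such that $\nu(\bigcup_k E_k)=\sum_k\nu(E_k)$ for every countable family of pairwise disjoint sets $E_k\in\mathcal{O}(X)$, with convergence in the ultraweak topology. An atom for $\nu$ is a set $E\in\mathcal{O}(X)$ with $\nu(E)\neq0$ such that every measurable $F\subseteq E$ has $\nu(F)=0$ or $\nu(F)=\nu(E)$; $\nu$ is nonatomic if it has no atoms. For $\rho\in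 S(\mathcal{H})$ put $\nu_\rho(E)=\mathrm{Tr}(\rho\,\nu(E))$, a finite positive measure; for $\rho$ full-rank, $\nu$ and $\nu_\rho$ have the same null sets. Fix an orthonormal basis $\{e_n\}$ of $\mathcal{H}$ with matrix units $e_{ij}$, and let $\nu_{ij}(E)=\langle\nu(E)e_j,e_i\rangle$. For $\rho$ full-rank, $\nu_{ij}$ is absolutely continuous with respect to $\nu_\rho$, and one sets $\frac{d\nu}{d\nu_\rho}=\sum_{i,j\ge1}\frac{d\nu_{ij}}{d\nu_\rho}\otimes e_{ij}$, where $\frac{d\nu_{ij}}{d\nu_\rho}\in L^1(X,\nu_\rho)$ is the classical Radon-Nikodým derivative. The derivative $\frac{d\nu}{d\nu_\rho}$ is said to exist if it takes every $x$ to a bounded operator (as usual for Radon-Nikodým derivatives, up to modification on a null set). Existence for one full-rank $\rho$ is equivalent to existence for all full-rank $\rho$. A quantum random variable is a function $f:X\to\mathcal{B}(\mathcal{H})$ such that $x\mapsto\mathrm{Tr}(sf(x))$ is Borel measurable for every $s\in S(\mathcal{H})$. It is essentially bounded if there is $M\ge0$ with $\nu(\{x:\|f(x)\|>M\})=0$. When $\frac{d\nu}{d\nu_\rho}$ exists, the integral of an essentially bounded $f$ is the operator $\mathcal{E}_\nu(f)=\int_X f\,d\nu\in\mathcal{B}(\mathcal{H})$ determined by $$\mathrm{Tr}\Big(s\int_X f\,d\nu\Big)=\int_X\mathrm{Tr}\Big(s\big(\tfrac{d\nu}{d\nu_\rho}(x)\big)^{1/2}f(x)\big(\tfrac{d\nu}{d\nu_\rho}(x)\big)^{1/2}\Big)d\nu_\rho(x)\quad\text{for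 all } s\in S(\mathcal{H}).$$ In particular $\int_X\chi_E I_{\mathcal{H}}\,d\nu=\nu(E)$. Integration against $\nu$ is classically non-injective if for every $E\in\mathcal{O}(X)$ with $\nu(E)\ne0$ the map $L^\infty(E,\nu)\to\mathcal{B}(\mathcal{H})$, $f\mapsto\mathcal{E}_\nu(fI_{\mathcal{H}})$, is not injective. Here $L^\infty(E,\nu)=L^\infty(E,\nu_\rho)$ consists of (classes of) essentially bounded scalar-valued measurable functions on $E$, extended by $0$ to $X$. *)

(* Defs.v *)
From HB Require Import structures.
From mathcomp Require Import all_boot all_order all_algebra.
From mathcomp Require Import complex.
From mathcomp Require Import all_classical all_reals all_analysis.
Set Implicit Arguments.
Unset Strict Implicit.
Unset Printing Implicit Defensive.
Import Order.TTheory GRing.Theory Num.Theory Num.Def.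
Import numFieldNormedType.Exports.
Local Open Scope classical_set_scope.
Local Open Scope ring_scope.
Local Open Scope complex_scope.

Definition separable (T : topologicalType) :=
  exists2 S : set T, countable S & dense S.

Notation borelType X := (g_sigma_algebraType (@open X)).

(* The algebra B(H), as a submodule of the module of all functions H -> H. *)
Section BoundedOperators.
Variables (R : realType) (H : completeNormedModType R[i]).

Definition bounded_linear : {pred H -> H} := fun f =>
  `[< linear f /\ exists M : R[i], forall x, `|f x| <= M * `|x| >].

Lemma bounded_linearP (f : H -> H) :
  reflect (linear f /\ exists M : R[i], forall x, `|f x| <= M * `|x|)
          (f \in bounded_linear).
Proof. exact: asboolP. Qed.

Fact bounded_linear_submod : submod_closed bounded_linear.
Proof.
split=> [|a f g /bounded_linearP[fl [M fM]] /bounded_linearP[gl [N gN]]].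
  apply/bounded_linearP; split=> [a x y|] /=.
    by rewrite scaler0 addr0.
  by exists 0 => x; rewrite normr0 mul0r.
have E x : (a *: f + g) x = a *: f x + g x by [].
apply/bounded_linearP; split=> [b x y|].
  rewrite !E fl gl !scalerDr !scalerA [a * b]mulrC -!addrA.
  by congr (_ + _); rewrite addrCA.
exists (`|a| * M + N) => x; rewrite E mulrDl -mulrA.
by rewrite (le_trans (ler_normD _ _))// lerD// normrZ ler_wpM2l.
Qed.

HB.instance Definition _ :=
  GRing.isSubmodClosed.Build R[i] (H -> H) bounded_linear bounded_linear_submod.

Record bop := Bop { bop_fun :> H -> H ; _ : bop_fun \in bounded_linear }.

HB.instance Definition _ := [isSub for bop_fun].
HB.instance Definition _ := [Choice of bop by <:].
HB.instance Definition _ := [SubChoice_isSubLmodule of bop by <:].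

Fact bid_subproof : idfun \in bounded_linear.
Proof. by apply/bounded_linearP; split=> //; exists 1 => x; rewrite mul1r. Qed.

Definition bid : bop := Bop bid_subproof.

Fact bcomp_subproof (A B : bop) : (A \o B : H -> H) \in bounded_linear.
Proof.
have /bounded_linearP[Al [M AM]] := valP A.
have /bounded_linearP[Bl [N BN]] := valP B.
apply/bounded_linearP; split=> [a x y|] /=; first by rewrite Bl Al.
exists (`|M| * N) => x; rewrite -mulrA (le_trans _ (ler_wpM2l _ (BN x)))//.
have := AM (B x); have [Bx0|Bx0] := eqVneq (B x) 0.
  by rewrite /= Bx0 normr0 !mulr0.
move=> /[dup] /(le_trans (normr_ge0 _)); rewrite pmulr_lge0 ?normr_gt0//.
by move=> /ger0_norm ->.
Qed.

Definition bcomp (A B : bop) : bop := Bop (bcomp_subproof A B).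

End BoundedOperators.

Notation "A *o B" := (bcomp A B)
  (at level 40, left associativity, format "A  *o  B") : ring_scope.

(* [dot] is linear in its first argument. The orthonormal basis is the family
   of the e n for n in J, so that finite-dimensional spaces are included. *)
Section TraceClass.
Variables (R : realType) (H : completeNormedModType R[i]).
Variables (dot : {dot H for conjC}) (e : nat -> H) (J : set nat).
Implicit Types (A B P s : bop H).

Definition orthonormal_basis :=
  (forall i j, J i -> J j -> dot (e i) (e j) = (i == j)%:R) /\
  (forall x, \sum_(0 <= k < n | k \in J) dot x (e k) *: e k @[n --> \oo] --> x).

(* 0 <= z in R[i] says that z is real and nonnegative. *)
Definition positive_op A := forall x, 0 <= dot (A x) x.

Definition is_adjoint A B := forall x y, dot (A x) y = dot x (B y).

Definition is_opsqrt A B := positive_op B /\ B *o B = A.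

Definition opsqrt A : bop H := xget 0 (is_opsqrt A).

(* P is the absolute value (A^* A)^(1/2) of A. *)
Definition is_absop A P := exists2 B, is_adjoint A B & is_opsqrt (B *o A) P.

Definition trace_series A : nat -> R[i]^o :=
  fun n => \sum_(0 <= k < n | k \in J) dot (A (e k)) (e k).

Definition trace A : R[i] := limn (trace_series A).

Definition trace_class : set (bop H) :=
  [set s | exists2 P, is_absop s P & cvgn (trace_series P)].

Definition is_state s := positive_op s /\ trace_series s @ \oo --> (1 : R[i]^o).

Definition full_rank s := injective s.

Definition trace_pairing A : {ptws trace_class -> R[i]^o} :=
  fun s : trace_class => trace (set_val s *o A).

(* The coarsest topology that makes A |-> Tr(s A) continuous for every trace
   class s. *)
Definition ultraweak := initial_topology trace_pairing.

End TraceClass.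

Section ComplexIntegral.
Context d (T : measurableType d) (R : realType) (mu : set T -> \bar R).
Implicit Types (D : set T) (f : T -> R[i]).

Definition cmeasurable f :=
  measurable_fun setT (fun x => complex.Re (f x)) /\
  measurable_fun setT (fun x => complex.Im (f x)).

Definition cintegrable D f :=
  mu.-integrable D (fun x => (complex.Re (f x))%:E) /\
  mu.-integrable D (fun x => (complex.Im (f x))%:E).

Definition cintegral D f : R[i] :=
  fine (\int[mu]_(x in D) (complex.Re (f x))%:E) +i*
  fine (\int[mu]_(x in D) (complex.Im (f x))%:E).

End ComplexIntegral.

Section OperatorValuedMeasures.
Context d (T : measurableType d) (R : realType).
Variables (H : completeNormedModType R[i]).
Variables (dot : {dot H for conjC}) (e : nat -> H) (J : set nat).
Implicit Types (nu : set T -> bop H) (rho : bop H) (D : T -> bop H).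

Definition is_povm nu :=
  (forall E, measurable E -> positive_op dot (nu E)) /\
  (forall F : nat -> set T, (forall k, measurable (F k)) -> trivIset setT F ->
    (\sum_(0 <= k < n) nu (F k) : ultraweak dot e J) @[n --> \oo]
      --> (nu (\bigcup_k F k) : ultraweak dot e J)).

Definition is_atom nu (E : set T) :=
  [/\ measurable E, nu E <> 0 &
      forall F, measurable F -> F `<=` E -> nu F = 0 \/ nu F = nu E].

Definition nonatomic nu := ~ exists E, is_atom nu E.

Definition povm_state nu rho (E : set T) : \bar R :=
  (complex.Re (trace dot e J (rho *o nu E)))%:E.

(* D is a version of the derivative of nu with respect to nu_rho: its (i, j)
   matrix entry is a classical Radon-Nikodym derivative of nu_ij. *)
Definition is_RN_derivative nu rho D :=
  forall i j, J i -> J j ->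
    cintegrable (povm_state nu rho) setT (fun x => dot (D x (e j)) (e i)) /\
    (forall E, measurable E -> dot (nu E (e j)) (e i) =
      cintegral (povm_state nu rho) E (fun x => dot (D x (e j)) (e i))).

(* A is the integral of f against nu, computed from the version D of the
   derivative of nu with respect to nu_rho. *)
Definition is_qintegral nu rho D (f : T -> bop H) (A : bop H) :=
  forall s, is_state dot e J s ->
    let g x :=
      trace dot e J (s *o (opsqrt dot (D x) *o (f x *o opsqrt dot (D x)))) in
    cintegrable (povm_state nu rho) setT g /\
    trace dot e J (s *o A) = cintegral (povm_state nu rho) setT g.

(* Representatives of the elements of L^oo(E, nu), extended by 0 outside E. *)
Definition Linfty nu (E : set T) (f : T -> R[i]) :=
  [/\ cmeasurable f, (forall x, ~ E x -> f x = 0) &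
      exists2 M : R, 0 <= M & nu [set x | M%:C < `|f x|] = 0].

Definition classically_noninjective nu rho D :=
  forall E, measurable E -> nu E <> 0 ->
  exists f g : T -> R[i],
    [/\ Linfty nu E f, Linfty nu E g, nu [set x | f x <> g x] <> 0 &
        exists A : bop H,
          is_qintegral nu rho D (fun x => f x *: bid H) A /\
          is_qintegral nu rho D (fun x => g x *: bid H) A].

Definition povm_range nu : set (bop H) := [set nu E | E in measurable].

End OperatorValuedMeasures.

(* Main.v *)
(* Lindenstrauss' proof of Lyapunov's theorem. For a trace class operator s let h_s
   be the density of Tr(s nu(.)) with respect to nu_rho. The functions u with values
   in [0, 1] form a weak-* compact convex subset of the dual of L^1(nu_rho), and u
   determines the integrals of the u h_s. Let u be an extreme point of the set of
   those with prescribed integrals. If {0 < u < 1} were not null, non-injectivity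
   would provide a bounded real r, not almost everywhere 0 and supported where u is
   bounded away from 0 and 1, such that r h_s has integral 0 for all s; then u would
   be the midpoint of two other such functions u + c r and u - c r. So u is an
   indicator function, and the range of nu is the image of a compact convex set
   under a continuous affine map.

   Non-injectivity only gives that r <D v, v> has integral 0, where D is the derivative
   and v a finite combination of basis vectors. The passage to h_s approximates
   u = 1/2 + r / (2 M) by simple functions of step 1/n: if u_n is the
   simple function, then u_n - 1/2 + 1/n integrates against nu to a positive operator
   below nu(X) / n, on which the functional A |-> Tr(s A) is small. *)

Require Import Defs.
From HB Require Import structures.
From mathcomp Require Import all_boot all_order all_algebra.
From mathcomp Require Import complex.
From mathcomp Require Import all_classical all_reals all_analysis.
From mathcomp Require Import measurable_realfun.
From mathcomp Require Import ring lra.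
Set Implicit Arguments.
Unset Strict Implicit.
Unset Printing Implicit Defensive.
Import Order.TTheory GRing.Theory Num.Theory Num.Def.
Import numFieldNormedType.Exports HBSimple HBNNSimple.
Local Open Scope classical_set_scope.
Local Open Scope ring_scope.
Local Open Scope complex_scope.

(** * Lyapunov's theorem through extreme points *)

(** The obstacle is that [D] is tied to [nu] through matrix entries only. Bilinearity makes <D v, v>
    a density of <nu(.) v, v> for finite combinations v of basis vectors; for a trace class s,
    however, h_s is an abstract Radon-Nikodym derivative, and identifying it with Tr(s D) would mean
    exchanging the trace series with the integral. The transfer avoids any formula for h_s and
    compares traces of operators instead. Indicators are used because their integrals are values of
    [nu], and inequalities between quadratic forms on finite combinations extend to all vectors by
    continuity, which is why the error is arranged to be positive. What remains is a bound for Tr(s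
    A) by a multiple of the norm of a positive A. It is needed for every trace class s, since these
    define the ultraweak topology, and it is derived from square roots and Hilbert-Schmidt sums. As
    that topology is initial, compactness of the range is compactness of a set of families of traces
    in a product space. *)

Section Extreme.
Context (R : realType) (I : eqType).
Implicit Types (K F : set {ptws I -> R}) (phi delta : I -> R).

(** Extremality is tested on symmetric segments with midpoint in [F], the shape in which
    perturbations of a function arrive later. *)
Let face K F := [/\ F `<=` K, F !=set0, closed F &
  forall phi delta, F phi ->
    K (fun i => phi i + delta i) -> K (fun i => phi i - delta i) ->
    F (fun i => phi i + delta i) /\ F (fun i => phi i - delta i)].

(* A minimal face exists by Zorn; maximizing a coordinate over it yields a smaller
   face, so it is a single point. *)
Lemma extreme_point K : compact K -> closed K -> K !=set0 ->
  exists2 phi, K phi & forall delta, K (fun i => phi i + delta i) ->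
    K (fun i => phi i - delta i) -> forall i, delta i = 0.
Proof.
move=> cK clK K0.
pose U := {F : set {ptws I -> R} | face K F}.
(* Reverse inclusion, so that a maximal element for Zorn is a minimal face. *)
pose le (F G : U) := `[< sval G `<=` sval F >].
have [||||[F fF] Fmin] := @Zorn U le.
- by move=> F; apply/asboolP.
- move=> F G H /asboolP FG /asboolP GH; apply/asboolP.
  exact: subset_trans FG.
- move=> [F fF] [G fG] /asboolP /= GF /asboolP /= FG.
  by apply: eq_exist; apply/seteqP.
- move=> C Ctot.
  have [->|/set0P[F0 CF0]] := eqVneq C set0.
    have fK : face K K by split.
    by exists (exist _ K fK) => s.
  (* The chain is a filter base on the compact set [K]; a cluster point lies in every closed member,
     so the intersection is nonempty. *)
  pose B := filter_from C sval.
  have FB : ProperFilter B.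
    apply: filter_from_proper => [|F _]; last by case: F => F [].
    apply: filter_from_filter; first by exists F0.
    move=> F G CF CG; have [/asboolP FG|/asboolP GF] := Ctot _ _ CF CG.
      by exists G => //= x Gx; split => //; exact: FG.
    by exists F => //= x Fx; split => //; exact: GF.
  have BK : B K by exists F0 => //; case: F0 {CF0} => F [].
  have [p [Kp Bp]] := cK B FB BK.
  have inp (F : U) : C F -> sval F p.
    move=> CF; have [_ _ cl _] := svalP F.
    by apply: cl => A /Bp; apply; exists F.
  have fI : face K (K `&` [set x | forall F : U, C F -> sval F x]).
    split.
    + by move=> x [].
    + by exists p; split.
    + apply: closedI => //.
      have -> : [set x | forall F : U, C F -> sval F x] = \bigcap_(F in C) sval F.
        by apply/seteqP; split => x Hx F CF; exact: Hx.
      by apply: closed_bigI => -[F []].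
    + move=> phi delta [Kphi Cphi] Kp1 Kp2; split; split => // F CF.
        by have [_ _ _ ff] := svalP F; have [] := ff phi delta (Cphi _ CF) Kp1 Kp2.
      by have [_ _ _ ff] := svalP F; have [] := ff phi delta (Cphi _ CF) Kp1 Kp2.
  exists (exist _ _ fI) => F CF; apply/asboolP => /= x [_]; exact.
- have [FK [f0 Ff0] clF ff] := fF.
  have cF : compact F by apply: subclosed_compact cK FK.
  have cst i phi psi : F phi -> F psi -> phi i = psi i.
    move: phi psi.
    have ci : continuous (fun phi : {ptws I -> R} => phi i).
      exact: (@proj_continuous I (fun=> R) i).
    have [m [Fm mmax]] : exists m, F m /\ forall phi, F phi -> phi i <= m i.
      have [||c Fc cm] := @compact_EVT_max _ _ (fun phi : {ptws I -> R} => phi i) F _ cF.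
      + by exists f0.
      + by apply: continuous_subspaceT => x; apply: ci.
      + exists c; split; first exact: set_mem.
        by move=> phi Fphi; apply: cm; exact: mem_set.
    have fG : face K (F `&` [set phi | phi i = m i]).
      split.
      + by move=> x [/FK].
      + by exists m.
      + apply: closedI => //.
        apply: (@closed_comp _ _ (fun phi : {ptws I -> R} => phi i) [set m i]).
          by move=> x _; apply: ci.
        exact: closed_eq.
      + move=> phi delta [Fphi /= pm] K1 K2.
        have [F1 F2] := ff phi delta Fphi K1 K2.
        (* The maximum is the mean of the two perturbed values, neither of which exceeds it, so both
           attain it. *)
        have := mmax _ F1; have := mmax _ F2; rewrite /= pm => h1 h2.
        by split; split => //=; lra.
    (* By minimality this subface is all of [F], so coordinate [i] is constant on [F]. *)
    have /(congr1 sval) /= FE := Fmin (exist _ _ fG) (asboolT (@subIsetl _ _ _)).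
    by move=> phi psi; rewrite -FE => -[_ /= ->] [_ /= ->].
  exists f0; first exact: FK.
  move=> delta K1 K2 i; have [F1 F2] := ff f0 delta Ff0 K1 K2.
  have := cst i _ _ F1 F2; lra.
Qed.

End Extreme.

(** * Real integrable functions for a finite measure *)

Section RealIntegral.
Context d (T : measurableType d) (R : realType).
Variable mu : {finite_measure set T -> \bar R}.
Implicit Types (f g h : T -> R) (A E : set T).

Definition L1 f : Prop := mu.-integrable setT (EFin \o f).

Lemma L1_measurable f : L1 f -> measurable_fun setT f.
Proof. by move=> /measurable_int /measurable_EFinP. Qed.

Lemma L1D f g : L1 f -> L1 g -> L1 (f \+ g).
Proof.
move=> If Ig; rewrite /L1 /=.
rewrite (_ : EFin \o (f \+ g)%R = (EFin \o f) \+ (EFin \o g))%E; last first.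
  by apply/funext => x.
exact: integrableD.
Qed.

Lemma L1Z c f : L1 f -> L1 (fun x => c * f x).
Proof.
move=> If; rewrite /L1 /=.
rewrite (_ : EFin \o _ = fun x => (c%:E * (EFin \o f) x))%E; last first.
  by apply/funext => x.
exact: integrableZl.
Qed.

Lemma L1B f g : L1 f -> L1 g -> L1 (f \- g).
Proof.
move=> If Ig; rewrite /L1 /=.
rewrite (_ : EFin \o (f \- g)%R = (EFin \o f) \- (EFin \o g))%E; last first.
  by apply/funext => x.
exact: integrableB.
Qed.

Lemma L1_norm f : L1 f -> L1 (fun x => `|f x|).
Proof. exact: integrable_norm. Qed.

Lemma L1_cst c : L1 (fun=> c).
Proof. exact: finite_measure_integrable_cst. Qed.

Lemma L1_indic A : measurable A -> L1 \1_A.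
Proof. exact: integrable_indic. Qed.

Lemma L1M f g : L1 f -> measurable_fun setT g -> (exists M, forall x, `|g x| <= M) ->
  L1 (fun x => g x * f x).
Proof.
move=> If mg [M gM].
apply: (@integrableMr _ _ _ mu setT measurableT g (EFin \o f)) => //.
exists M; split; first exact: num_real.
by move=> x Mx y _ /=; apply: le_trans (gM y) (ltW Mx).
Qed.

Lemma L1_bounded f : measurable_fun setT f -> (exists M, forall x, `|f x| <= M) -> L1 f.
Proof.
move=> mf bf; have := L1M (L1_cst 1) mf bf.
by congr L1; apply/funext => x; rewrite mulr1.
Qed.

Lemma RintD f g : L1 f -> L1 g ->
  \int[mu]_x (f x + g x) = Rintegral mu setT f + Rintegral mu setT g.
Proof. by move=> If Ig; rewrite RintegralD. Qed.

Lemma RintB f g : L1 f -> L1 g ->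
  \int[mu]_x (f x - g x) = Rintegral mu setT f - Rintegral mu setT g.
Proof. by move=> If Ig; rewrite RintegralB. Qed.

Lemma RintZ c f : L1 f -> \int[mu]_x (c * f x) = c * Rintegral mu setT f.
Proof. by move=> If; rewrite RintegralZl. Qed.

Lemma le_Rint f g : L1 f -> L1 g -> (forall x, f x <= g x) ->
  \int[mu]_x f x <= \int[mu]_x g x.
Proof. by move=> If Ig fg; rewrite le_Rintegral. Qed.

Lemma Rint_indic A : measurable A -> \int[mu]_x (\1_A x) = fine (mu A).
Proof. by move=> mA; rewrite /Rintegral integral_indic// setIT. Qed.

Lemma Rint_in A f : \int[mu]_(x in A) f x = \int[mu]_x (\1_A x * f x).
Proof.
rewrite Rintegral_mkcond; congr Rintegral; apply/funext => x.
by rewrite /patch indicE; case: ifP; rewrite ?mul1r ?mul0r.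
Qed.

Lemma Rint_EFin A f : measurable A -> L1 f ->
  (\int[mu]_(x in A) (f x)%:E)%E = (\int[mu]_(x in A) f x)%:E.
Proof.
move=> mA If; rewrite /Rintegral fineK//.
apply: integrable_fin_num => //; exact: (integrableS measurableT).
Qed.

Lemma indic_bounded A : exists M : R, forall x, `|\1_A x : R| <= M.
Proof. by exists 1 => x; rewrite indicE; case: (_ \in _); rewrite ?normr1 ?normr0. Qed.

Lemma L1_in A f : measurable A -> L1 f -> L1 (fun x => \1_A x * f x).
Proof. by move=> mA If; apply: L1M => //; exact: indic_bounded. Qed.

Lemma Rint_gt0_null f : L1 f -> (forall x, 0 <= f x) -> \int[mu]_x f x = 0 ->
  mu [set x | f x != 0] = 0.
Proof.
move=> If f0 J0.
have mf := L1_measurable If.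
have mf0 : measurable [set x | f x != 0].
  rewrite (_ : [set x | f x != 0] = setT `&` f @^-1` (~` [set 0])).
    by apply: mf => //; exact: measurableC.
  by rewrite setTI; apply/seteqP; split => x /eqP.
have : (\int[mu]_(x in setT) `|(EFin \o f) x| = 0)%E.
  under eq_integral do rewrite /= ger0_norm//.
  by rewrite (Rint_EFin measurableT If) J0.
move/(ae_eq_integral_abs _ measurableT) => /(_ (measurable_int _ If)).
move=> [N [mN N0 sN]].
apply/eqP; rewrite -measure_le0 -N0; apply: le_measure.
- by rewrite inE.
- by rewrite inE.
- move=> x /= /negP fx0; apply: sN => /= /(_ Logic.I) [] /eqP; exact: fx0.
Qed.

(** Taking for [E] the set where f is negative forces the nonnegative function [g], which is -f
    there and 0 elsewhere, to have integral 0. *)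
Lemma ae_ge0_from_Rint f : L1 f ->
  (forall E, measurable E -> 0 <= \int[mu]_(x in E) f x) ->
  mu [set x | f x < 0] = 0.
Proof.
move=> If f0; have mf := L1_measurable If.
have mN : measurable [set x | f x < 0].
  rewrite (_ : [set x | f x < 0] = setT `&` f @^-1` `]-oo, 0[).
    by apply: mf => //; exact: measurable_itv.
  by rewrite setTI; apply/seteqP; split => x /=; rewrite in_itv.
pose g x := - (\1_[set x | f x < 0] x * f x).
have Ig : L1 g.
  have := L1Z (-1) (L1_in mN If); congr L1; apply/funext => x.
  by rewrite mulN1r.
have g0 x : 0 <= g x.
  rewrite /g indicE; case: (boolP (_ \in _)); rewrite ?mul0r ?oppr0// inE /=.
  by move=> /ltW; rewrite mul1r oppr_ge0.
have gE : [set x | f x < 0] = [set x | g x != 0].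
  apply/seteqP; split => x; rewrite /= /g indicE.
    by move=> fx; rewrite mem_set//= mul1r oppr_eq0 lt_eqF.
  by case: (boolP (_ \in _)); rewrite ?mul0r ?oppr0 ?eqxx// inE.
rewrite gE; apply: Rint_gt0_null => //.
apply/eqP; rewrite eq_le; apply/andP; split; last by apply: Rintegral_ge0.
have -> : \int[mu]_x g x = - \int[mu]_(x in [set x | f x < 0]) f x.
  rewrite [in RHS]Rint_in -mulN1r -(RintZ (-1) (L1_in mN If)).
  by congr Rintegral; apply/funext => x; rewrite mulN1r.
by rewrite oppr_le0 f0.
Qed.

End RealIntegral.

(** * Closed conditions on continuous real functions *)

Section RealFunctions.
Context (Z : topologicalType) (R : realType).
Implicit Types a b : Z -> R.

Lemma continuous_cst_fun (c : R) : continuous (fun _ : Z => c).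
Proof. by move=> z; exact: cvg_cst. Qed.

Lemma continuous_add_fun a b : continuous a -> continuous b ->
  continuous (fun z => a z + b z).
Proof. by move=> ca cb z; apply: cvgD; [exact: ca | exact: cb]. Qed.

Lemma continuous_mul_fun c a : continuous a -> continuous (fun z => c * a z).
Proof. by move=> ca z; apply: cvgMl_tmp; exact: ca. Qed.

Lemma closed_le_fun a b : continuous a -> continuous b ->
  closed [set z | a z <= b z].
Proof.
move=> ca cb.
rewrite (_ : [set z | a z <= b z] = (fun z => b z - a z) @^-1` [set x | 0 <= x]).
  apply: closed_comp => [x _|]; last exact: closed_ge.
  by apply: cvgB; [exact: cb | exact: ca].
by apply/seteqP; split => x /=; rewrite subr_ge0.
Qed.

Lemma closed_eq_fun a b : continuous a -> continuous b ->
  closed [set z | a z = b z].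
Proof.
move=> ca cb.
rewrite (_ : [set z | a z = b z] = [set z | a z <= b z] `&` [set z | b z <= a z]).
  by apply: closedI; exact: closed_le_fun.
apply/seteqP; split => x /=; first by move->.
by move=> [ab ba]; apply/le_anti; rewrite ab ba.
Qed.

End RealFunctions.

(** * Radon-Nikodym for real set functions *)

Section RadonNikodym.
Context d (T : measurableType d) (R : realType).
Variable mu : {finite_measure set T -> \bar R}.

(** The input is a bare real set function because it will be a functional evaluated on indicators,
    or a part of a trace; absolute continuity supplies the value 0 at the empty set. *)
Lemma radon_nikodym_real (lam : set T -> R) :
  (forall F : nat -> set T, (forall k, measurable (F k)) -> trivIset setT F ->
    \sum_(0 <= k < n) lam (F k) @[n --> \oo] --> lam (\bigcup_k F k)) ->
  (forall A, measurable A -> mu A = 0 -> lam A = 0) ->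
  exists2 h, L1 mu h & forall A, measurable A -> lam A = \int[mu]_(x in A) h x.
Proof.
move=> lam_sigma lam_ac.
have lam0 : lam set0 = 0 by rewrite lam_ac// measure0.
have lamS : semi_sigma_additive (fun A => (lam A)%:E).
  move=> F mF tF mUF.
  rewrite (_ : (fun n => _) = EFin \o (fun n => \sum_(0 <= k < n) lam (F k))); last first.
    by apply/funext => n /=; rewrite sumEFin.
  by apply: cvg_EFin; [exact: nearW | exact: lam_sigma].
have lamF A : measurable A -> (lam A)%:E \is a fin_num by [].
have lam0E : (lam set0)%:E = 0%E by rewrite lam0.
pose l : {charge set T -> \bar R} :=
  HB.pack (fun A => (lam A)%:E) (@isCharge.Build d T R _ lam0E lamF lamS).
have lac : l `<< mu.
  by apply/null_content_dominatesP => A mA muA0; rewrite /= lam_ac.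
exists (fun x => fine (Radon_Nikodym l mu x)).
  have := Radon_Nikodym_integrable lac; congr (mu.-integrable setT _).
  by apply/funext => x /=; rewrite fineK// Radon_Nikodym_fin_num.
move=> A mA; rewrite /Rintegral.
under eq_integral do rewrite fineK ?Radon_Nikodym_fin_num//.
by rewrite -Radon_Nikodym_integral.
Qed.

End RadonNikodym.

(** * The weak-* compact set of functions with values in [0, 1] *)

Section WeakStarBall.
Context d (T : measurableType d) (R : realType).
Variable mu : {finite_measure set T -> \bar R}.
Implicit Types (f g h : T -> R) (A E : set T).

Definition unit_fun g := measurable_fun setT g /\ forall x, 0 <= g x <= 1.

Lemma unit_fun_bounded g : unit_fun g -> exists M : R, forall x, `|g x| <= M.
Proof.
by move=> [_ g01]; exists 1 => x; have /andP[g0 g1] := g01 x; rewrite ger0_norm.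
Qed.

Lemma L1_unit g h : unit_fun g -> L1 mu h -> L1 mu (fun x => g x * h x).
Proof.
by move=> ug Ih; apply: L1M => //; [case: ug | exact: unit_fun_bounded].
Qed.

(* With the value 0 outside L1, the functions with values in [0, 1] embed into a
   product of intervals indexed by all functions, where Tychonoff applies. *)
Definition pairing g h : R :=
  if `[< L1 mu h >] then \int[mu]_x (g x * h x) else 0.

Lemma pairingE g h : L1 mu h -> pairing g h = \int[mu]_x (g x * h x).
Proof. by move=> Ih; rewrite /pairing asboolT. Qed.

(** Each clause is an equation or inequality between finitely many coordinates, hence closed in the
    product; [wball_repr] shows that exactly the pairings remain. The first clause matches the
    default value of [pairing]. *)
Definition wball : set {ptws (T -> R) -> R} := [set phi | [/\
  forall h, ~ L1 mu h -> phi h = 0,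
  forall h1 h2, L1 mu h1 -> L1 mu h2 -> phi (h1 \+ h2) = phi h1 + phi h2,
  forall c h, L1 mu h -> phi (fun x => c * h x) = c * phi h &
  forall h, L1 mu h -> (forall x, 0 <= h x) -> 0 <= phi h <= Rintegral mu setT h]].

Lemma pairing_wball g : unit_fun g -> wball (pairing g).
Proof.
move=> ug; split.
- by move=> h nIh; rewrite /pairing asboolF.
- move=> h1 h2 I1 I2; rewrite !pairingE//; last exact: L1D.
  rewrite -RintD; [|exact: L1_unit..].
  by congr Rintegral; apply/funext => x; rewrite /= mulrDr.
- move=> c h Ih; rewrite !pairingE//; last exact: L1Z.
  rewrite -RintZ; last exact: L1_unit.
  by congr Rintegral; apply/funext => x; rewrite mulrCA.
- move=> h Ih h0; rewrite pairingE//; apply/andP; split.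
    apply: Rintegral_ge0 => x _; apply: mulr_ge0 => //.
    by have /andP[] := ug.2 x.
  apply: le_Rint => //; first exact: L1_unit.
  by move=> x; have /andP[_ g1] := ug.2 x; rewrite ler_piMl.
Qed.

Section Representation.
Variable phi : (T -> R) -> R.
Hypothesis phiW : wball phi.

Let phiD h1 h2 : L1 mu h1 -> L1 mu h2 -> phi (h1 \+ h2) = phi h1 + phi h2.
Proof. by case: phiW => _ + _ _; exact. Qed.
Let phiZ c h : L1 mu h -> phi (fun x => c * h x) = c * phi h.
Proof. by case: phiW => _ _ + _; exact. Qed.
Let phi01 h : L1 mu h -> (forall x, 0 <= h x) -> 0 <= phi h <= Rintegral mu setT h.
Proof. by case: phiW => _ _ _; exact. Qed.

Let phiB h1 h2 : L1 mu h1 -> L1 mu h2 -> phi (h1 \- h2) = phi h1 - phi h2.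
Proof.
move=> I1 I2.
have -> : h1 \- h2 = h1 \+ (fun x => -1 * h2 x).
  by apply/funext => x /=; rewrite mulN1r.
by rewrite phiD// ?phiZ ?mulN1r//; exact: L1Z.
Qed.

(** Positivity is applied to |h| + h and |h| - h, the upper bound to |h|. *)
Lemma wball_le h : L1 mu h -> `|phi h| <= \int[mu]_x `|h x|.
Proof.
move=> Ih; have In := L1_norm Ih.
have /andP[+ _] : 0 <= phi ((fun x => `|h x|) \- h) <= Rintegral mu setT ((fun x => `|h x|) \- h).
  by apply: phi01 => [|x]; [exact: L1B | rewrite /= subr_ge0 ler_norm].
have /andP[+ _] : 0 <= phi ((fun x => `|h x|) \+ h) <= Rintegral mu setT ((fun x => `|h x|) \+ h).
  apply: phi01 => [|x]; first exact: L1D.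
  by have := ler_norm (- h x); rewrite normrN /=; lra.
have /andP[_] := phi01 In (fun x => normr_ge0 (h x)).
by rewrite phiB// phiD// => H1 H2 H3; rewrite ler_norml; apply/andP; split; lra.
Qed.

Let phi0 : phi (fun=> 0) = 0.
Proof.
rewrite -[RHS](mul0r (phi (fun=> 0))) -phiZ; last exact: L1_cst.
congr phi.
by apply/funext => x; rewrite mul0r.
Qed.

Let phi_sum n (s : nat -> T -> R) : (forall i, L1 mu (s i)) ->
  L1 mu (fun x => \sum_(0 <= i < n) s i x) /\
  phi (fun x => \sum_(0 <= i < n) s i x) = \sum_(0 <= i < n) phi (s i).
Proof.
move=> Is; elim: n => [|n [IH1 IH2]].
  rewrite big_geq//.
  have -> : (fun x => \sum_(0 <= i < 0) s i x) = fun=> 0.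
    by apply/funext => x; rewrite big_geq.
  by split; [exact: L1_cst | exact: phi0].
have -> : (fun x => \sum_(0 <= i < n.+1) s i x) =
    (fun x => \sum_(0 <= i < n) s i x) \+ s n.
  by apply/funext => x; rewrite big_nat_recr.
by split; [exact: L1D | rewrite phiD// IH2 big_nat_recr].
Qed.

Let lam A := phi \1_A.

Let lam_le A : measurable A -> 0 <= lam A <= fine (mu A).
Proof.
by move=> mA; rewrite -Rint_indic//; apply: phi01 => //; exact: L1_indic.
Qed.

Let fin_mu A : measurable A -> mu A \is a fin_num.
Proof. by move=> mA; exact: fin_num_measure. Qed.

(** The remainder [r n] is a nonnegative function, so [phi] of it is at most its integral, which
    tends to 0 because [mu] is countably additive. *)
Let lam_sigma (F : nat -> set T) : (forall k, measurable (F k)) -> trivIset setT F ->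
  \sum_(0 <= k < n) lam (F k) @[n --> \oo] --> lam (\bigcup_k F k).
Proof.
move=> mF tF; set U := \bigcup_k F k.
have mU : measurable U by exact: bigcup_measurable.
pose r n := \1_U \- (fun x => \sum_(0 <= k < n) \1_(F k) x : R).
have Is k : L1 mu (\1_(F k) : T -> R) by exact: L1_indic.
have Ir n : L1 mu (r n).
  by apply: L1B; [exact: L1_indic | have [] := phi_sum n Is].
have r0 n x : 0 <= r n x.
  rewrite /r /= subr_ge0.
  rewrite -lee_fin -sumEFin indic_bigcup//.
  by apply: nneseries_lim_ge => k _; rewrite lee_fin.
apply/cvgrPdist_le => e e0.
have : \sum_(0 <= k < n) fine (mu (F k)) @[n --> \oo] --> fine (mu U).
  have := @measure_semi_sigma_additive _ _ _ mu F mF tF mU.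
  rewrite -[X in _ --> X](fineK (fin_mu mU)) => /fine_cvg.
  apply: cvg_trans; apply: near_eq_cvg; apply: nearW => n /=.
  by rewrite -sum_fine// => k _; exact: fin_mu.
move=> /cvgrPdist_le /(_ _ e0); apply: filterS => n.
have [_ phis] := phi_sum n Is.
have phir : phi (r n) = lam U - \sum_(0 <= k < n) lam (F k).
  by rewrite phiB// ?phis//; [exact: L1_indic | have [] := phi_sum n Is].
have Jr : Rintegral mu setT (r n) = fine (mu U) - \sum_(0 <= k < n) fine (mu (F k)).
  rewrite RintB; [|exact: L1_indic | by have [] := phi_sum n Is].
  rewrite Rint_indic//; congr (_ - _).
  elim: n {Ir r0 phis phir} => [|n IH].
    rewrite big_geq// (_ : (fun x => _) = fun=> 0) ?Rintegral_cst ?mul0r//.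
    by apply/funext => x; rewrite big_geq.
  rewrite big_nat_recr//= -IH -Rint_indic// -RintD//; last by have [] := phi_sum n Is.
  by congr Rintegral; apply/funext => x; rewrite big_nat_recr.
have /andP[p0 p1] := phi01 (Ir n) (r0 n).
have J0 := le_trans p0 p1.
by rewrite -phir -Jr (ger0_norm p0) (ger0_norm J0); exact: le_trans.
Qed.

(** On indicators [phi] is a set function dominated by [mu], whose density represents it. Linearity
    extends this to simple functions, and the L1 bound [wball_le] to their limits. *)
Lemma wball_repr : exists2 g, unit_fun g & phi = pairing g.
Proof.
have [|g0 Ig0 g0E] := radon_nikodym_real lam_sigma (mu := mu).
  move=> A mA muA0; have := lam_le mA; rewrite muA0 /= => l0.
  by apply/eqP; rewrite eq_le andbC.
have mg0 := L1_measurable Ig0.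
(* The density lies in [0, 1] only almost everywhere; clipping alters it on a null set and makes the
   bounds hold everywhere. *)
pose g x := Num.max 0 (Num.min 1 (g0 x)).
have mg : measurable_fun setT g.
  apply: measurable_maxr => //; exact: measurable_minr.
have ug : unit_fun g.
  by split => // x; rewrite /g le_max lexx /= ge_max ler01 /= ge_min lexx.
have N1 : mu [set x | g0 x < 0] = 0.
  apply: ae_ge0_from_Rint => // E mE; rewrite -g0E//.
  by have /andP[] := lam_le mE.
have N2 : mu [set x | 1 - g0 x < 0] = 0.
  apply: (@ae_ge0_from_Rint _ _ _ mu ((fun=> 1) \- g0)).
    by apply: L1B => //; exact: L1_cst.
  move=> E mE; rewrite RintegralB//; last 2 first.
  - exact: (integrableS measurableT mE (@subsetT _ _) (L1_cst mu 1)).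
  - exact: (integrableS measurableT).
  rewrite Rintegral_cst// mul1r subr_ge0 -g0E//.
  by have /andP[] := lam_le mE.
have gE A : measurable A -> phi \1_A = \int[mu]_x (g x * \1_A x).
  move=> mA; have := g0E A mA; rewrite /lam => ->.
  rewrite Rint_in /Rintegral; congr fine; apply: ae_eq_integral => //.
  - by apply/measurable_EFinP; apply: measurable_funM.
  - by apply/measurable_EFinP; apply: measurable_funM.
  have m1 : measurable [set x | g0 x < 0].
    rewrite (_ : [set x | g0 x < 0] = setT `&` g0 @^-1` `]-oo, 0[).
      by apply: mg0 => //; exact: measurable_itv.
    by rewrite setTI; apply/seteqP; split => x /=; rewrite in_itv.
  have m2 : measurable [set x | 1 - g0 x < 0].
    rewrite (_ : [set x | 1 - g0 x < 0] = setT `&` g0 @^-1` `]1, +oo[).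
      by apply: mg0 => //; exact: measurable_itv.
    by rewrite setTI; apply/seteqP; split => x /=; rewrite in_itv /= andbT subr_lt0.
  exists ([set x | g0 x < 0] `|` [set x | 1 - g0 x < 0]); split.
  - exact: measurableU.
  - apply/eqP; rewrite -measure_le0; apply: le_trans (measureU2 mu m1 m2) _.
    by rewrite [X in (X + _)%E]N1 [X in (_ + X)%E]N2 adde0.
  - move=> x /= nx; apply: contrapT => /not_orP[/negP nx1 /negP nx2]; apply: nx => _.
    rewrite mulrC /g; congr (_ * _)%:E; rewrite -!leNgt in nx1 nx2.
    by rewrite min_r ?max_r//; lra.
exists g => //.
have pgW := pairing_wball ug.
have simple (s : {sfun T >-> R}) : L1 mu s -> phi s = pairing g s.
  move=> Is; pose S : seq R := finmap.enum_fset (fset_set (range s)).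
  pose t (i : nat) x : R := S`_i * \1_(s @^-1` [set S`_i]) x.
  have mt i : measurable (s @^-1` [set S`_i]) by exact: measurable_funPTI.
  have It i : L1 mu (t i) by apply: L1Z; exact: L1_indic.
  have sE : (s : T -> R) = fun x => \sum_(0 <= i < size S) t i x.
    by apply/funext => x; rewrite big_mkord; exact: fimfunEord.
  rewrite sE; have [_ ->] := phi_sum (size S) It.
  have : forall n, L1 mu (fun x => \sum_(0 <= i < n) t i x) /\
      pairing g (fun x => \sum_(0 <= i < n) t i x) = \sum_(0 <= i < n) pairing g (t i).
    elim=> [|n [IH1 IH2]].
      have -> : (fun x => \sum_(0 <= i < 0) t i x) = fun=> 0.
        by apply/funext => x; rewrite big_geq.
      split; first exact: L1_cst.
      rewrite big_geq// pairingE; last exact: L1_cst.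
      rewrite (_ : (fun x => _) = fun=> 0) ?Rintegral_cst ?mul0r//.
      by apply/funext => x; rewrite mulr0.
    have -> : (fun x => \sum_(0 <= i < n.+1) t i x) =
        (fun x => \sum_(0 <= i < n) t i x) \+ t n.
      by apply/funext => x; rewrite big_nat_recr.
    split; first exact: L1D.
    by case: pgW => _ -> // _ _; rewrite IH2 big_nat_recr.
  move=> /(_ (size S)) [_ ->]; apply: eq_bigr => i _.
  rewrite /t phiZ; last exact: L1_indic.
  case: pgW => _ _ -> //; last exact: L1_indic.
  by rewrite pairingE ?gE//; exact: L1_indic.
apply/funext => h; have [Ih|nIh] := pselect (L1 mu h); last first.
  by case: phiW => -> // _ _ _; case: pgW => ->.
have [s_ [Is _ sh]] := approximation_sfun_integrable measurableT Ih.
apply/eqP; rewrite -subr_eq0 -normr_le0; apply/ler_addgt0Pr => e e0.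
rewrite add0r; have e20 : 0 < e / 2 by lra.
have /fine_cvg /cvgrPdist_le /(_ _ e20) [N _ /(_ _ (leqnn N))] := sh.
have Isn : L1 mu (s_ N) by exact: Is.
rewrite sub0r normrN /= => le_e.
have Id : L1 mu (h \- s_ N) by exact: L1B.
have Jle : \int[mu]_x `|(h \- s_ N) x| <= e / 2 by apply: le_trans (ler_norm _) le_e.
have pgB : pairing g (h \- s_ N) = pairing g h - pairing g (s_ N).
  rewrite !pairingE// -RintB; [|exact: L1_unit..].
  by congr Rintegral; apply/funext => x; rewrite /= mulrBr.
have e1 := wball_le Id.
have e2 : `|pairing g (h \- s_ N)| <= \int[mu]_x `|(h \- s_ N) x|.
  rewrite pairingE//; apply: le_trans (le_normr_Rintegral measurableT (L1_unit ug Id)) _.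
  apply: le_Rint; [exact: L1_norm (L1_unit ug Id) | exact: L1_norm|].
  move=> x; rewrite normrM; have /andP[g1 g2] := ug.2 x.
  by rewrite (ger0_norm g1) ler_piMl.
have -> : phi h - pairing g h = phi (h \- s_ N) - pairing g (h \- s_ N).
  by rewrite phiB// pgB simple//; ring.
by apply: le_trans (ler_normB _ _) _; lra.
Qed.

End Representation.

(** By [wball_le] the coordinate [h] stays in the interval of radius [b h], so a closed set sits
    inside a product of compact intervals. *)
Lemma wball_compact : compact wball /\ closed wball.
Proof.
have pc h : continuous (fun phi : {ptws (T -> R) -> R} => phi h).
  exact: (@proj_continuous (T -> R) (fun=> R) h).
have clW : closed wball.
  have clE := @closed_eq_fun {ptws (T -> R) -> R} R.
  have clL := @closed_le_fun {ptws (T -> R) -> R} R.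
  have cst := @continuous_cst_fun {ptws (T -> R) -> R} R.
  have clos (Q : set {ptws (T -> R) -> R}) phi : closed Q -> wball `<=` Q ->
      closure wball phi -> Q phi.
    by move=> cQ WQ Wp; apply: cQ; exact: closure_subset Wp.
  move=> phi Wphi; split.
  - move=> h nh; apply: (clos _ phi (clE (fun p => p h) (fun=> 0) (pc h) (cst 0))) => //.
    by move=> p [+ _ _ _]; exact.
  - move=> h1 h2 I1 I2.
    apply: (clos _ phi (clE (fun p => p (h1 \+ h2)) (fun p => p h1 + p h2) (pc _) _)) => //.
      exact: (@continuous_add_fun {ptws (T -> R) -> R}).
    by move=> p [_ + _ _]; exact.
  - move=> c h Ih.
    apply: (clos _ phi (clE (fun p => p (fun x => c * h x)) (fun p => c * p h) (pc _) _)) => //.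
      exact: (@continuous_mul_fun {ptws (T -> R) -> R}).
    by move=> p [_ _ + _]; exact.
  - move=> h Ih h0; apply/andP; split.
      apply: (clos _ phi (clL (fun=> 0) (fun p => p h) (cst 0) (pc h))) => //.
      by move=> p [_ _ _ +] /=; move=> /(_ h Ih h0)/andP[].
    apply: (clos _ phi (clL (fun p => p h) (fun=> Rintegral mu setT h) (pc h) (cst _))) => //.
    by move=> p [_ _ _ +] /=; move=> /(_ h Ih h0)/andP[].
split => //.
pose b h : R := if `[< L1 mu h >] then \int[mu]_x `|h x| else 0.
have cB : compact [set phi : {ptws (T -> R) -> R} | forall h, (`[- b h, b h]%classic) (phi h)].
  by apply: (@tychonoff (T -> R) (fun=> R) (fun h => (`[- b h, b h]%classic))) => h; exact: segment_compact.
apply: subclosed_compact clW cB _ => phi Wphi h /=.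
rewrite in_itv /= -ler_norml /b; case: asboolP => [Ih|nIh]; first exact: wball_le.
by case: Wphi => -> //; rewrite normr0.
Qed.

End WeakStarBall.

Lemma continuous_ptws (Z : topologicalType) (I : Type) (V : topologicalType)
    (f : Z -> {ptws I -> V}) :
  (forall i, continuous (fun z => f z i)) -> continuous f.
Proof.
move=> cf z; apply/cvg_sup => i U [B [[W oW <-] Wfz] WU].
by apply: (filterS WU); apply: cf; apply: open_nbhs_nbhs.
Qed.

Lemma perturb01 (R : realType) (k u v : R) : k <= u <= 1 - k -> `|v| <= k ->
  0 <= u + v <= 1 /\ 0 <= u - v <= 1.
Proof.
by rewrite ler_norml => /andP[? ?] /andP[? ?]; split; apply/andP; split; lra.
Qed.

(** * Integrals over sets for an arbitrary family of densities *)

Section Lyapunov.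
Context d (T : measurableType d) (R : realType).
Variable mu : {finite_measure set T -> \bar R}.
Variables (I : Type) (h : I -> T -> R).
Hypothesis Ih : forall i, L1 mu (h i).
(** For finitely many [h i] and a nonatomic measure this would be a dimension count; for an
    arbitrary family it is a genuine assumption. *)
Hypothesis annihilator : forall E, measurable E -> mu E != 0 ->
  exists r : T -> R, [/\ measurable_fun setT r, exists M, forall x, `|r x| <= M,
    forall x, ~ E x -> r x = 0, mu [set x | r x != 0] != 0 &
    forall i, \int[mu]_x (r x * h i x) = 0].

Lemma unit_fun_set (g : T -> R) : unit_fun g ->
  exists2 G, measurable G & forall i, \int[mu]_(x in G) h i x = \int[mu]_x (g x * h i x).
Proof.
move=> ug; have [cW clW] := wball_compact mu.
pose Q i : set {ptws (T -> R) -> R} := [set phi | phi (h i) = pairing mu g (h i)].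
have clQ : closed (\bigcap_i Q i).
  apply: closed_bigI => i _.
  apply: (@closed_comp _ _ (fun phi : {ptws (T -> R) -> R} => phi (h i))
    [set x | x = pairing mu g (h i)]); last exact: closed_eq.
  by move=> x _; exact: (@proj_continuous (T -> R) (fun=> R) (h i)).
have clK : closed (wball mu `&` \bigcap_i Q i) by exact: closedI.
have cK : compact (wball mu `&` \bigcap_i Q i).
  by apply: subclosed_compact clK cW _; exact: subIsetl.
have [|phi [phiW phiQ] ext] := extreme_point cK clK.
  by exists (pairing mu g); split => //; exact: pairing_wball.
have [f uf phiE] := wball_repr phiW.
have [mf f01] := uf.
have fin_null : mu [set x | 0 < f x < 1] = 0.
  (* These sets exhaust the set where f lies strictly between 0 and 1, and on [E n] a perturbation
     of size at most 1/(n+1) stays within [0, 1]. *)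
  pose E n := [set x | n.+1%:R^-1 <= f x <= 1 - n.+1%:R^-1 ].
  have mE n : measurable (E n).
    rewrite (_ : E n = setT `&` f @^-1` `[n.+1%:R^-1, 1 - n.+1%:R^-1]).
      by apply: mf => //; exact: measurable_itv.
    by rewrite setTI; apply/seteqP; split => x /=; rewrite in_itv.
  have mF : measurable [set x | 0 < f x < 1].
    rewrite (_ : [set x | 0 < f x < 1] = setT `&` f @^-1` `]0, 1[).
      by apply: mf => //; exact: measurable_itv.
    by rewrite setTI; apply/seteqP; split => x /=; rewrite in_itv.
  apply: (proj1 (@negligibleP _ _ _ mu _ mF)).
  apply: (@negligibleS _ _ _ mu (\bigcup_n E n)).
    move=> x /= /andP[f0 f1]; pose a := Num.min (f x) (1 - f x).
    have a0 : 0 < a by rewrite lt_min f0 subr_gt0.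
    exists (truncn a^-1) => //.
    have : (truncn a^-1).+1%:R^-1 <= a.
      by rewrite invf_ple// ?posrE// ltW// truncnS_gt.
    by rewrite le_min => /andP[Ha Hb]; rewrite /E /= Ha lerBrDr addrC -lerBrDr.
  apply: (@negligible_bigcup _ _ _ mu) => n; apply: (proj2 (@negligibleP _ _ _ mu _ (mE n))).
  apply/eqP/negPn/negP => En0.
  have [r [mr [M rM] rE r0 rh]] := annihilator (mE n) En0.
  (* Chosen so that |c r| <= 1/(n+1); the added 1 keeps the denominator positive. *)
  pose c : R := (n.+1%:R * (`|M| + 1))^-1.
  have cr x : `|c * r x| <= n.+1%:R^-1.
    rewrite /c normrM ger0_norm; last by rewrite invr_ge0 mulr_ge0// addr_ge0.
    rewrite invfM -mulrA ler_piMr// ?invr_ge0//.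
    rewrite mulrC ler_pdivrMr ?mul1r; last by rewrite ltr_wpDl.
    by apply: (le_trans (rM x)); apply: (le_trans (ler_norm _)); rewrite lerDl.
  have mcr : measurable_fun setT (fun x => c * r x) by apply: measurable_funM.
  have bcr : exists M, forall x, `|c * r x| <= M by exists n.+1%:R^-1.
  have up : unit_fun (fun x => f x + c * r x).
    split; first exact: measurable_funD.
    move=> x; have [Ex|/rE ->] := pselect (E n x); last by rewrite mulr0 addr0.
    by have [] := perturb01 Ex (cr x).
  have um : unit_fun (fun x => f x - c * r x).
    split; first exact: measurable_funB.
    move=> x; have [Ex|/rE ->] := pselect (E n x); last by rewrite mulr0 subr0.
    by have [] := perturb01 Ex (cr x).
  have bM : exists M, forall x, `|r x| <= M by exists M.
  (* The direction of the perturbation in the product space, with the default value of [pairing]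
     outside L1, so that adding it to [phi] gives again a pairing. *)
  pose delta k : R := if `[< L1 mu k >] then \int[mu]_x ((c * r x) * k x) else 0.
  have deltah i : delta (h i) = 0.
    rewrite /delta asboolT//.
    under eq_Rintegral do rewrite -mulrA.
    by rewrite RintZ ?rh ?mulr0//; exact: L1M.
  have dp : (fun k => phi k + delta k) = pairing mu (fun x => f x + c * r x).
    apply/funext => k; rewrite phiE /pairing /delta; case: asboolP => Ik; last by rewrite addr0.
    rewrite -RintD; [|exact: L1_unit|exact: L1M].
    by congr Rintegral; apply/funext => x; rewrite mulrDl.
  have dm : (fun k => phi k - delta k) = pairing mu (fun x => f x - c * r x).
    apply/funext => k; rewrite phiE /pairing /delta; case: asboolP => Ik; last by rewrite subr0.
    rewrite -RintB; [|exact: L1_unit|exact: L1M].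
    by congr Rintegral; apply/funext => x; rewrite mulrBl.
  have Ir : L1 mu r by apply: L1_bounded => //; exists M.
  (* The coordinates are indexed by all functions, [r] included; there [delta] is c times the
     integral of r^2, which forces r to vanish almost everywhere. *)
  have d0 : delta r = 0.
    apply: ext.
      split; first by rewrite dp; exact: pairing_wball.
      by move=> i _; rewrite /Q /= deltah addr0; exact: phiQ.
    split; first by rewrite dm; exact: pairing_wball.
    by move=> i _; rewrite /Q /= deltah subr0; exact: phiQ.
  move/negP: r0; apply; apply/eqP.
  have -> : [set x | r x != 0] = [set x | r x * r x != 0].
    by apply/seteqP; split => x /=; rewrite mulf_eq0 orbb.
  apply: (@Rint_gt0_null _ _ _ mu (fun x => r x * r x)).
  - exact: L1M.
  - by move=> x; rewrite -expr2 sqr_ge0.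
  - have c0 : c != 0.
      by rewrite /c invr_eq0 mulf_neq0// gt_eqF// ltr_wpDl.
    move: d0; rewrite /delta asboolT//.
    under eq_Rintegral do rewrite -mulrA.
    rewrite RintZ; last exact: L1M.
    by move=> /eqP; rewrite mulf_eq0 (negbTE c0) => /eqP.
(* Off a null set [f] takes only the values 0 and 1, so it agrees there with the indicator of this
   set. *)
have mG : measurable [set x | 1 <= f x].
  rewrite (_ : [set x | 1 <= f x] = setT `&` f @^-1` `[1, +oo[).
    by apply: mf => //; exact: measurable_itv.
  by rewrite setTI; apply/seteqP; split => x /=; rewrite in_itv /= andbT.
exists [set x | 1 <= f x] => // i.
have := phiQ i Logic.I; rewrite /Q /= phiE !pairingE// => <-.
have mh := L1_measurable (Ih i).
rewrite Rint_in /Rintegral; congr fine; apply: ae_eq_integral => //.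
- by apply/measurable_EFinP; apply: measurable_funM.
- by apply/measurable_EFinP; apply: measurable_funM.
exists [set x | 0 < f x < 1]; split => //.
  rewrite (_ : [set x | 0 < f x < 1] = setT `&` f @^-1` `]0, 1[).
    by apply: mf => //; exact: measurable_itv.
  by rewrite setTI; apply/seteqP; split => x /=; rewrite in_itv.
move=> x /= nx; apply: contrapT => /negP f_nint; apply: nx => _.
congr (_ * _)%:E; have /andP[f0 f1] := f01 x.
rewrite indicE; case: (boolP (x \in _)); first by rewrite inE /= => f1'; apply/le_anti; rewrite f1 f1'.
move=> /negP; rewrite inE /= => /negP; rewrite -ltNge => f1'.
by move: f_nint; rewrite f1' andbT -leNgt => f0'; apply/le_anti; rewrite f0 f0'.
Qed.

(** Restriction to the coordinates [h i] is continuous on [wball], and by [unit_fun_set] indicators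
    already produce its whole image. *)
Lemma compact_range : compact
  ([set (fun i => \int[mu]_(x in G) h i x) | G in measurable] : set {ptws I -> R}).
Proof.
pose F (phi : {ptws (T -> R) -> R}) : {ptws I -> R} := fun i => phi (h i).
have -> : [set (fun i => \int[mu]_(x in G) h i x) | G in measurable] = F @` wball mu.
  apply/seteqP; split => [_ [G mG <-]|_ [phi phiW <-]].
    have uG : unit_fun (\1_G : T -> R).
      by split => // x; rewrite indicE; case: (_ \in _); rewrite lexx ler01.
    exists (pairing mu (\1_G : T -> R)); first refine (pairing_wball mu uG).
    by rewrite /F; apply: (@funext I R) => i; rewrite pairingE// [RHS]Rint_in.
  have [g ug ->] := wball_repr phiW.
  have [G mG GE] := unit_fun_set ug.
  by exists G => //; rewrite /F; apply: (@funext I R) => i; rewrite GE pairingE.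
apply: continuous_compact; last by have [] := wball_compact mu.
apply: continuous_subspaceT; apply: continuous_ptws => i.
exact: (@proj_continuous (T -> R) (fun=> R) (h i)).
Qed.

End Lyapunov.

(** * Operators on a Hilbert space *)

Section InnerProduct.
Context (R : realType) (H : completeNormedModType R[i]) (dot : {dot H for conjC}).
Hypothesis dot_norm : forall x : H, `|x| ^+ 2 = dot x x.
Implicit Types (x y z : H) (A B : bop H) (a b : R) (c : R[i]).

Lemma dotDl x y z : dot (x + y) z = dot x z + dot y z.
Proof. by rewrite linearDl. Qed.

Lemma dotDr x y z : dot z (x + y) = dot z x + dot z y.
Proof. by rewrite linearDr. Qed.

Lemma dotBl x y z : dot (x - y) z = dot x z - dot y z.
Proof. by rewrite linearBl. Qed.

Lemma dotBr x y z : dot z (x - y) = dot z x - dot z y.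
Proof. by rewrite linearBr. Qed.

Lemma dotZl c x y : dot (c *: x) y = c * dot x y.
Proof. by rewrite linearZl_LR. Qed.

Lemma dotZr c x y : dot x (c *: y) = conjc c * dot x y.
Proof. by rewrite linearZr_LR. Qed.

Lemma dot_suml n (u : nat -> H) y :
  dot (\sum_(0 <= k < n) u k) y = \sum_(0 <= k < n) dot (u k) y.
Proof.
apply: (big_morph (fun x => dot x y)) => [x z|]; first exact: dotDl.
exact: linear0l.
Qed.

Lemma dotC x y : dot x y = conjc (dot y x).
Proof. by rewrite hermC expr0 mul1r. Qed.

(** The norm takes its values in [R[i]]; its real part loses nothing ([nrmE]) and allows real
    arithmetic. *)
Definition nrm x : R := complex.Re `|x|.
Definition rdot x y : R := complex.Re (dot x y).

Lemma nrmE x : `|x| = (nrm x)%:C.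
Proof. by rewrite /nrm RRe_real// ger0_real. Qed.

Lemma nrm_ge0 x : 0 <= nrm x.
Proof. by rewrite -ler0c -nrmE. Qed.

Lemma nrm0 : nrm 0 = 0.
Proof. by rewrite /nrm normr0. Qed.

Lemma nrm_eq0 x : (nrm x == 0) = (x == 0).
Proof. by rewrite -[in RHS]normr_eq0 nrmE (inj_eq (@complexI R) _ 0). Qed.

Lemma nrmD x y : nrm (x + y) <= nrm x + nrm y.
Proof. by rewrite -lecR rmorphD /= -!nrmE ler_normD. Qed.

Lemma nrmN x : nrm (- x) = nrm x.
Proof. by rewrite /nrm normrN. Qed.

Lemma nrmB x y : nrm (x - y) <= nrm x + nrm y.
Proof. by rewrite -(nrmN y) nrmD. Qed.

Lemma nrmBC x y : nrm (x - y) = nrm (y - x).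
Proof. by rewrite -nrmN opprB. Qed.

Lemma nrmZ c x : nrm (c *: x) = complex.Re `|c| * nrm x.
Proof.
apply: (@complexI R); rewrite rmorphM /= -nrmE normrZ nrmE; congr (_ * _).
Qed.

Lemma nrmZr a x : nrm (a%:C *: x) = `|a| * nrm x.
Proof.
rewrite nrmZ; congr (_ * _).
by rewrite normc_def /= expr0n addr0 sqrtr_sqr.
Qed.

Lemma dotxx x : dot x x = ((nrm x) ^+ 2)%:C.
Proof. by rewrite -dot_norm nrmE rmorphXn. Qed.

Lemma rdotxx x : rdot x x = nrm x ^+ 2.
Proof. by rewrite /rdot dotxx. Qed.

Lemma rdotC x y : rdot x y = rdot y x.
Proof. by rewrite /rdot dotC; case: (dot y x). Qed.

Lemma ReD c1 c2 : complex.Re (c1 + c2) = complex.Re c1 + complex.Re c2.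
Proof. by case: c1; case: c2. Qed.
Lemma ImD c1 c2 : complex.Im (c1 + c2) = complex.Im c1 + complex.Im c2.
Proof. by case: c1; case: c2. Qed.
Lemma ReN c : complex.Re (- c) = - complex.Re c.
Proof. by case: c. Qed.
Lemma ImN c : complex.Im (- c) = - complex.Im c.
Proof. by case: c. Qed.
Lemma ReZ a c : complex.Re (a%:C * c) = a * complex.Re c.
Proof. by case: c => p q; simpc. Qed.
Lemma ImZ a c : complex.Im (a%:C * c) = a * complex.Im c.
Proof. by case: c => p q; simpc. Qed.

Lemma rdotDl x y z : rdot (x + y) z = rdot x z + rdot y z.
Proof. by rewrite /rdot dotDl ReD. Qed.

Lemma rdotDr x y z : rdot z (x + y) = rdot z x + rdot z y.
Proof. by rewrite /rdot dotDr ReD. Qed.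

Lemma rdot0l y : rdot 0 y = 0.
Proof. by rewrite /rdot linear0l. Qed.

Lemma rdotZl a x y : rdot (a%:C *: x) y = a * rdot x y.
Proof. by rewrite /rdot dotZl ReZ. Qed.

Lemma rdotZr a x y : rdot x (a%:C *: y) = a * rdot x y.
Proof. by rewrite rdotC rdotZl rdotC. Qed.

Lemma rdotNl x y : rdot (- x) y = - rdot x y.
Proof. by rewrite -scaleN1r -[-1](rmorphN1 (real_complex R)) rdotZl mulN1r. Qed.

Lemma rdotNr x y : rdot x (- y) = - rdot x y.
Proof. by rewrite rdotC rdotNl rdotC. Qed.

Lemma nrmDsq x y : nrm (x + y) ^+ 2 = nrm x ^+ 2 + 2 * rdot x y + nrm y ^+ 2.
Proof.
rewrite -!rdotxx !rdotDl !rdotDr (rdotC y x); ring.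
Qed.

Lemma nrmBsq x y : nrm (x - y) ^+ 2 = nrm x ^+ 2 - 2 * rdot x y + nrm y ^+ 2.
Proof. by rewrite nrmDsq rdotNr nrmN; ring. Qed.

(** Reduces statements about imaginary parts to statements about [rdot]. *)
Lemma Im_dot x y : complex.Im (dot x y) = rdot x ('i *: y).
Proof. by rewrite /rdot dotZr; case: (dot x y) => p q; simpc. Qed.

Lemma nrmi x : nrm ('i *: x) = nrm x.
Proof. by rewrite nrmZ normc_def /= expr0n expr1n add0r sqrtr1 mul1r. Qed.

Lemma rdot_CS x y : `|rdot x y| <= nrm x * nrm y.
Proof.
have key (u v : H) : nrm u = 1 -> nrm v = 1 -> `|rdot u v| <= 1.
  move=> u1 v1; rewrite ler_norml.
  have := sqr_ge0 (nrm (u + v)); have := sqr_ge0 (nrm (u - v)).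
  rewrite nrmBsq nrmDsq u1 v1 => *; apply/andP; split; lra.
have [->|x0] := eqVneq x 0.
  by rewrite rdot0l normr0 mulr_ge0 ?nrm_ge0.
have [->|y0] := eqVneq y 0.
  by rewrite rdotC rdot0l normr0 mulr_ge0 ?nrm_ge0.
have nx : 0 < nrm x by rewrite lt0r nrm_eq0 x0 nrm_ge0.
have ny : 0 < nrm y by rewrite lt0r nrm_eq0 y0 nrm_ge0.
have := key ((nrm x)^-1%:C *: x) ((nrm y)^-1%:C *: y).
rewrite !nrmZr !normfV !(ger0_norm (nrm_ge0 _)) !mulVf ?gt_eqF// => /(_ erefl erefl).
rewrite rdotZl rdotZr !normrM !normfV !(ger0_norm (nrm_ge0 _)) mulrA -invfM.
by rewrite mulrC ler_pdivrMr ?mulr_gt0// mul1r.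
Qed.

Lemma Re_dot_CS x y : `|complex.Re (dot x y)| <= nrm x * nrm y.
Proof. exact: rdot_CS. Qed.

Lemma Im_dot_CS x y : `|complex.Im (dot x y)| <= nrm x * nrm y.
Proof. by rewrite Im_dot -(nrmi y) rdot_CS. Qed.

Lemma bop_ext A B : (forall x, A x = B x) -> A = B.
Proof. by move=> AB; apply: val_inj; apply/funext. Qed.

Lemma bopP A c x y : A (c *: x + y) = c *: A x + A y.
Proof. by have /bounded_linearP[+ _] := valP A; exact. Qed.

Lemma bopD A x y : A (x + y) = A x + A y.
Proof. by have := bopP A 1 x y; rewrite !scale1r. Qed.

Lemma bop0 A : A 0 = 0.
Proof. by apply: (addrI (A 0)); rewrite -bopD !addr0. Qed.

Lemma bopZ A c x : A (c *: x) = c *: A x.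
Proof. by have := bopP A c x 0; rewrite addr0 bop0 addr0. Qed.

Lemma bopN A x : A (- x) = - A x.
Proof. by rewrite -scaleN1r bopZ scaleN1r. Qed.

Lemma bopB A x y : A (x - y) = A x - A y.
Proof. by rewrite bopD bopN. Qed.

Lemma bop_sum A n (u : nat -> H) (P : pred nat) :
  A (\sum_(0 <= k < n | P k) u k) = \sum_(0 <= k < n | P k) A (u k).
Proof. by apply: (big_morph A (bopD A) (bop0 A)). Qed.

Lemma bopDE A B x : (A + B) x = A x + B x. Proof. by []. Qed.
Lemma bopZE c A x : (c *: A) x = c *: A x. Proof. by []. Qed.
Lemma bopBE A B x : (A - B) x = A x - B x. Proof. by []. Qed.
Lemma bcompE A B x : (A *o B) x = A (B x). Proof. by []. Qed.
Lemma bop0E x : (0 : bop H) x = 0. Proof. by []. Qed.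
Lemma bidE x : bid H x = x. Proof. by []. Qed.

Definition opbound A a := forall x, nrm (A x) <= a * nrm x.

Lemma bop_bounded A : exists2 a, 0 <= a & opbound A a.
Proof.
have /bounded_linearP[_ [M AM]] := valP A.
exists `|complex.Re M| => // x.
have := AM x; rewrite !nrmE lecE => /andP[_].
have -> : complex.Re (M * (nrm x)%:C) = complex.Re M * nrm x.
  by case: M {AM} => p q; simpc.
move=> /le_trans; apply; apply: ler_wpM2r; first exact: nrm_ge0.
exact: ler_norm.
Qed.

Fact bop_of_subproof (f : H -> H) a :
  linear f -> (forall x, nrm (f x) <= a * nrm x) -> f \in @bounded_linear R H.
Proof.
move=> fl fa; apply/bounded_linearP; split => //; exists a%:C => x.
by rewrite !nrmE -rmorphM /= lecR.
Qed.

Local Notation pos := (positive_op dot).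

Lemma positiveP A : pos A <-> (forall x, 0 <= rdot (A x) x) /\
  (forall x, complex.Im (dot (A x) x) = 0).
Proof.
split=> [pA|[A0 A1] x]; last by rewrite lecE /= A1 eqxx; exact: A0.
by split=> x; have := pA x; rewrite lecE => /andP[/eqP + +].
Qed.

(** Polarization: the quadratic form is real at x + y and at x + i y, which compares the imaginary
    and the real parts of the two sides. *)
Lemma positive_selfadjoint A : pos A -> forall x y, dot (A x) y = dot x (A y).
Proof.
move=> /positiveP[_ A1] x y.
have A1x := A1 x; have A1y := A1 y.
have := A1 (x + y); have := A1 (x + 'i *: y).
rewrite !bopD !bopZ !dotDl !dotDr !dotZl !dotZr !ImD A1x.
rewrite (dotC x (A y)); move: A1y.
case: (dot (A y) y) => p q /=; case: (dot (A x) y) => a b; case: (dot (A y) x) => a' b'.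
simpc => /= -> h1 h2; congr (_ +i* _); move: h1 h2; rewrite ?mulr0 ?mul0r; lra.
Qed.

Lemma selfadjoint_positive A : (forall x y, dot (A x) y = dot x (A y)) ->
  (forall x, 0 <= rdot (A x) x) -> pos A.
Proof.
move=> sA A0; apply/positiveP; split => // x.
have := dotC (A x) x; rewrite -sA; case: (dot _ _) => p q [] /=; lra.
Qed.

Lemma positive_rdot A : pos A -> forall x y, rdot (A x) y = rdot x (A y).
Proof. by move=> pA x y; rewrite /rdot (positive_selfadjoint pA). Qed.

Lemma positiveD A B : pos A -> pos B -> pos (A + B).
Proof. by move=> pA pB x; rewrite bopDE dotDl addr_ge0. Qed.

Lemma positiveZ a A : 0 <= a -> pos A -> pos (a%:C *: A).
Proof. by move=> a0 pA x; rewrite bopZE dotZl mulr_ge0// ler0c. Qed.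

Lemma opbound_positive_rdot A a x : opbound A a -> rdot (A x) x <= a * nrm x ^+ 2.
Proof.
move=> Aa; apply: le_trans (ler_norm _) _; apply: le_trans (rdot_CS _ _) _.
by rewrite expr2 mulrA ler_wpM2r ?nrm_ge0.
Qed.

(* A(a - A) = ((a - A)A(a - A) + A(a - A)A) / a is positive. *)
Lemma positive_nrm_le A a : pos A -> 0 < a ->
  (forall x, rdot (A x) x <= a * nrm x ^+ 2) ->
  forall x, nrm (A x) ^+ 2 <= a * rdot (A x) x.
Proof.
move=> pA a0 Aa x; have /positiveP[A0 _] := pA.
pose y := a%:C *: x - A x.
have h1 := A0 y; have h2 := Aa (A x).
suff : 0 <= a * (a * rdot (A x) x - nrm (A x) ^+ 2) by rewrite pmulr_rge0// subr_ge0.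
have -> : a * (a * rdot (A x) x - nrm (A x) ^+ 2) =
    rdot (A y) y + (a * nrm (A x) ^+ 2 - rdot (A (A x)) (A x)).
  rewrite /y !bopB !bopZ !rdotDl !rdotDr !rdotNl !rdotNr !rdotZl !rdotZr.
  rewrite -!rdotxx (positive_rdot pA (A x) x); ring.
by rewrite addr_ge0// subr_ge0.
Qed.

(** For a > 0, |A x|^2 <= a <A x, x> <= a^2 |x|^2. For a = 0 the previous lemma is applied with the
    constant 1, which gives |A x|^2 <= <A x, x> <= 0. *)
Lemma positive_opbound A a : pos A -> 0 <= a ->
  (forall x, rdot (A x) x <= a * nrm x ^+ 2) -> opbound A a.
Proof.
move=> pA; rewrite le_eqVlt => /predU1P[<-|a0] Aa x.
  have /positiveP[A0 _] := pA.
  have Ax0 y : rdot (A y) y <= 0 by have := Aa y; rewrite mul0r.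
  have [n0|] := ltP 0 (nrm (A x)); last by rewrite mul0r.
  have Ax1 y : rdot (A y) y <= 1 * nrm y ^+ 2.
    by rewrite mul1r; apply: le_trans (Ax0 y) (sqr_ge0 _).
  have := positive_nrm_le pA ltr01 Ax1 x; rewrite mul1r => /le_trans /(_ (Ax0 x)).
  by rewrite leNgt exprn_gt0.
rewrite -ler_sqr ?nnegrE; [|exact: nrm_ge0|by rewrite mulr_ge0 ?nrm_ge0 ?ltW].
apply: le_trans (positive_nrm_le pA a0 Aa x) _.
by rewrite exprMn expr2 -mulrA ler_pM2l.
Qed.

End InnerProduct.

(** * Limits in the Hilbert space *)

Section HilbertLimits.
Context (R : realType) (H : completeNormedModType R[i]) (dot : {dot H for conjC}).
Hypothesis dot_norm : forall x : H, `|x| ^+ 2 = dot x x.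
Implicit Types (x y z l : H) (u v : nat -> H) (A B : bop H) (a b : R).

Lemma cvg_nrm u l :
  (u n @[n --> \oo] --> l) <-> (nrm (u n - l) @[n --> \oo] --> (0 : R)).
Proof.
split.
  move=> /cvgrPdist_lt ul; apply/cvgrPdist_lt => e e0.
  have := ul e%:C; rewrite ltcR => /(_ e0); apply: filterS => n.
  by rewrite sub0r normrN (ger0_norm (nrm_ge0 _)) nrmBC nrmE ltcR.
move=> /cvgrPdist_lt ul; apply/cvgrPdist_lt => e e0.
have [e1 eE] : 0 < complex.Re e /\ e = (complex.Re e)%:C.
  by case: e e0 => p q; rewrite ltcE /= => /andP[/eqP -> p0].
have := ul _ e1; apply: filterS => n.
by rewrite sub0r normrN (ger0_norm (nrm_ge0 _)) nrmBC -ltcR -nrmE -eE.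
Qed.

Lemma squeeze0 (f g : nat -> R) : (forall n, 0 <= f n <= g n) ->
  g n @[n --> \oo] --> (0 : R) -> f n @[n --> \oo] --> (0 : R).
Proof.
move=> fg g0; apply: (@squeeze_cvgr _ _ _ _ (fun=> 0) g) => //; last exact: cvg_cst.
exact: nearW.
Qed.

Lemma cvgH_unique u l l' : u n @[n --> \oo] --> l -> u n @[n --> \oo] --> l' -> l = l'.
Proof. by move=> ul ul'; exact: (cvg_unique (@norm_hausdorff _ H) ul ul'). Qed.

Lemma cvg_bop A u l : u n @[n --> \oo] --> l -> A (u n) @[n --> \oo] --> A l.
Proof.
move=> /cvg_nrm ul; apply/cvg_nrm; have [a a0 Aa] := bop_bounded A.
apply: (@squeeze0 _ (fun n => a * nrm (u n - l))).
  by move=> n; rewrite nrm_ge0 -bopB Aa.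
by rewrite -[0](mulr0 a); exact: cvgMl_tmp.
Qed.

Lemma nrm_sub_le x y : `|nrm x - nrm y| <= nrm (x - y).
Proof.
have h1 := nrmD (x - y) y; have h2 := nrmD (y - x) x; rewrite !subrK in h1 h2.
by rewrite (nrmBC y x) in h2; rewrite ler_norml; apply/andP; split; lra.
Qed.

Lemma cvg_of_nrm u l : u n @[n --> \oo] --> l -> nrm (u n) @[n --> \oo] --> nrm l.
Proof.
move=> /cvg_nrm ul; apply/cvgrPdist_le => e e0.
move/cvgrPdist_le : ul => /(_ _ e0); apply: filterS => n.
rewrite sub0r normrN (ger0_norm (nrm_ge0 _)) nrmBC; apply: le_trans.
exact: nrm_sub_le.
Qed.

(** Polarization writes [rdot] through norms, which are continuous. *)
Lemma cvg_rdot u v l l' : u n @[n --> \oo] --> l -> v n @[n --> \oo] --> l' ->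
  rdot dot (u n) (v n) @[n --> \oo] --> rdot dot l l'.
Proof.
move=> ul vl.
have E x y : rdot dot x y = 4^-1 * (nrm (x + y) * nrm (x + y) - nrm (x - y) * nrm (x - y)).
  by rewrite -!expr2 (nrmBsq dot_norm) (nrmDsq dot_norm); lra.
rewrite E; under eq_fun do rewrite E.
have hp : nrm (u n + v n) @[n --> \oo] --> nrm (l + l') by apply: cvg_of_nrm; exact: cvgD.
have hm : nrm (u n - v n) @[n --> \oo] --> nrm (l - l') by apply: cvg_of_nrm; exact: cvgB.
by apply: cvgMl_tmp; apply: cvgB; exact: cvgM.
Qed.

Lemma limr_le_cvg (f : nat -> R) (l a : R) : f n @[n --> \oo] --> l ->
  (\forall n \near \oo, f n <= a) -> l <= a.
Proof.
by move=> fl fa; rewrite -(cvg_lim _ fl)//; apply: limr_le => //; apply/cvg_ex; exists l.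
Qed.

Lemma limr_ge_cvg (f : nat -> R) (l a : R) : f n @[n --> \oo] --> l ->
  (\forall n \near \oo, a <= f n) -> a <= l.
Proof.
by move=> fl fa; rewrite -(cvg_lim _ fl)//; apply: limr_ge => //; apply/cvg_ex; exists l.
Qed.

Lemma cvg_nrm_le u l a : u n @[n --> \oo] --> l -> (forall n, nrm (u n) <= a) ->
  nrm l <= a.
Proof.
move=> /cvg_of_nrm ul ua; apply: (limr_le_cvg ul); exact: nearW.
Qed.

(** The steps telescope, so the distance of two terms of [u] is at most the difference of the
    corresponding terms of [y], and [u] is Cauchy. *)
Lemma complete_steps u (y : nat -> R) : cvgn y ->
  (forall n, nrm (u n.+1 - u n) <= y n.+1 - y n) -> cvgn u.
Proof.
move=> cy uy.
have mono n k : nrm (u (n + k)%N - u n) <= y (n + k)%N - y n.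
  elim: k => [|k IH]; first by rewrite addn0 !subrr nrm0.
  rewrite addnS.
  have -> : u (n + k).+1 - u n = (u (n + k).+1 - u (n + k)%N) + (u (n + k)%N - u n).
    by rewrite addrA subrK.
  by apply: le_trans (nrmD _ _) _; have := uy (n + k)%N; lra.
apply/cauchy_cvgP; apply: cauchy_exP => e e0.
have [e1 eE] : 0 < complex.Re e /\ e = (complex.Re e)%:C.
  by case: e e0 => p q; rewrite ltcE /= => /andP[/eqP -> p0].
have e2 : 0 < complex.Re e / 3 by lra.
have /cvg_ex[l yl] := cy.
move/cvgrPdist_lt : (yl) => /(_ _ e2) [N _ yN].
exists (u N); exists N => // n /= Nn.
rewrite -ball_normE /= eE nrmE ltcR nrmBC -(subnKC Nn).
apply: le_lt_trans (mono _ _) _.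
have := yN N (leqnn N); have := yN (N + (n - N))%N (leq_addr _ _).
rewrite /= !ltr_norml => /andP[? ?] /andP[? ?]; lra.
Qed.

End HilbertLimits.

(** * Square roots of positive operators *)

Section SquareRoot.
Context (R : realType) (H : completeNormedModType R[i]) (dot : {dot H for conjC}).
Hypothesis dot_norm : forall x : H, `|x| ^+ 2 = dot x x.
Implicit Types (x y z l : H) (A B : bop H) (a b : R).

Lemma opboundD A B a b : opbound A a -> opbound B b -> opbound (A + B) (a + b).
Proof.
move=> Aa Bb x; rewrite bopDE (le_trans (nrmD _ _))// mulrDl lerD//.
Qed.

Lemma opboundZ A a b : 0 <= b -> opbound A a -> opbound (b%:C *: A) (b * a).
Proof. by move=> b0 Aa x; rewrite bopZE nrmZr ger0_norm// -mulrA ler_wpM2l. Qed.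

Lemma opbound_comp A B a b : 0 <= a -> opbound A a -> opbound B b ->
  opbound (A *o B) (a * b).
Proof.
move=> a0 Aa Bb x; rewrite bcompE (le_trans (Aa _))// -mulrA ler_wpM2l//.
Qed.

Lemma opbound_le A a b : a <= b -> opbound A a -> opbound A b.
Proof. by move=> ab Aa x; rewrite (le_trans (Aa x))// ler_wpM2r// nrm_ge0. Qed.

Section Contraction.
Variable X : bop H.
Hypothesis X1 : opbound X 1.
Hypothesis Xsa : forall x y, dot (X x) y = dot x (X y).

Fixpoint rootseq n : bop H :=
  if n is n'.+1 then (2^-1 : R)%:C *: (X + rootseq n' *o rootseq n') else 0.

Fixpoint rootbound n : R :=
  if n is n'.+1 then 2^-1 * (1 + rootbound n' * rootbound n') else 0.

Let y_01 n : 0 <= rootbound n <= 1.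
Proof.
elim: n => [|n /andP[IH1 IH2]] /=; first by rewrite lexx ler01.
by apply/andP; split; nra.
Qed.

Let y_mono n : rootbound n <= rootbound n.+1.
Proof.
elim: n => [|n IH] /=; first lra.
have /andP[h1 h2] := y_01 n; have /andP[h3 h4] := y_01 n.+1.
rewrite ler_pM2l ?invr_gt0// lerD2l; exact: ler_pM.
Qed.

Let Y_bound n : opbound (rootseq n) (rootbound n).
Proof.
elim: n => [|n IH] /=; first by move=> x; rewrite bop0E nrm0 mul0r.
apply: opboundZ; first lra.
apply: opboundD => //; apply: opbound_comp => //.
by have /andP[] := y_01 n.
Qed.

(** The identity Y'^2 - Y^2 = Y' (Y' - Y) + (Y' - Y) Y, valid for operators and for scalars alike,
    makes the bound inductive without commuting Y and Y'. *)
Let Y_step n : opbound (rootseq n.+1 - rootseq n) (rootbound n.+1 - rootbound n).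
Proof.
elim: n => [|n IH].
  by rewrite /= !subr0; exact: Y_bound 1%N.
have /andP[h1 h2] := y_01 n; have /andP[h3 h4] := y_01 n.+1.
have h5 := y_mono n.
set Y' := rootseq n.+1; set Y := rootseq n.
have -> : rootseq n.+2 - Y' = (2^-1 : R)%:C *: (Y' *o (Y' - Y) + (Y' - Y) *o Y).
  apply: bop_ext => x.
  transitivity ((2^-1 : R)%:C *: (X x + Y' (Y' x)) - (2^-1 : R)%:C *: (X x + Y (Y x))) => //.
  rewrite bopZE bopDE !bcompE !bopBE bopB -scalerBr; congr (_ *: _).
  by rewrite subrKA opprD addrACA subrr add0r.
have -> : rootbound n.+2 - rootbound n.+1 = 2^-1 *
   (rootbound n.+1 * (rootbound n.+1 - rootbound n) +
    (rootbound n.+1 - rootbound n) * rootbound n).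
  transitivity (2^-1 * (1 + rootbound n.+1 * rootbound n.+1) -
    2^-1 * (1 + rootbound n * rootbound n)) => //.
  by move: (rootbound n.+1) (rootbound n) => p q; ring.
apply: opboundZ; first lra.
apply: opboundD; apply: opbound_comp => //; first exact: Y_bound.
  by rewrite subr_ge0.
exact: Y_bound.
Qed.

Let Y_sa n x y : dot (rootseq n x) y = dot x (rootseq n y).
Proof.
elim: n x y => [|n IH] x y.
  by rewrite [rootseq 0 x]bop0E [rootseq 0 y]bop0E linear0l linear0r.
have E u : rootseq n.+1 u = (2^-1 : R)%:C *: (X u + rootseq n (rootseq n u)) by [].
by rewrite !E dotZl dotZr dotDl dotDr Xsa !IH conjc_real.
Qed.

Let y_cvg : cvgn rootbound.
Proof.
apply: nondecreasing_is_cvgn; first exact/nondecreasing_seqP.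
by exists 1 => _ [n _ <-]; have /andP[] := y_01 n.
Qed.

Let Y_cvg x : cvgn (fun n => rootseq n x).
Proof.
apply: (@complete_steps _ _ _ (fun n => rootbound n * nrm x)).
  by apply: is_cvgMr_tmp; exact: y_cvg.
move=> n; rewrite -mulrBl; exact: Y_step.
Qed.

(* I - Y is the square root of I - X; Y is the limit of Y_(n+1) = (X + Y_n^2) / 2,
   and the increments of Y_n are dominated by those of the same scalar iteration. *)
Lemma contraction_root : exists Y : bop H,
  [/\ opbound Y 1, (forall x y, dot (Y x) y = dot x (Y y)) &
      forall x, 2%:C *: Y x = X x + Y (Y x)].
Proof.
pose f x : H := get [set l | rootseq n x @[n --> \oo] --> l].
have fP x : rootseq n x @[n --> \oo] --> f x.
  by have /cvg_ex h := @Y_cvg x; exact: (getPex h).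
have fl : linear f.
  move=> c x y; apply: (cvgH_unique (fP _)).
  under eq_fun do rewrite bopP.
  by apply: cvgD; [apply: cvgZl_tmp; exact: fP | exact: fP].
have f1 x : nrm (f x) <= 1 * nrm x.
  apply: (cvg_nrm_le (fP x)) => n; apply: le_trans (Y_bound n x) _.
  by rewrite ler_wpM2r ?nrm_ge0//; have /andP[] := y_01 n.
pose Y := Bop (bop_of_subproof fl f1).
exists Y; split => //.
  move=> x y.
  have h u v : rdot dot (f u) v = rdot dot u (f v).
    apply: (cvg_unique (@Rhausdorff R) (cvg_rdot dot_norm (fP u) (cvg_cst v))).
    have E : (fun n => rdot dot (rootseq n u) v) = (fun n => rdot dot u (rootseq n v)).
      by apply/funext => n; rewrite /rdot Y_sa.
    by rewrite E; exact: (cvg_rdot dot_norm (cvg_cst u) (fP v)).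
  change (dot (f x) y = dot x (f y)).
  have hr := h x y; have hi := h x ('i *: y).
  have fi : f ('i *: y) = 'i *: f y by exact: (bopZ Y).
  rewrite fi -!Im_dot in hi.
  by apply/eqP; rewrite eq_complex; apply/andP; split; apply/eqP.
move=> x; change (2%:C *: f x = X x + f (f x)).
apply: (@cvgH_unique _ _ (fun n => 2%:C *: rootseq n.+1 x)).
  apply: cvgZl_tmp.
  by have := fP x; rewrite -(cvg_shiftS (fun n => rootseq n x)).
have -> : (fun n => 2%:C *: rootseq n.+1 x) = (fun n => X x + rootseq n (rootseq n x)).
  apply/funext => n.
  rewrite (_ : rootseq n.+1 x = (2^-1 : R)%:C *: (X x + rootseq n (rootseq n x)))//.
  by rewrite scalerA -rmorphM /= mulfV// scale1r.
apply: cvgD; first exact: cvg_cst.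
apply/cvg_nrm.
apply: (@squeeze0 _ _ (fun n => nrm (rootseq n x - f x) + nrm (rootseq n (f x) - f (f x)))).
  move=> n; rewrite nrm_ge0 /=.
  have -> : rootseq n (rootseq n x) - f (f x) =
      rootseq n (rootseq n x - f x) + (rootseq n (f x) - f (f x)).
    by rewrite bopB addrA subrK.
  rewrite (le_trans (nrmD _ _))// lerD2r (le_trans (Y_bound n _))//.
  by rewrite ler_piMl ?nrm_ge0//; have /andP[] := y_01 n.
rewrite -[0]addr0; apply: cvgD; apply/cvg_nrm; exact: fP.
Qed.

End Contraction.

(** Dividing by a bound [a] makes X = I - A / a a contraction. With 2 Y = X + Y^2, the operator S =
    I - Y satisfies S^2 = I - X = A / a; multiply by the root of [a]. *)
Lemma opsqrt_exists A : positive_op dot A -> exists B, is_opsqrt dot A B.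
Proof.
move=> pA; have [a0 a00 Aa0] := bop_bounded A.
pose a := a0 + 1; have a_gt0 : 0 < a by rewrite /a; lra.
have Aa : opbound A a by apply: opbound_le Aa0; rewrite /a; lra.
pose C := (a^-1)%:C *: A.
have pC : positive_op dot C by apply: positiveZ => //; rewrite invr_ge0 ltW.
have C1 x : rdot dot (C x) x <= 1 * nrm x ^+ 2.
  rewrite mul1r bopZE rdotZl ler_pdivrMl//; exact: opbound_positive_rdot.
have C2 := positive_nrm_le dot_norm pC ltr01 C1.
have /positiveP[C0 _] := pC.
(* |x - C x|^2 = |x|^2 - 2 <C x, x> + |C x|^2, and |C x|^2 <= <C x, x>. *)
have X1 : opbound (bid H - C) 1.
  move=> x; rewrite mul1r -ler_sqr ?nnegrE ?nrm_ge0//.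
  rewrite bopBE bidE (nrmBsq dot_norm).
  have := C2 x; have := C0 x; rewrite (rdotC _ x); lra.
have Xsa x y : dot ((bid H - C) x) y = dot x ((bid H - C) y).
  by rewrite !bopBE !bidE dotBl dotBr (positive_selfadjoint pC).
have [Y [Y1 Ysa YE]] := contraction_root X1 Xsa.
pose S := bid H - Y.
have Ssa x y : dot (S x) y = dot x (S y).
  by rewrite !bopBE !bidE dotBl dotBr Ysa.
have S0 x : 0 <= rdot dot (S x) x.
  rewrite bopBE bidE rdotDl rdotNl (rdotxx dot_norm) subr_ge0.
  have := opbound_positive_rdot dot_norm x Y1; lra.
exists ((Num.sqrt a)%:C *: S); split.
  by apply: positiveZ; [exact: sqrtr_ge0 | exact: selfadjoint_positive].
apply: bop_ext => x.
have SS : S (S x) = C x.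
  rewrite /S !bopBE !bidE bopB.
  have E : Y x + Y x = x - C x + Y (Y x).
    have := YE x; rewrite bopBE bidE => <-.
    by rewrite -[2]/(1 + 1) rmorphD /= scalerDl scale1r.
  rewrite opprB addrACA -opprD E; apply/eqP.
  by rewrite subr_eq addrA [C x + _]addrC subrK.
have sq : (Num.sqrt a)%:C * (Num.sqrt a)%:C = a%:C.
  by rewrite -rmorphM /= -expr2 sqr_sqrtr ?ltW.
have inv : a%:C * (a^-1)%:C = 1 by rewrite -rmorphM /= mulfV// gt_eqF.
by rewrite bcompE !bopZE bopZ scalerA SS sq /C bopZE scalerA inv scale1r.
Qed.

End SquareRoot.

(** * Trace class operators *)

Lemma cvgn_ext (T : topologicalType) (f g : nat -> T) (l : T) : f =1 g ->
  f n @[n --> \oo] --> l -> g n @[n --> \oo] --> l.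
Proof. by move=> /funext ->. Qed.

(** * Complex limits through real and imaginary parts *)

Section ComplexLimits.
Context (R : realType).
Implicit Types (f : nat -> R[i]) (l c : R[i]).

Lemma cvg_complexP f l : (f n @[n --> \oo] --> (l : R[i]^o)) <->
  (complex.Re (f n) @[n --> \oo] --> complex.Re l /\
   complex.Im (f n) @[n --> \oo] --> complex.Im l).
Proof.
split.
  move=> fl; split; apply/cvgrPdist_lt => eps eps0.
    have := (proj1 (@cvgrPdist_lt R[i] R[i]^o _ _ _ f l) fl eps%:C); rewrite ltcR => /(_ _ eps0); apply: filterS => n.
    move=> h; rewrite -ltcR; apply: le_lt_trans h.
    have := normc_ge_Re (l - f n); by rewrite ReD ReN.
  have := (proj1 (@cvgrPdist_lt R[i] R[i]^o _ _ _ f l) fl eps%:C); rewrite ltcR => /(_ _ eps0); apply: filterS => n.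
  move=> h; rewrite -ltcR; apply: le_lt_trans h.
  rewrite -ImN -ImD; case: (l - f n) => p q /=; rewrite normc_def lecR.
  by rewrite -[leLHS]sqrtr_sqr ler_wsqrtr// lerDr sqr_ge0.
move=> [/cvgrPdist_lt fr /cvgrPdist_lt fi].
apply: (proj2 (@cvgrPdist_lt R[i] R[i]^o _ _ _ f l)) => e e0.
have [e1 eE] : 0 < complex.Re e /\ e = (complex.Re e)%:C.
  by case: e e0 => p q; rewrite ltcE /= => /andP[/eqP -> p0].
have e2 : 0 < complex.Re e / 2 by lra.
near=> n.
have h1 : `|complex.Re l - complex.Re (f n)| < complex.Re e / 2 by near: n; exact: fr.
have h2 : `|complex.Im l - complex.Im (f n)| < complex.Re e / 2 by near: n; exact: fi.
rewrite -ReN -ReD in h1; rewrite -ImN -ImD in h2.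
change (`|l - f n| < e).
move: h1 h2; rewrite eE; case: (l - f n) => p q /= h1 h2.
have -> : p +i* q = p%:C + 'i * q%:C by simpc.
apply: le_lt_trans (ler_normD _ _) _.
rewrite normrM !normc_def /= !expr0n !expr1n !addr0 !add0r sqrtr1 mul1r !sqrtr_sqr.
rewrite -rmorphD /= ltcR; lra.
Unshelve. all: by end_near.
Qed.

Lemma limn_complex f l : f n @[n --> \oo] --> (l : R[i]^o) ->
  limn (f : nat -> R[i]^o) = l.
Proof. by move=> fl; apply: cvg_lim => //; exact: norm_hausdorff. Qed.

Lemma Re_sum n (f : nat -> R[i]) :
  complex.Re (\sum_(0 <= k < n) f k) = \sum_(0 <= k < n) complex.Re (f k).
Proof. by apply: big_morph => // x y; exact: ReD. Qed.

Lemma Im_sum n (f : nat -> R[i]) :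
  complex.Im (\sum_(0 <= k < n) f k) = \sum_(0 <= k < n) complex.Im (f k).
Proof. by apply: big_morph => // x y; exact: ImD. Qed.

Definition cmod2 c : R := complex.Re c ^+ 2 + complex.Im c ^+ 2.

Lemma cmod2_ge0 c : 0 <= cmod2 c.
Proof. by rewrite addr_ge0 ?sqr_ge0. Qed.

Lemma cmod2J c : cmod2 (conjc c) = cmod2 c.
Proof. by case: c => p q; rewrite /cmod2 /= sqrrN. Qed.

End ComplexLimits.

(** * Basis expansions and Hilbert-Schmidt sums *)

Section Basis.
Context (R : realType) (H : completeNormedModType R[i]) (dot : {dot H for conjC}).
Hypothesis dot_norm : forall x : H, `|x| ^+ 2 = dot x x.
Variables (e : nat -> H) (J : set nat).
Hypothesis basis_e : orthonormal_basis dot e J.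
Implicit Types (x y z : H) (A B P Q X Y : bop H) (a b c : R).

(* Off J the basis is padded with zeros, so that sums run over all of nat. *)
Definition ebasis k : H := if k \in J then e k else 0.

Lemma ebasisE k : J k -> ebasis k = e k.
Proof. by move=> Jk; rewrite /ebasis mem_set. Qed.

Definition bproj n x : H := \sum_(0 <= k < n) dot x (ebasis k) *: ebasis k.

Lemma bproj_cvg x : bproj n x @[n --> \oo] --> x.
Proof.
have [_ /(_ x)] := basis_e;
  apply: cvgn_ext => n; rewrite /bproj big_mkcond /=; apply: eq_bigr => k _; rewrite /ebasis.
by case: ifP => // _; rewrite scaler0.
Qed.

Lemma trace_seriesE A n :
  trace_series dot e J A n = \sum_(0 <= k < n) dot (A (ebasis k)) (ebasis k).
Proof.
rewrite /trace_series big_mkcond /=; apply: eq_bigr => k _; rewrite /ebasis.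
by case: ifP => // _; rewrite linear0r.
Qed.

Lemma ebasis_nrm k : nrm (ebasis k) <= 1.
Proof.
rewrite /ebasis; case: ifP => [kJ|_]; last by rewrite nrm0.
have [on _] := basis_e; rewrite -ler_sqr ?nnegrE ?nrm_ge0// expr1n.
by rewrite -(rdotxx dot_norm) /rdot on ?eqxx//; exact: set_mem.
Qed.

Lemma basis_ext A B :
  (forall i j, J i -> J j -> dot (A (e j)) (e i) = dot (B (e j)) (e i)) -> A = B.
Proof.
move=> AB.
have ABb i j : dot (A (ebasis j)) (ebasis i) = dot (B (ebasis j)) (ebasis i).
  rewrite /ebasis; case: ifPn => [jJ|_]; last by rewrite !bop0 !linear0l.
  case: ifPn => [iJ|_]; last by rewrite !linear0r.
  by apply: AB; exact: set_mem.
have ABk j : A (ebasis j) = B (ebasis j).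
  apply: (cvgH_unique (@bproj_cvg _)); have := @bproj_cvg (B (ebasis j)).
  by apply: cvgn_ext => n; apply: eq_bigr => k _; rewrite ABb.
apply: bop_ext => x; apply: cvgH_unique (cvg_bop (A := A) (@bproj_cvg x)) _.
have := cvg_bop (A := B) (@bproj_cvg x); apply: cvgn_ext => n.
by rewrite !bop_sum; apply: eq_bigr => k _; rewrite !bopZ ABk.
Qed.

Lemma rdot_bproj n x : rdot dot (bproj n x) x = \sum_(0 <= k < n) cmod2 (dot x (ebasis k)).
Proof.
rewrite /rdot /bproj dot_suml Re_sum; apply: eq_bigr => k _.
rewrite dotZl (dotC dot (ebasis k) x); case: (dot x _) => p q.
by rewrite /cmod2 /= mulrN opprK !expr2.
Qed.

Lemma parseval x :
  \sum_(0 <= k < n) cmod2 (dot x (ebasis k)) @[n --> \oo] --> nrm x ^+ 2.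
Proof.
rewrite -(rdotxx dot_norm).
apply: (cvgn_ext _ (cvg_rdot dot_norm (@bproj_cvg x) (cvg_cst x))) => n.
exact: rdot_bproj.
Qed.

Lemma parseval_ereal x :
  ((nrm x ^+ 2)%:E = \sum_(0 <= k <oo) (cmod2 (dot x (ebasis k)))%:E)%E.
Proof.
apply/esym; apply: cvg_lim => //.
rewrite (_ : (fun n => _) = EFin \o (fun n => \sum_(0 <= k < n) cmod2 (dot x (ebasis k)))).
  by apply: cvg_EFin; [exact: nearW | exact: parseval].
by apply/funext => n; rewrite /= sumEFin.
Qed.

(** The squared Hilbert-Schmidt norm, as an extended real so that nonnegative double sums can be
    interchanged before finiteness is known. *)
Definition hs X : \bar R := (\sum_(0 <= k <oo) (nrm (X (ebasis k)) ^+ 2)%:E)%E.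

(** By Parseval both sides are the sum of the squared moduli of all matrix entries, summed by
    columns or by rows. *)
Lemma hs_adjoint X Y : (forall x y, dot (X x) y = dot x (Y y)) -> hs X = hs Y.
Proof.
move=> XY; rewrite /hs.
under eq_eseriesr do rewrite parseval_ereal.
rewrite nneseries_interchange; last by move=> *; rewrite lee_fin cmod2_ge0.
apply: eq_eseriesr => j _; rewrite parseval_ereal; apply: eq_eseriesr => k _.
by rewrite XY (dotC dot _ (Y _)) cmod2J.
Qed.

Lemma hs_partial X n : (\sum_(0 <= k < n) (nrm (X (ebasis k)) ^+ 2)%:E <= hs X)%E.
Proof. by apply: nneseries_lim_ge => k _ _; rewrite lee_fin sqr_ge0. Qed.

Lemma hs_le X Y a : (forall x, nrm (X x) <= a * nrm (Y x)) ->
  (hs X <= (a ^+ 2)%:E * hs Y)%E.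
Proof.
move=> XY; rewrite /hs -nneseriesZl//; last by move=> k _; rewrite lee_fin sqr_ge0.
apply: lee_nneseries => k _; first by rewrite lee_fin sqr_ge0.
rewrite -EFinM lee_fin -exprMn.
have h := XY (ebasis k).
rewrite ler_sqr ?nnegrE ?nrm_ge0//; exact: le_trans (nrm_ge0 _) h.
Qed.

Lemma hs_cvg X : (hs X < +oo)%E ->
  \sum_(0 <= k < n) nrm (X (ebasis k)) ^+ 2 @[n --> \oo] --> fine (hs X).
Proof.
move=> Xoo.
have hf : hs X \is a fin_num.
  by rewrite ge0_fin_numE//; apply: nneseries_ge0 => k _ _; rewrite lee_fin sqr_ge0.
have h : (\sum_(0 <= k < n) (nrm (X (ebasis k)) ^+ 2)%:E)%E @[n --> \oo] --> hs X.
  by apply: is_cvg_nneseries => k _ _; rewrite lee_fin sqr_ge0.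
rewrite -(fineK hf) in h.
by apply: (cvgn_ext _ (fine_cvg h)) => n; rewrite /= sumEFin.
Qed.

Lemma hs_sum_le X n t : (hs X <= t%:E)%E ->
  \sum_(0 <= k < n) nrm (X (ebasis k)) ^+ 2 <= t.
Proof.
by move=> Xt; have := le_trans (hs_partial X n) Xt; rewrite sumEFin lee_fin.
Qed.

(** Since P = Q^2 with Q self-adjoint, the k-th diagonal entry of P is the squared norm of Q applied
    to the k-th basis vector. *)
Lemma trace_sqrt_hs P Q : is_opsqrt dot P Q -> cvgn (trace_series dot e J P) ->
  (hs Q < +oo)%E.
Proof.
move=> [pQ QP] /cvg_ex[l /= /cvg_complexP[+ _]].
have E n : complex.Re (trace_series dot e J P n) = \sum_(0 <= k < n) nrm (Q (ebasis k)) ^+ 2.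
  rewrite trace_seriesE Re_sum; apply: eq_bigr => k _.
  by rewrite -QP bcompE (positive_selfadjoint pQ) (dotxx dot_norm).
move=> Pl.
have -> : hs Q = (complex.Re l)%:E; last exact: ltry.
apply: cvg_lim => //.
rewrite (_ : (fun n => _) = EFin \o (fun n => complex.Re (trace_series dot e J P n))).
  by apply: cvg_EFin; [exact: nearW | exact: Pl].
by apply/funext => n; rewrite /= E sumEFin.
Qed.

(* Polarization turns hs X = hs X^* into tr (Y^* X) = tr (X Y^* ). *)
Lemma hs_polarization X (Xa : bop H) Y (Ya : bop H) :
  (forall x y, dot (X x) y = dot x (Xa y)) ->
  (forall x y, dot (Y x) y = dot x (Ya y)) ->
  (hs (X + Y)%R < +oo)%E -> (hs (X - Y)%R < +oo)%E -> exists l : R,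
  \sum_(0 <= k < n) rdot dot (X (ebasis k)) (Y (ebasis k)) @[n --> \oo] --> l /\
  \sum_(0 <= k < n) rdot dot (Xa (ebasis k)) (Ya (ebasis k)) @[n --> \oo] --> l.
Proof.
move=> XXa YYa hp hm.
exists (4^-1 * (fine (hs (X + Y)) - fine (hs (X - Y)))).
have adp : hs (X + Y) = hs (Xa + Ya).
  by apply: hs_adjoint => x y; rewrite !bopDE dotDl dotDr XXa YYa.
have adm : hs (X - Y) = hs (Xa - Ya).
  by apply: hs_adjoint => x y; rewrite !bopBE dotBl dotBr XXa YYa.
have key A B : (hs (A + B)%R < +oo)%E -> (hs (A - B)%R < +oo)%E ->
    \sum_(0 <= k < n) rdot dot (A (ebasis k)) (B (ebasis k)) @[n --> \oo] -->
    4^-1 * (fine (hs (A + B)) - fine (hs (A - B))).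
  move=> h1 h2.
  have -> : (fun n => \sum_(0 <= k < n) rdot dot (A (ebasis k)) (B (ebasis k))) =
    (fun n => 4^-1 * (\sum_(0 <= k < n) nrm ((A + B) (ebasis k)) ^+ 2 -
                      \sum_(0 <= k < n) nrm ((A - B) (ebasis k)) ^+ 2)).
    apply/funext => n; rewrite -sumrB mulr_sumr; apply: eq_bigr => k _.
    by rewrite bopDE bopBE (nrmBsq dot_norm) (nrmDsq dot_norm); lra.
  by apply: cvgMl_tmp; apply: cvgB; exact: hs_cvg.
split; first exact: key.
by rewrite adp adm; apply: key; rewrite -?adp -?adm.
Qed.

End Basis.

(** * Bounds for the trace against a trace class operator *)

Section TraceClassBound.
Context (R : realType) (H : completeNormedModType R[i]) (dot : {dot H for conjC}).
Hypothesis dot_norm : forall x : H, `|x| ^+ 2 = dot x x.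
Variables (e : nat -> H) (J : set nat).
Hypothesis basis_e : orthonormal_basis dot e J.
Implicit Types (x y z : H) (s A B P Q X Y : bop H) (a b c : R).

Local Notation ebasis := (ebasis e J).
Local Notation hs := (hs e J).
Local Notation trace_series := (trace_series dot e J).
Local Notation trace := (trace dot e J).

(** A bound on sums of [abs1] gives absolute convergence of the real and the imaginary series at
    once. *)
Definition abs1 (c : R[i]) : R := `|complex.Re c| + `|complex.Im c|.

Lemma abs1D (c c' : R[i]) : abs1 (c + c') <= abs1 c + abs1 c'.
Proof.
rewrite /abs1 ReD ImD addrACA; apply: lerD; exact: ler_normD.
Qed.

Lemma abs1_dot x y : abs1 (dot x y) <= 2 * (nrm x * nrm y).
Proof.
rewrite /abs1; have := Re_dot_CS dot_norm x y; have := Im_dot_CS dot_norm x y.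
lra.
Qed.

Section Resolvent.
Variables (P : bop H) (c : R).
Hypotheses (pP : positive_op dot P) (c0 : 0 < c).
Hypothesis cP1 : forall x, c * rdot dot (P x) x <= nrm x ^+ 2.

Let C := c%:C *: P.
Let K := bid H - C.

Let CE x : C x = c%:C *: P x. Proof. by []. Qed.
Let KE x : K x = x - c%:C *: P x. Proof. by []. Qed.

Let pC : positive_op dot C. Proof. by apply: positiveZ => //; exact: ltW. Qed.

Let C_le x : nrm (C x) ^+ 2 <= rdot dot (C x) x.
Proof.
have := positive_nrm_le dot_norm pC ltr01 _ x; rewrite mul1r; apply => y.
by rewrite mul1r CE rdotZl.
Qed.

(* ksum n = c (1 + K + ... + K^(n-1)) is an approximate inverse of P (P_ksum); it
   replaces the polar decomposition, which would need the range of P. *)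
Fixpoint kpow n : bop H := if n is n'.+1 then K *o kpow n' else bid H.
Fixpoint ksum n : bop H := if n is n'.+1 then ksum n' + c%:C *: kpow n' else 0.

Let kpowS n x : kpow n.+1 x = K (kpow n x). Proof. by []. Qed.
Let ksumS n x : ksum n.+1 x = ksum n x + c%:C *: kpow n x. Proof. by []. Qed.

Let K_step x : nrm (K x) ^+ 2 <= nrm x ^+ 2 - nrm (C x) ^+ 2.
Proof.
rewrite KE -CE (nrmBsq dot_norm); have := C_le x; rewrite (rdotC _ x); lra.
Qed.

Lemma kpow_le n x : nrm (kpow n x) <= nrm x.
Proof.
elim: n => // n IH; apply: le_trans IH; rewrite kpowS.
rewrite -ler_sqr ?nnegrE ?nrm_ge0//; apply: le_trans (K_step _) _.
by rewrite gerBl sqr_ge0.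
Qed.

Let KP x : K (P x) = P (K x).
Proof. by rewrite !KE bopB bopZ. Qed.

Lemma kpowP n x : kpow n (P x) = P (kpow n x).
Proof. by elim: n => // n IH; rewrite !kpowS IH KP. Qed.

Lemma ksumP n x : ksum n (P x) = P (ksum n x).
Proof.
elim: n => [|n IH]; first by rewrite [ksum 0 _]bop0E [ksum 0 _]bop0E bop0.
by rewrite !ksumS IH bopD bopZ kpowP.
Qed.

Lemma P_ksum n x : P (ksum n x) = x - kpow n x.
Proof.
elim: n => [|n IH]; first by rewrite [ksum 0 _]bop0E bop0 subrr.
by rewrite ksumS bopD IH bopZ kpowS KE opprB addrA [RHS]addrAC.
Qed.

Let C_sa x y : dot (C x) y = dot x (C y). Proof. exact: positive_selfadjoint. Qed.
Let K_sa x y : dot (K x) y = dot x (K y).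
Proof. by rewrite !KE -!CE dotBl dotBr C_sa. Qed.

Let kpowK n x : kpow n (K x) = K (kpow n x).
Proof. by elim: n => // n IH; rewrite kpowS IH. Qed.

Let kpow_sa n x y : dot (kpow n x) y = dot x (kpow n y).
Proof. by elim: n x y => // n IH x y; rewrite kpowS K_sa IH kpowK kpowS. Qed.

Lemma ksum_sa n x y : dot (ksum n x) y = dot x (ksum n y).
Proof.
elim: n => [|n IH]; first by rewrite [ksum 0 _]bop0E [ksum 0 _]bop0E linear0l linear0r.
by rewrite !ksumS dotDl dotDr IH dotZl dotZr conjc_real kpow_sa.
Qed.

(** The squared norms of K^n x decrease, hence converge, and by [K_step] their consecutive
    differences dominate |c P K^n x|^2. *)
Lemma P_kpow_cvg x : nrm (P (kpow n x)) @[n --> \oo] --> (0 : R).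
Proof.
pose u n := nrm (kpow n x) ^+ 2.
have u_step n : (c * nrm (P (kpow n x))) ^+ 2 <= u n - u n.+1.
  have := K_step (kpow n x); rewrite -[K (kpow n x)]kpowS CE nrmZr (ger0_norm (ltW c0)) /u; lra.
have u_cvg : cvgn u.
  apply: nonincreasing_is_cvgn.
    apply/nonincreasing_seqP => n; have := u_step n.
    by have := sqr_ge0 (c * nrm (P (kpow n x))); lra.
  by exists 0 => _ [n _ <-]; exact: sqr_ge0.
have {u_cvg} /cvg_ex[l ul] := u_cvg.
have d0 : u n - u n.+1 @[n --> \oo] --> (0 : R).
  rewrite -(subrr l); apply: cvgB => //.
  by have := ul; rewrite -(cvg_shiftS u).
have sq0 : (c * nrm (P (kpow n x))) ^+ 2 @[n --> \oo] --> (0 : R).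
  by apply: squeeze0 d0 => n; rewrite sqr_ge0 u_step.
have : Num.sqrt ((c * nrm (P (kpow n x))) ^+ 2) @[n --> \oo] --> Num.sqrt (0 : R).
  by apply: continuous_cvg => //; exact: sqrt_continuous.
rewrite sqrtr0 => s0.
have : c^-1 * Num.sqrt ((c * nrm (P (kpow n x))) ^+ 2) @[n --> \oo] --> c^-1 * 0.
  exact: cvgMl_tmp.
rewrite mulr0; apply: cvgn_ext => n.
by rewrite sqrtr_sqr ger0_norm ?mulr_ge0 ?nrm_ge0 ?ltW// mulKf// gt_eqF.
Qed.

End Resolvent.

(* With Q^2 = |s| = P, s = s K^n + (s ksum_n Q) Q: the second term is a product of
   two Hilbert-Schmidt operators with norms bounded in n, and the first one
   vanishes in the limit. *)
Lemma trace_class_bound s : trace_class dot e J s ->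
  exists2 C, 0 <= C & forall A a, positive_op dot A -> 0 < a ->
    (forall x, rdot dot (A x) x <= a * nrm x ^+ 2) ->
    forall N, \sum_(0 <= k < N) abs1 (dot (s (A (ebasis k))) (ebasis k)) <= C * a.
Proof.
move=> [P [B sB [pP PP]] cvgP].
have [Q sqQ] := opsqrt_exists dot_norm pP.
have [pQ QP] := sqQ.
have hsQ := trace_sqrt_hs dot_norm sqQ cvgP.
set t := fine (hs Q).
have hsQE : hs Q = t%:E.
  by rewrite fineK// ge0_fin_numE//; apply: nneseries_ge0 => k _ _; rewrite lee_fin sqr_ge0.
have t0 : 0 <= t.
  by rewrite -lee_fin -hsQE; apply: nneseries_ge0 => k _ _; rewrite lee_fin sqr_ge0.
have [p p0 Pp] := bop_bounded P.
(* Makes c P <= I; the added 1 covers p = 0. *)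
pose c := (p + 1)^-1; have c0 : 0 < c by rewrite invr_gt0; lra.
have cP1 x : c * rdot dot (P x) x <= nrm x ^+ 2.
  rewrite ler_pdivrMl; last lra.
  apply: (opbound_positive_rdot dot_norm); apply: opbound_le Pp; lra.
have sP x : nrm (s x) = nrm (P x).
  apply/eqP; rewrite -(@eqrXn2 _ 2) ?nrm_ge0// -!(rdotxx dot_norm) /rdot.
  rewrite sB -bcompE -PP bcompE; by rewrite (positive_selfadjoint pP).
pose T n := s *o (ksum P c n *o Q).
pose Ta n := Q *o (ksum P c n *o B).
have Bs x y : dot (B x) y = dot x (s y) by rewrite dotC -sB -dotC.
have TTa n x y : dot (Ta n x) y = dot x (T n y).
  rewrite /Ta /T !bcompE (positive_selfadjoint pQ).
  by rewrite (ksum_sa pP c0) Bs.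
(* As |s y| = |P y| and P ksum_n = I - K^n with K^n a contraction, the factor [s ksum_n] costs at
   most 2, whatever n. *)
have T_le n x : nrm (T n x) <= 2 * nrm (Q x).
  rewrite !bcompE sP P_ksum; apply: le_trans (nrmB _ _) _.
  by have := kpow_le pP c0 cP1 n (Q x); lra.
have hsTa n : (hs (Ta n) <= (4 * t)%:E)%E.
  rewrite (hs_adjoint dot_norm basis_e (TTa n)).
  apply: le_trans (hs_le e J (T_le n)) _.
  by rewrite hsQE -EFinM lee_fin; lra.
(* 5 = 1 + 4: the sum for Q A contributes a^2 t / a, and the one for [Ta n], bounded by 4 t, is
   weighted by a. *)
exists (5 * t); first lra.
move=> A a pA a0 Aa N.
have Aa' := positive_opbound dot_norm pA (ltW a0) Aa.
have hsQA : (hs (Q *o A) <= (a ^+ 2 * t)%:E)%E.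
  rewrite (hs_adjoint dot_norm basis_e (Y := A *o Q)); last first.
    by move=> x y; rewrite !bcompE (positive_selfadjoint pQ) (positive_selfadjoint pA).
  by have := hs_le e J (X := A *o Q) (Y := Q) (fun x => Aa' (Q x)); rewrite hsQE -EFinM.
(* The contribution of s K^n, which for a fixed number of terms tends to 0 as n grows; the bound can
   therefore be proved with this error for each n. *)
pose r M n : R := \sum_(0 <= k < M) 2 * nrm (P (kpow P c n (A (ebasis k)))).
have r0 M : r M n @[n --> \oo] --> (0 : R).
  elim: M => [|M IH].
    by rewrite /r; under eq_fun do rewrite big_geq//; exact: cvg_cst.
  have -> : r M.+1 = fun n => r M n + 2 * nrm (P (kpow P c n (A (ebasis M)))).
    by apply/funext => n; rewrite /r big_nat_recr.
  rewrite -[0]addr0; apply: cvgD => //.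
  rewrite -(mulr0 2); apply: cvgMl_tmp; exact: (P_kpow_cvg pP c0 cP1).
suff main n : \sum_(0 <= k < N) abs1 (dot (s (A (ebasis k))) (ebasis k)) <= r N n + 5 * t * a.
  apply: (@limr_ge_cvg _ (fun n => r N n + 5 * t * a)); last exact: nearW.
  by rewrite -[X in _ --> X]add0r; apply: cvgD => //; exact: cvg_cst.
have term k : abs1 (dot (s (A (ebasis k))) (ebasis k)) <=
    2 * nrm (P (kpow P c n (A (ebasis k)))) +
    (a^-1 * nrm ((Q *o A) (ebasis k)) ^+ 2 + a * nrm (Ta n (ebasis k)) ^+ 2).
  set x := A (ebasis k); set y := ebasis k.
  have -> : s x = s (kpow P c n x) + T n (Q x).
    rewrite !bcompE -[Q (Q x)]bcompE QP ksumP P_ksum bopB.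
    by rewrite addrC subrK.
  rewrite dotDl; apply: le_trans (abs1D _ _) _; apply: lerD.
    apply: le_trans (abs1_dot _ _) _; rewrite sP ler_pM2l// ler_piMr ?nrm_ge0//.
    exact: (ebasis_nrm dot_norm basis_e).
  have -> : dot (T n (Q x)) y = dot (Q x) (Ta n y).
    by rewrite dotC -TTa -dotC.
  apply: le_trans (abs1_dot _ _) _.
  rewrite -[(Q *o A) y]/(Q x); set u := nrm (Q x); set v := nrm _.
  (* Weighted arithmetic-geometric mean 2 u v <= u^2 / a + a v^2; the weight makes both terms sum to
     multiples of a. *)
  have : 0 <= a^-1 * (u - a * v) ^+ 2 by rewrite mulr_ge0 ?sqr_ge0// invr_ge0 ltW.
  have -> : a^-1 * (u - a * v) ^+ 2 = a^-1 * u ^+ 2 + a * v ^+ 2 - 2 * (u * v).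
    by field; rewrite gt_eqF.
  by rewrite subr_ge0.
apply: le_trans (ler_sum _ (fun k _ => term k)) _.
rewrite big_split /= lerD2l big_split /= -!mulr_sumr.
have h1 := hs_sum_le N hsQA; have h2 := hs_sum_le N (hsTa n).
have -> : 5 * t * a = a^-1 * (a ^+ 2 * t) + a * (4 * t) by field; rewrite gt_eqF.
by apply: lerD; rewrite ler_pM2l ?invr_gt0.
Qed.

(** Partial sums bounded in [abs1] make both real series absolutely convergent. As [C] depends on s
    only, the trace is small when the positive operator is. *)
Lemma trace_class_cvg s : trace_class dot e J s ->
  exists2 C, 0 <= C & forall A a, positive_op dot A -> 0 < a ->
    (forall x, rdot dot (A x) x <= a * nrm x ^+ 2) ->
    (trace_series (s *o A) @ \oo --> (trace (s *o A) : R[i]^o)) /\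
    `|complex.Re (trace (s *o A))| <= C * a /\ `|complex.Im (trace (s *o A))| <= C * a.
Proof.
move=> /trace_class_bound[C C0 sC]; exists C => // A a pA a0 Aa.
have bnd := sC A a pA a0 Aa.
have key (f : nat -> R) :
    (forall k, `|f k| <= abs1 (dot (s (A (ebasis k))) (ebasis k))) ->
    exists2 l : R, \sum_(0 <= k < n) f k @[n --> \oo] --> l & `|l| <= C * a.
  move=> fk.
  have fb n : \sum_(0 <= k < n) `|f k| <= C * a.
    by apply: le_trans (bnd n); apply: ler_sum => k _.
  have : cvgn (series f).
    apply: normed_cvg; apply: nondecreasing_is_cvgn.
      apply/nondecreasing_seqP => n; rewrite /normed_series_of /series /=.
      by rewrite big_nat_recr//= lerDl.
    by exists (C * a) => _ [n _ <-]; exact: fb.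
  move=> /cvg_ex[l fl]; exists l => //.
  rewrite ler_norml; apply/andP; split.
    apply: (@limr_ge_cvg _ _ _ _ fl); apply: nearW => n.
    rewrite lerNl; apply: le_trans (ler_norm _) _; rewrite normrN.
    by apply: le_trans (ler_norm_sum _ _ _) (fb n).
  apply: (limr_le_cvg fl); apply: nearW => n.
  by apply: le_trans (ler_norm _) _; apply: le_trans (ler_norm_sum _ _ _) (fb n).
have [lr lrE lrC] := key (fun k => complex.Re (dot (s (A (ebasis k))) (ebasis k)))
  (fun k => ltac:(by rewrite /abs1 lerDl)).
have [li liE liC] := key (fun k => complex.Im (dot (s (A (ebasis k))) (ebasis k)))
  (fun k => ltac:(by rewrite /abs1 lerDr)).
have tl : trace_series (s *o A) @ \oo --> ((lr +i* li) : R[i]^o).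
  apply/cvg_complexP; split.
    by apply: cvgn_ext lrE => n; rewrite -[X in complex.Re X]/(trace_series _ n) trace_seriesE Re_sum.
  by apply: cvgn_ext liE => n; rewrite -[X in complex.Im X]/(trace_series _ n) trace_seriesE Im_sum.
have -> : trace (s *o A) = lr +i* li by exact: limn_complex.
by [].
Qed.

End TraceClassBound.

(** * The trace as a functional of its second factor *)

Section TraceFunctional.
Context (R : realType) (H : completeNormedModType R[i]) (dot : {dot H for conjC}).
Hypothesis dot_norm : forall x : H, `|x| ^+ 2 = dot x x.
Variables (e : nat -> H) (J : set nat).
Hypothesis basis_e : orthonormal_basis dot e J.
Implicit Types (x y z w : H) (s A B P Q X Y : bop H) (a b c : R).

Local Notation ebasis := (ebasis e J).
Local Notation hs := (hs e J).
Local Notation trace_series := (trace_series dot e J).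
Local Notation trace := (trace dot e J).

Lemma cvg_dot (u v : nat -> H) x y : u n @[n --> \oo] --> x -> v n @[n --> \oo] --> y ->
  dot (u n) (v n) @[n --> \oo] --> (dot x y : R[i]^o).
Proof.
move=> ux vy; apply/cvg_complexP; split; first exact: (cvg_rdot dot_norm ux vy).
rewrite Im_dot; apply: (cvgn_ext (f := fun n => rdot dot (u n) ('i *: v n))) => [n|].
  by rewrite Im_dot.
by apply: (cvg_rdot dot_norm ux); exact: cvgZl_tmp.
Qed.

Lemma positive_trace_class P : positive_op dot P -> cvgn (trace_series P) ->
  trace_class dot e J P.
Proof.
move=> pP cP; exists P => //; exists P; first exact: positive_selfadjoint.
by split.
Qed.

Lemma state_trace_class s : is_state dot e J s -> trace_class dot e J s.
Proof.
by move=> [ps cs]; apply: (positive_trace_class ps (cvgP _ cs)).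
Qed.

(** [trace] is a [limn] and says nothing without convergence, so the linearity lemmas carry
    convergence along. *)
Definition tr_cvg s A := trace_series (s *o A) @ \oo --> (trace (s *o A) : R[i]^o).

Lemma tr_cvgP s A (l : R[i]) : trace_series (s *o A) @ \oo --> (l : R[i]^o) ->
  tr_cvg s A /\ trace (s *o A) = l.
Proof.
by move=> sl; have tl : trace (s *o A) = l by [exact: limn_complex]; rewrite /tr_cvg tl.
Qed.

Lemma tr_cvg_positive s A : trace_class dot e J s -> positive_op dot A -> tr_cvg s A.
Proof.
move=> sT pA; have [C _ sC] := trace_class_cvg dot_norm basis_e sT.
have [a a0 Aa] := bop_bounded A.
have [] := sC A (a + 1) pA _ _ => //; first lra.
by move=> x; apply: (opbound_positive_rdot dot_norm); apply: opbound_le Aa; lra.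
Qed.

Lemma tr_add s A B : tr_cvg s A -> tr_cvg s B ->
  tr_cvg s (A + B) /\ trace (s *o (A + B)) = trace (s *o A) + trace (s *o B).
Proof.
move=> sA sB; apply: tr_cvgP.
have E n : trace_series (s *o A) n + trace_series (s *o B) n = trace_series (s *o (A + B)) n.
  rewrite !trace_seriesE -big_split; apply: eq_bigr => k _.
  by rewrite !bcompE bopDE bopD dotDl.
apply: (cvgn_ext E); exact: (@cvgD R[i] R[i]^o _ _ _ _ _ _ _ sA sB).
Qed.

Lemma tr_scale s (a : R[i]) A : tr_cvg s A ->
  tr_cvg s (a *: A) /\ trace (s *o (a *: A)) = a * trace (s *o A).
Proof.
move=> sA; apply: tr_cvgP.
have E n : a * trace_series (s *o A) n = trace_series (s *o (a *: A)) n.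
  rewrite !trace_seriesE mulr_sumr; apply: eq_bigr => k _.
  by rewrite !bcompE bopZE bopZ dotZl.
apply: (@cvgn_ext R[i]^o (fun n => a * trace_series (s *o A) n) _ _ E).
exact: (@cvgZl_tmp R[i] R[i]^o _ _ _ a _ _ sA).
Qed.

Lemma tr_zero s : tr_cvg s 0 /\ trace (s *o 0) = 0.
Proof.
apply: tr_cvgP.
have E n : 0 = trace_series (s *o 0) n.
  by rewrite trace_seriesE big1// => k _; rewrite bcompE bop0E bop0 linear0l.
by apply: (@cvgn_ext R[i]^o (fun=> 0) _ _ E); exact: cvg_cst.
Qed.

Lemma tr_sum s (A : nat -> bop H) n : (forall k, tr_cvg s (A k)) ->
  tr_cvg s (\sum_(0 <= k < n) A k) /\
  trace (s *o (\sum_(0 <= k < n) A k)) = \sum_(0 <= k < n) trace (s *o A k).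
Proof.
move=> sA; elim: n => [|n [IH1 IH2]].
  by rewrite !big_geq//; exact: tr_zero.
have [h1 h2] := tr_add IH1 (sA n).
rewrite [\sum_(0 <= k < n.+1) A k]big_nat_recr; last by [].
split; first exact: h1.
rewrite [RHS]big_nat_recr; last by [].
by rewrite -[X in _ = X + _]IH2; exact: h2.
Qed.

(** With P = S^2 the trace is the sum of <S A e_k, S e_k>; [hs_polarization] turns it into the sum
    of <A S e_k, S e_k>, whose terms are nonnegative. *)
Lemma trace_ge0 P A : positive_op dot P -> cvgn (trace_series P) ->
  positive_op dot A -> 0 <= complex.Re (trace (P *o A)).
Proof.
move=> pP cP pA; have [S sqS] := opsqrt_exists dot_norm pP.
have [pS SP] := sqS; have hsS := trace_sqrt_hs dot_norm sqS cP.
have saA := positive_selfadjoint pA; have saS := positive_selfadjoint pS.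
have [a a0 Aa] := bop_bounded A.
have ad x y : dot ((S *o A) x) y = dot x ((A *o S) y) by rewrite !bcompE saS saA.
(* [hs_le] compares norms vector by vector, which suits A S rather than S A; hence the passage to
   the adjoint. *)
have fin X Y : (forall x y, dot (X x) y = dot x (Y y)) ->
    (forall x, nrm (Y x) <= (a + 1) * nrm (S x)) -> (hs X < +oo)%E.
  move=> XY YS; rewrite (hs_adjoint dot_norm basis_e XY).
  apply: le_lt_trans (hs_le e J YS) _.
  by apply: lte_mul_pinfty => //; rewrite lee_fin sqr_ge0.
have hp : (hs (S *o A + S)%R < +oo)%E.
  apply: (fin _ (A *o S + S)) => [x y|x].
    by rewrite !bopDE dotDl dotDr ad saS.
  by rewrite bopDE (le_trans (nrmD _ _))// mulrDl mul1r lerD2r bcompE Aa.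
have hm : (hs (S *o A - S)%R < +oo)%E.
  apply: (fin _ (A *o S - S)) => [x y|x].
    by rewrite !bopBE dotBl dotBr ad saS.
  by rewrite bopBE (le_trans (nrmB _ _))// mulrDl mul1r lerD2r bcompE Aa.
have [l [l1 l2]] := hs_polarization dot_norm basis_e ad saS hp hm.
have l0 : 0 <= l.
  apply: (limr_ge_cvg l2); apply: nearW => n; apply: sumr_ge0 => k _.
  by have /positiveP[A0 _] := pA; exact: A0.
suff -> : complex.Re (trace (P *o A)) = l by [].
have /cvg_complexP[h _] := tr_cvg_positive (positive_trace_class pP cP) pA.
apply: (cvg_unique (@Rhausdorff R) h); apply: cvgn_ext l1 => n.
rewrite -[X in _ = complex.Re X]/(trace_series (P *o A) n) trace_seriesE Re_sum.
by apply: eq_bigr => k _; rewrite -SP !bcompE saS.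
Qed.

Lemma Re_norm_le_abs1 (c : R[i]) : complex.Re `|c| <= abs1 c.
Proof.
case: c => p q; rewrite normc_def /abs1 /=.
rewrite -[leRHS]ger0_norm ?addr_ge0// -[leRHS]sqrtr_sqr ler_wsqrtr//.
rewrite sqrrD !real_normK ?num_real// -addrA lerD2l lerDr.
by rewrite mulrn_wge0// mulr_ge0.
Qed.

Fact rank1_subproof w : (fun x => dot x w *: w) \in @bounded_linear R H.
Proof.
apply: (@bop_of_subproof _ _ _ (2 * nrm w * nrm w)) => [a x y|x].
  by rewrite dotDl dotZl scalerDl scalerA.
rewrite nrmZ [leRHS]mulrAC; apply: ler_wpM2r; first exact: nrm_ge0.
apply: le_trans (Re_norm_le_abs1 _) _; apply: le_trans (abs1_dot dot_norm _ _) _.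
by rewrite -mulrA (mulrC (nrm x)).
Qed.

Definition rank1 w : bop H := Bop (rank1_subproof w).

Lemma rank1E w x : rank1 w x = dot x w *: w. Proof. by []. Qed.

(** The partial sums equal <A w_n, w> with w_n the truncated expansion of w. Thus traces against
    rank one operators recover the quadratic form of A. *)
Lemma rank1_trace_series w A :
  trace_series (rank1 w *o A) @ \oo --> (dot (A w) w : R[i]^o).
Proof.
have E n : dot (A (bproj dot e J n w)) w = trace_series (rank1 w *o A) n.
  rewrite trace_seriesE /bproj bop_sum dot_suml; apply: eq_bigr => k _.
  by rewrite bcompE rank1E bopZ !dotZl mulrC.
apply: (cvgn_ext E).
apply: (@cvg_dot _ (fun=> w)); last exact: cvg_cst.
by apply: cvg_bop; exact: (bproj_cvg basis_e).
Qed.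

Lemma rank1_trace w A : tr_cvg (rank1 w) A /\ trace (rank1 w *o A) = dot (A w) w.
Proof. by apply: tr_cvgP; exact: rank1_trace_series. Qed.

Lemma rank1_positive w : positive_op dot (rank1 w).
Proof. by move=> x; rewrite rank1E dotZl (dotC dot w x); exact: mulcJ_ge0. Qed.

Lemma rank1_series w : trace_series (rank1 w) @ \oo --> (dot w w : R[i]^o).
Proof.
have -> : rank1 w = rank1 w *o bid H by apply: bop_ext.
exact: rank1_trace_series.
Qed.

Lemma rank1_trace_class w : trace_class dot e J (rank1 w).
Proof. exact: (positive_trace_class (@rank1_positive w) (cvgP _ (@rank1_series w))). Qed.

Lemma rank1_state w : nrm w = 1 -> is_state dot e J (rank1 w).
Proof.
move=> w1; split; first exact: rank1_positive.
have -> : 1 = dot w w by rewrite (dotxx dot_norm) w1 expr1n.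
exact: rank1_series.
Qed.

(** The difference is self-adjoint with zero quadratic form, hence positive with bound 0. *)
Lemma positive_eq A B : positive_op dot A -> positive_op dot B ->
  (forall x, rdot dot (A x) x = rdot dot (B x) x) -> A = B.
Proof.
move=> pA pB AB.
have Z0 x : rdot dot ((A - B) x) x = 0 by rewrite bopBE rdotDl rdotNl AB subrr.
have pZ : positive_op dot (A - B).
  apply: selfadjoint_positive => [x y|x]; last by rewrite Z0.
  by rewrite !bopBE dotBl dotBr (positive_selfadjoint pA) (positive_selfadjoint pB).
have Zb : opbound (A - B) 0.
  by apply: (positive_opbound dot_norm pZ) => // x; rewrite Z0 mul0r.
apply: bop_ext => x; apply/eqP; rewrite -subr_eq0 -nrm_eq0 -bopBE.
by apply/eqP/le_anti; rewrite nrm_ge0 andbT; have := Zb x; rewrite mul0r.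
Qed.

End TraceFunctional.

(** * The operator-valued measure *)

Section SetFunctionIntegral.
Context d (T : measurableType d) (R : realType).
Variables m1 m2 : set T -> \bar R.
Hypothesis m12 : forall A, measurable A -> m1 A = m2 A.
Local Open Scope ereal_scope.

(* povm_state is no measure outside the measurable sets, but integrals do not see
   the values there. *)
Lemma eq_setfun_integral (D : set T) (f : T -> \bar R) :
  \int[m1]_(x in D) f x = \int[m2]_(x in D) f x.
Proof.
rewrite /integral.
have E (h : {nnsfun T >-> R}) : sintegral m1 h = sintegral m2 h.
  rewrite /sintegral; apply: eq_fsbigr => x _; congr (_ * _).
  by apply: m12; exact: measurable_funPTI.
by congr (ereal_sup _ - ereal_sup _); apply: eq_imagel => h _.
Qed.

Lemma eq_setfun_integrable (D : set T) (f : T -> \bar R) :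
  m1.-integrable D f -> m2.-integrable D f.
Proof.
by move=> /integrableP[mf foo]; apply/integrableP; split; rewrite -?eq_setfun_integral.
Qed.

End SetFunctionIntegral.

(** * Approximation by averages of indicators *)

Section LayerCake.
Context d (T : measurableType d) (R : realType).
Variable mu : {finite_measure set T -> \bar R}.
Implicit Types (u h phi psi : T -> R).

Lemma sum_leqn (n m : nat) : (m <= n)%N -> (\sum_(0 <= k < n) (k < m))%N = m.
Proof.
move=> mn; rewrite (@big_cat_nat _ _ _ m)//=.
rewrite (@eq_big_nat _ _ _ 0 m _ (fun=> 1%N)); last by move=> k /andP[_ ->].
rewrite sum_nat_const_nat muln1 subn0 big_nat big1 ?addn0// => k /andP[mk _].
by rewrite ltnNge mk.
Qed.

(** With [E k] the set where u >= (k+1)/n, the number of k < n with x in [E k] is the integer part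
    of n u(x); u <= 1 ensures that n sets suffice. *)
Lemma layer_cake u (n : nat) : unit_fun u -> (0 < n)%N ->
  exists2 E : nat -> set T, (forall k, measurable (E k)) &
    forall x, 0 <= u x - n%:R^-1 * \sum_(0 <= k < n) \1_(E k) x <= n%:R^-1.
Proof.
move=> [mu_ u01] n0; pose E k := [set x | k.+1%:R / n%:R <= u x].
have nR : 0 < n%:R :> R by rewrite ltr0n.
exists E => [k|x].
  rewrite (_ : E k = setT `&` u @^-1` `[k.+1%:R / n%:R, +oo[).
    by apply: mu_ => //; exact: measurable_itv.
  by rewrite setTI; apply/seteqP; split => x /=; rewrite in_itv /= andbT.
have /andP[u0 u1] := u01 x.
pose m := truncn (n%:R * u x).
have nu0 : 0 <= n%:R * u x by rewrite mulr_ge0// ler0n.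
have mn : (m <= n)%N.
  rewrite -(ler_nat R); apply: le_trans (_ : _ <= n%:R * u x) _; first by rewrite truncn_le.
  by rewrite ler_piMr// ler0n.
have -> : \sum_(0 <= k < n) (\1_(E k) x : R) = m%:R.
  rewrite -[in RHS](sum_leqn mn) natr_sum; apply: eq_bigr => k _.
  rewrite indicE; congr (nat_of_bool _)%:R.
  rewrite /m truncn_gt_nat -ler_pdivrMl// mulrC.
  by apply/idP/idP; rewrite inE.
have h1 : m%:R <= n%:R * u x by rewrite truncn_le.
have h2 := truncnS_gt (n%:R * u x).
rewrite -/m in h2.
have -> : u x = n%:R^-1 * (n%:R * u x) by rewrite mulKf// gt_eqF.
rewrite -mulrBr; apply/andP; split.
  by rewrite mulr_ge0 ?invr_ge0 ?ler0n// subr_ge0.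
by rewrite ler_piMr ?invr_ge0 ?ler0n// lerBlDl natr1 ltW.
Qed.

(** The hypothesis makes [h] nonnegative almost everywhere, so it may be replaced by its positive
    part. *)
Lemma Rint_ge0_of_sets h phi : L1 mu h ->
  (forall E, measurable E -> 0 <= \int[mu]_(x in E) h x) ->
  measurable_fun setT phi -> (exists M, forall x, `|phi x| <= M) ->
  (forall x, 0 <= phi x) -> 0 <= \int[mu]_x (phi x * h x).
Proof.
move=> Ih h0 mphi bphi phi0; have mh := L1_measurable Ih.
have -> : \int[mu]_x (phi x * h x) = \int[mu]_x (phi x * Num.max 0 (h x)).
  rewrite /Rintegral; congr fine; apply: ae_eq_integral => //.
  - by apply/measurable_EFinP; apply: measurable_funM.
  - apply/measurable_EFinP; apply: measurable_funM => //.
    exact: measurable_maxr.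
  exists [set x | h x < 0]; split.
  - rewrite (_ : [set x | h x < 0] = setT `&` h @^-1` `]-oo, 0[).
      by apply: mh => //; exact: measurable_itv.
    by rewrite setTI; apply/seteqP; split => x /=; rewrite in_itv.
  - exact: ae_ge0_from_Rint.
  - move=> x /= nx; apply: contrapT => /negP hx; apply: nx => _.
    by rewrite max_r// leNgt.
by apply: Rintegral_ge0 => x _; rewrite mulr_ge0// le_max lexx.
Qed.

Lemma le_Rint_of_sets h phi psi : L1 mu h ->
  (forall E, measurable E -> 0 <= \int[mu]_(x in E) h x) ->
  measurable_fun setT phi -> (exists M, forall x, `|phi x| <= M) ->
  measurable_fun setT psi -> (exists M, forall x, `|psi x| <= M) ->
  (forall x, phi x <= psi x) ->
  \int[mu]_x (phi x * h x) <= \int[mu]_x (psi x * h x).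
Proof.
move=> Ih h0 mphi [M phiM] mpsi [N psiN] le_phi.
rewrite -subr_ge0 -RintB; last 2 first.
- by apply: L1M => //; exists N.
- by apply: L1M => //; exists M.
have -> : Rintegral mu setT (fun x => psi x * h x - phi x * h x) =
    \int[mu]_x ((psi x - phi x) * h x).
  by congr Rintegral; apply/funext => x; rewrite mulrBl.
apply: Rint_ge0_of_sets => //; first exact: measurable_funB.
  exists (N + M) => x; apply: le_trans (ler_normB _ _) _; exact: lerD.
by move=> x; rewrite subr_ge0.
Qed.

Lemma simple_unit_fun (n : nat) (E : nat -> set T) : (0 < n)%N ->
  (forall k, measurable (E k)) ->
  unit_fun (fun x => n%:R^-1 * \sum_(0 <= k < n) \1_(E k) x : R).
Proof.
move=> n0 mE; split.
  apply: measurable_funM => //; apply: measurable_sum => k.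
  exact: measurable_indic.
move=> x; have n0' : 0 < n%:R :> R by rewrite ltr0n.
apply/andP; split; first by rewrite mulr_ge0 ?invr_ge0 ?ler0n// sumr_ge0.
rewrite mulrC ler_pdivrMr// mul1r.
have : \sum_(0 <= k < n) \1_(E k) x <= \sum_(0 <= k < n) 1 :> R.
  by apply: ler_sum => k _; rewrite indicE; case: (_ \in _); rewrite ?ler01.
by rewrite sumr_const_nat subn0.
Qed.

Lemma Rint_simple (n : nat) (c : R) (E : nat -> set T) h :
  (forall k, measurable (E k)) -> L1 mu h ->
  \int[mu]_x ((c * \sum_(0 <= k < n) \1_(E k) x) * h x) =
  c * \sum_(0 <= k < n) \int[mu]_(x in E k) h x.
Proof.
move=> mE Ih.
have : L1 mu (fun x => (\sum_(0 <= k < n) \1_(E k) x) * h x) /\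
    \int[mu]_x ((\sum_(0 <= k < n) \1_(E k) x) * h x) =
    \sum_(0 <= k < n) \int[mu]_(x in E k) h x.
  elim: n => [|n [IH1 IH2]].
    rewrite big_geq// (_ : (fun x => _) = fun=> 0); last first.
      by apply/funext => x; rewrite big_geq// mul0r.
    by split; [exact: L1_cst | rewrite Rintegral_cst// mul0r].
  rewrite big_nat_recr//= -IH2 [X in _ + X]Rint_in -RintD//; last exact: L1_in.
  have -> : (fun x => (\sum_(0 <= k < n.+1) \1_(E k) x) * h x) =
      (fun x => (\sum_(0 <= k < n) \1_(E k) x) * h x) \+ (fun x => \1_(E n) x * h x).
    by apply/funext => x; rewrite big_nat_recr//= mulrDl.
  by split => //; apply: L1D => //; exact: L1_in.
move=> [I1 <-]; rewrite -RintZ//.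
by congr Rintegral; apply/funext => x; rewrite mulrA.
Qed.

End LayerCake.

Section RealParts.
Context (R : realType).
Implicit Types (b : bool) (c : R[i]).

(** A boolean selects the part, so that one proof covers both and parts can index a real family. *)
Definition part b c : R := if b then complex.Re c else complex.Im c.

Lemma partD b c c' : part b (c + c') = part b c + part b c'.
Proof. by case: b; rewrite /= ?ReD ?ImD. Qed.

Lemma partZ b (a : R) c : part b (a%:C * c) = a * part b c.
Proof. by case: b; rewrite /= ?ReZ ?ImZ. Qed.

Lemma part_sum b n (f : nat -> R[i]) :
  part b (\sum_(0 <= k < n) f k) = \sum_(0 <= k < n) part b (f k).
Proof. by case: b; rewrite /= ?Re_sum ?Im_sum. Qed.

Lemma part_cvg b (f : nat -> R[i]) (l : R[i]) : f n @[n --> \oo] --> (l : R[i]^o) ->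
  part b (f n) @[n --> \oo] --> part b l.
Proof. by move=> /cvg_complexP[? ?]; case: b. Qed.

Lemma part_ext c c' : (forall b, part b c = part b c') -> c = c'.
Proof.
move=> h; have := h true; have := h false.
by case: c {h} => p q; case: c' => p' q' /= -> ->.
Qed.

End RealParts.

(** * Scalar measures obtained from traces *)

Section TraceMeasure.
Context d (T : measurableType d) (R : realType).
Context (H : completeNormedModType R[i]) (dot : {dot H for conjC}).
Hypothesis dot_norm : forall x : H, `|x| ^+ 2 = dot x x.
Variables (e : nat -> H) (J : set nat).
Hypothesis basis_e : orthonormal_basis dot e J.
Variable nu : set T -> bop H.
Hypothesis nu_povm : is_povm dot e J nu.
Implicit Types (E F : set T) (s A B : bop H).

Local Notation trace := (trace dot e J).
Local Notation tr_cvg := (tr_cvg dot e J).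

Lemma povm_positive E : measurable E -> positive_op dot (nu E).
Proof. by have [+ _] := nu_povm; exact. Qed.

Lemma povm_tr_cvg s E : trace_class dot e J s -> measurable E -> tr_cvg s (nu E).
Proof. by move=> sT mE; exact: (tr_cvg_positive dot_norm basis_e sT (povm_positive mE)). Qed.

(** The trace against s is a coordinate of [trace_pairing], hence continuous for the ultraweak
    topology in which [nu] is countably additive. *)
Lemma povm_trace_sigma s (F : nat -> set T) : trace_class dot e J s ->
  (forall k, measurable (F k)) -> trivIset setT F ->
  \sum_(0 <= k < n) trace (s *o nu (F k)) @[n --> \oo] -->
    (trace (s *o nu (\bigcup_k F k)) : R[i]^o).
Proof.
move=> sT mF tF; have [_ /(_ F mF tF) h] := nu_povm.
pose s' : set_type (trace_class dot e J) := SigSub (mem_set sT).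
have cont : continuous (fun A : ultraweak dot e J =>
    (@trace_pairing R H dot e J A : {ptws trace_class dot e J -> R[i]^o}) s').
  move=> A; apply: (@continuous_comp _ _ _ (@trace_pairing R H dot e J : ultraweak dot e J -> _)
    (fun f : {ptws trace_class dot e J -> R[i]^o} => f s')).
    exact: initial_continuous.
  exact: (@proj_continuous (set_type (trace_class dot e J)) (fun=> R[i]^o) s').
apply: (cvgn_ext _ (continuous_cvg _ (cont _) h)) => n /=.
have [_ <-] := @tr_sum _ _ dot e J s (fun k => nu (F k)) n (fun k => povm_tr_cvg sT (mF k)).
by [].
Qed.

Lemma povm_part_sigma b s (F : nat -> set T) : trace_class dot e J s ->
  (forall k, measurable (F k)) -> trivIset setT F ->
  \sum_(0 <= k < n) part b (trace (s *o nu (F k))) @[n --> \oo] -->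
    part b (trace (s *o nu (\bigcup_k F k))).
Proof.
move=> sT mF tF; have h : part b (\sum_(0 <= k < n) trace (s *o nu (F k))) @[n --> \oo] -->
    part b (trace (s *o nu (\bigcup_k F k))) by apply: part_cvg; exact: povm_trace_sigma.
by apply: (@cvgn_ext R _ _ _ _ h) => n; exact: part_sum.
Qed.

(** For the constant sequence of empty sets, n lam(set0) converges, so its constant increments
    lam(set0) tend to 0. *)
Lemma sigma_set0 (lam : set T -> R) :
  (forall F : nat -> set T, (forall k, measurable (F k)) -> trivIset setT F ->
    \sum_(0 <= k < n) lam (F k) @[n --> \oo] --> lam (\bigcup_k F k)) ->
  lam set0 = 0.
Proof.
move=> /(_ (fun=> set0)) h.
have {}h : (fun n => n%:R * lam set0) @ \oo --> lam set0.
  rewrite -{2}(bigcup0 (fun (k : nat) (_ : setT k) => erefl (@set0 T))).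
  apply: (cvgn_ext _ (h _ _)) => //.
    by move=> n; rewrite sumr_const_nat subn0 mulr_natl.
  by move=> i j _ _ [x []].
have h2 : (fun n => n.+1%:R * lam set0 - n%:R * lam set0) @ \oo --> lam set0 - lam set0.
  by apply: cvgB => //; rewrite (cvg_shiftS (fun n => n%:R * lam set0)).
rewrite subrr in h2; apply: (cvg_unique (@Rhausdorff R) _ h2).
apply: (@cvgn_ext R (fun=> lam set0)) => [n|]; last exact: cvg_cst.
by rewrite -mulrBl -natr1 addrAC subrr add0r mul1r.
Qed.

Variable rho : bop H.
Hypothesis rho_state : is_state dot e J rho.

Let rhoT := state_trace_class rho_state.

Lemma povm_state_measure : exists mu : {finite_measure set T -> \bar R},
  forall E, measurable E -> povm_state dot e J nu rho E = mu E.
Proof.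
pose lam E := complex.Re (trace (rho *o nu E)).
have lamS (F : nat -> set T) := @povm_part_sigma true rho F rhoT.
(* A measure must be nonnegative on all sets, and [nu] is arbitrary on non-measurable ones; there
   the value is set to 0. *)
pose m E : \bar R := if `[< measurable E >] then (lam E)%:E else 0%E.
have mE E : measurable E -> m E = (lam E)%:E by move=> mE; rewrite /m asboolT.
have m0 : m set0 = 0%E by rewrite mE// (@sigma_set0 lam lamS).
have m_ge0 E : (0 <= m E)%E.
  rewrite /m; case: asboolP => // mE'; rewrite lee_fin.
  have [pr cr] := rho_state.
  exact: (trace_ge0 dot_norm basis_e pr (cvgP _ cr) (povm_positive mE')).
have mS : semi_sigma_additive m.
  move=> F mF tF mU; rewrite mE//.
  rewrite (_ : (fun n => _) = EFin \o (fun n => \sum_(0 <= k < n) lam (F k))).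
    by apply: cvg_EFin; [exact: nearW | exact: (lamS F mF tF)].
  apply/funext => n /=; rewrite -sumEFin; apply: eq_bigr => k _; exact: mE.
have mfin : fin_num_fun m by move=> E mE'; rewrite mE.
pose mu0 : {measure set T -> \bar R} :=
  HB.pack m (@isMeasure.Build d T R m m0 m_ge0 mS).
pose mu : {finite_measure set T -> \bar R} :=
  HB.pack (Measure.sort mu0) (@Measure_isFinite.Build d T R mu0 mfin).
by exists mu => E mE'; rewrite /= mE.
Qed.

End TraceMeasure.

Lemma separable_sequence (R : realType) (H : completeNormedModType R[i]) :
  separable H -> exists s : nat -> H, forall x (eps : R), 0 < eps ->
    exists k, nrm (s k - x) < eps.
Proof.
move=> [S cS dS]; have /countable_injP [f finj] := cS.
(* A left inverse of the injection [f] on the dense set; indices outside its image get the harmless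
   value 0. *)
exists (fun k => xget 0 [set y | S y /\ f y = k]) => x eps eps0.
have ob : open (ball x eps%:C : set H) by apply: ball_open; rewrite ltcR.
have nb : (ball x eps%:C : set H) !=set0.
  by exists x; apply: ballxx; rewrite ltcR.
have [y [By Sy]] := dS _ nb ob.
exists (f y).
have [S' fE] : [set y' | S y' /\ f y' = f y] (xget 0 [set y' | S y' /\ f y' = f y]).
  by apply: (@xgetPex _ 0 [set y' | S y' /\ f y' = f y]); exists y.
rewrite (finj _ _ (mem_set S') (mem_set Sy) fE).
by move: By; rewrite -ball_normE /= nrmE ltcR nrmBC.
Qed.

(** * The operator derivative as a density *)

Section Density.
Context d (T : measurableType d) (R : realType).
Context (H : completeNormedModType R[i]) (dot : {dot H for conjC}).
Hypothesis dot_norm : forall x : H, `|x| ^+ 2 = dot x x.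
Variables (e : nat -> H) (J : set nat).
Hypothesis basis_e : orthonormal_basis dot e J.
Hypothesis sepH : separable H.
Variable nu : set T -> bop H.
Hypothesis nu_povm : is_povm dot e J nu.
Variables (rho : bop H) (D : T -> bop H).
Hypothesis D_derivative : is_RN_derivative dot e J nu rho D.
Variable mu : {finite_measure set T -> \bar R}.
Hypothesis muE : forall E, measurable E -> povm_state dot e J nu rho E = mu E.
Implicit Types (E F : set T) (s A B : bop H) (u v w : H) (L : bop H -> R) (h : T -> R).

Local Notation trace := (trace dot e J).
Local Notation ebasis := (ebasis e J).
Local Notation bproj := (bproj dot e J).

Definition dens L h := L1 mu h /\ forall E, measurable E -> L (nu E) = \int[mu]_(x in E) h x.

Lemma densD L L' h h' : dens L h -> dens L' h' ->
  dens (fun A => L A + L' A) (fun x => h x + h' x).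
Proof.
move=> [Ih hE] [Ih' hE']; split; first exact: L1D.
move=> E mE; rewrite hE// hE'// RintegralD//; exact: (integrableS measurableT).
Qed.

Lemma densZ (a : R) L h : dens L h -> dens (fun A => a * L A) (fun x => a * h x).
Proof.
move=> [Ih hE]; split; first exact: L1Z.
by move=> E mE; rewrite hE// RintegralZl//; exact: (integrableS measurableT).
Qed.

Lemma dens0 : dens (fun=> 0) (fun=> 0).
Proof. by split; [exact: L1_cst | move=> E mE; rewrite Rintegral_cst// mul0r]. Qed.

(** Given for basis vectors by the definition of the derivative; bilinearity extends it to finite
    combinations, as far as one gets without a limit. *)
Definition dens_dot u v := forall b,
  dens (fun A => part b (dot (A u) v)) (fun x => part b (dot (D x u) v)).

Lemma dens_ext L L' h h' : L =1 L' -> h =1 h' -> dens L h -> dens L' h'.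
Proof. by move=> /funext -> /funext ->. Qed.

Lemma partM b (c z : R[i]) : part b (c * z) =
  complex.Re c * part b z + (if b then - 1 else 1) * (complex.Im c * part (~~ b) z).
Proof. by case: b; case: c => p q; case: z => p' q' /=; rewrite ?mulN1r ?mul1r. Qed.

Lemma dens_dot_ebasis i j : dens_dot (ebasis j) (ebasis i).
Proof.
have z0 u v : (forall A : bop H, dot (A u) v = 0) -> dens_dot u v.
  by move=> Z b; apply: dens_ext dens0 => z; rewrite Z; case: b.
rewrite /ebasis; case: ifPn => [jJ|_]; last by apply: z0 => A; rewrite bop0 linear0l.
case: ifPn => [iJ|_]; last by apply: z0 => A; rewrite linear0r.
have [[I1 I2] DE] := D_derivative (set_mem iJ) (set_mem jJ).
move=> b; split.
  by case: b; apply: (eq_setfun_integrable muE).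
move=> E mE; rewrite DE// /cintegral !(eq_setfun_integral muE).
by case: b.
Qed.

Lemma dens_dotDl u u' v : dens_dot u v -> dens_dot u' v -> dens_dot (u + u') v.
Proof.
move=> Du Du' b; apply: dens_ext (densD (Du b) (Du' b)) => z;
  by rewrite bopD dotDl partD.
Qed.

Lemma dens_dotDr u v v' : dens_dot u v -> dens_dot u v' -> dens_dot u (v + v').
Proof.
move=> Dv Dv' b; apply: dens_ext (densD (Dv b) (Dv' b)) => z;
  by rewrite dotDr partD.
Qed.

Lemma dens_dotZl c u v : dens_dot u v -> dens_dot (c *: u) v.
Proof.
move=> Du b; apply: dens_ext (densD (densZ (complex.Re c) (Du b))
  (densZ (if b then -1 else 1) (densZ (complex.Im c) (Du (~~ b))))) => z;
  by rewrite bopZ dotZl partM.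
Qed.

Lemma dens_dotZr c u v : dens_dot u v -> dens_dot u (c *: v).
Proof.
move=> Du b; apply: dens_ext (densD (densZ (complex.Re (conjc c)) (Du b))
  (densZ (if b then -1 else 1) (densZ (complex.Im (conjc c)) (Du (~~ b))))) => z;
  by rewrite dotZr partM.
Qed.

Lemma dens_dot_bproj n u m v : dens_dot (bproj n u) (bproj m v).
Proof.
have right j : dens_dot (ebasis j) (bproj m v).
  rewrite /bproj; elim: m => [|m IH].
    by rewrite big_geq// => b; apply: dens_ext dens0 => z; rewrite linear0r; case: b.
  rewrite big_nat_recr//; apply: dens_dotDr IH _; apply: dens_dotZr.
  exact: dens_dot_ebasis.
rewrite {1}/bproj; elim: n => [|n IH].
  by rewrite big_geq// => b; apply: dens_ext dens0 => z; rewrite bop0 linear0l; case: b.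
rewrite big_nat_recr//; apply: dens_dotDl IH _; apply: dens_dotZl.
exact: right.
Qed.

(** Absolute continuity comes with the derivative: every matrix entry of [nu E] is an integral over
    [E]. *)
Lemma povm_null E : measurable E -> mu E = 0 -> nu E = 0.
Proof.
move=> mE mu0; apply: (basis_ext basis_e) => i j iJ jJ.
have ij := @dens_dot_ebasis i j; rewrite !ebasisE// in ij.
rewrite bop0E linear0l; apply: part_ext => b.
have [Ih ->] := ij b; last by [].
rewrite /Rintegral null_set_integral//; first by case: b {Ih}.
by apply: (measurable_int mu); exact: (integrableS measurableT).
Qed.

Lemma povm_null_measure E : measurable E -> nu E = 0 -> mu E = 0.
Proof.
move=> mE nu0; rewrite -muE// /povm_state nu0.
by have [_ ->] := tr_zero dot e J rho.
Qed.

Lemma dens_bproj_ge0 n w E : measurable E ->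
  0 <= \int[mu]_(x in E) rdot dot (D x (bproj n w)) (bproj n w).
Proof.
move=> mE; have [_ /(_ E mE) <-] := @dens_dot_bproj n w n w true.
by have /positiveP[+ _] := povm_positive nu_povm mE; exact.
Qed.

(** Over every measurable set the real part has a nonnegative integral and the imaginary part
    integral 0; the exceptional set is covered by three null sets. *)
Lemma dens_bproj_null n w : mu.-negligible [set x |
  ~ 0 <= dot (D x (bproj n w)) (bproj n w)].
Proof.
set v := bproj n w.
have [I1 R1] := @dens_dot_bproj n w n w true.
have [I2 R2] := @dens_dot_bproj n w n w false.
pose N1 := [set x | rdot dot (D x v) v < 0].
pose N2 := [set x | complex.Im (dot (D x v) v) < 0].
pose N3 := [set x | -1 * complex.Im (dot (D x v) v) < 0].
have Im0 E : measurable E -> \int[mu]_(x in E) complex.Im (dot (D x v) v) = 0.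
  move=> mE; rewrite -(R2 E mE) /=.
  by have /positiveP[_] := povm_positive nu_povm mE; exact.
have mlt (g : T -> R) : L1 mu g -> measurable [set x | g x < 0].
  move=> /L1_measurable mg.
  rewrite (_ : [set x | g x < 0] = setT `&` g @^-1` `]-oo, 0[).
    by apply: mg => //; exact: measurable_itv.
  by rewrite setTI; apply/seteqP; split => x /=; rewrite in_itv.
have n1 : mu.-negligible N1.
  apply/negligibleP; first exact: (mlt _ I1).
  by apply: ae_ge0_from_Rint => // E mE; exact: dens_bproj_ge0.
have n2 : mu.-negligible N2.
  apply/negligibleP; first exact: (mlt _ I2).
  by apply: ae_ge0_from_Rint => // E mE; rewrite Im0.
have I3 := L1Z (-1) I2.
have n3 : mu.-negligible N3.
  apply/negligibleP; first exact: (mlt _ I3).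
  apply: ae_ge0_from_Rint => // E mE; rewrite RintegralZl ?Im0 ?mulr0//.
  exact: (integrableS measurableT).
apply: (negligibleS _ (negligibleU n1 (negligibleU n2 n3))) => x /= nx.
apply: contrapT => /not_orP[/negP h1] /not_orP[/negP h2 /negP h3]; apply: nx.
rewrite lecE /=; rewrite -!leNgt mulN1r oppr_ge0 in h1 h2 h3.
by apply/andP; split; [apply/eqP/le_anti/andP; split | exact: h1].
Qed.

(** Each vector has its own null set, and only countably many may be discarded: truncations of a
    dense sequence suffice, since D x is continuous. *)
Lemma derivative_positive_ae : exists2 N : set T, measurable N /\ mu N = 0 &
  forall x, ~ N x -> positive_op dot (D x).
Proof.
have [s sP] := separable_sequence sepH.
have [N [mN N0 sN]] : mu.-negligible (\bigcup_k \bigcup_n [set x |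
    ~ 0 <= dot (D x (bproj n (s k))) (bproj n (s k))]).
  apply: (@negligible_bigcup _ _ _ mu) => k.
  by apply: (@negligible_bigcup _ _ _ mu) => n; exact: dens_bproj_null.
exists N => // x Nx.
have pos_lim (u : nat -> H) y : u n @[n --> \oo] --> y ->
    (forall n, 0 <= dot (D x (u n)) (u n)) -> 0 <= dot (D x y) y.
  move=> uy u0; have := cvg_dot dot_norm (cvg_bop (A := D x) uy) uy.
  move=> /cvg_complexP[hr hi]; rewrite lecE /=; apply/andP; split.
    apply/eqP; apply: (cvg_unique (@Rhausdorff R) hi).
    apply: (@cvgn_ext R (fun=> 0)) => [n|]; last exact: cvg_cst.
    by have := u0 n; rewrite lecE => /andP[/eqP ->].
  apply: (limr_ge_cvg hr); apply: nearW => n.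
  by have := u0 n; rewrite lecE => /andP[].
have pos_s k : 0 <= dot (D x (s k)) (s k).
  apply: (pos_lim _ _ (bproj_cvg basis_e (x := s k))) => n.
  by apply: contrapT => h; apply: Nx; apply: sN; exists k => //; exists n.
move=> y.
have ex n : exists k, nrm (s k - y) < n.+1%:R^-1 by apply: sP; rewrite invr_gt0 ltr0n.
pose k n := projT1 (cid (ex n)).
have kP n : nrm (s (k n) - y) < n.+1%:R^-1 by exact: (projT2 (cid (ex n))).
apply: (pos_lim (fun n => s (k n))) => [|n]; last exact: pos_s.
apply/cvg_nrm; apply: (@squeeze0 _ _ (fun n => n.+1%:R^-1)).
  by move=> n; rewrite nrm_ge0 ltW.
exact: cvg_harmonic.
Qed.

End Density.

(** * Annihilating functions from non-injectivity *)

Section Annihilator.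
Context d (T : measurableType d) (R : realType).
Context (H : completeNormedModType R[i]) (dot : {dot H for conjC}).
Hypothesis dot_norm : forall x : H, `|x| ^+ 2 = dot x x.
Variables (e : nat -> H) (J : set nat).
Hypothesis basis_e : orthonormal_basis dot e J.
Hypothesis sepH : separable H.
Variable nu : set T -> bop H.
Hypothesis nu_povm : is_povm dot e J nu.
Variables (rho : bop H) (D : T -> bop H).
Hypothesis D_derivative : is_RN_derivative dot e J nu rho D.
Variable mu : {finite_measure set T -> \bar R}.
Hypothesis muE : forall E, measurable E -> povm_state dot e J nu rho E = mu E.
Hypothesis nu_noninj : classically_noninjective dot e J nu rho D.
Implicit Types (E F : set T) (s A B : bop H) (u v w : H) (f g : T -> R[i]).

Local Notation bproj := (bproj dot e J).

Lemma part_le_norm b (c : R[i]) : `|part b c|%:C <= `|c|.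
Proof.
case: c => p q; rewrite normc_def lecR -[leLHS]sqrtr_sqr ler_wsqrtr//.
by case: b => /=; rewrite ?lerDl ?lerDr sqr_ge0.
Qed.

Lemma norm_leNgt (M : R) (c : R[i]) : ~ (M%:C < `|c|) -> `|c| <= M%:C.
Proof. by rewrite normc_def ltcR lecR => /negP; rewrite -leNgt. Qed.

Lemma cmeasurable_part b f : cmeasurable f -> measurable_fun setT (fun x => part b (f x)).
Proof. by move=> [? ?]; case: b. Qed.

Lemma cmeasurable_norm_gt f (M : R) : 0 <= M -> cmeasurable f ->
  measurable [set x | M%:C < `|f x|].
Proof.
move=> M0 [mr mi].
pose k x := complex.Re (f x) ^+ 2 + complex.Im (f x) ^+ 2.
have mk : measurable_fun setT k.
  by apply: measurable_funD; apply: measurable_funX.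
rewrite (_ : [set x | _] = setT `&` k @^-1` `]M ^+ 2, +oo[).
  by apply: mk => //; exact: measurable_itv.
rewrite setTI; apply/seteqP; split => x; rewrite /= in_itv /= andbT normc_def ltcR -/(k x).
  by move=> h; rewrite -[ltRHS]sqr_sqrtr ?ltr_sqr ?nnegrE ?sqrtr_ge0// addr_ge0 ?sqr_ge0.
move=> h; rewrite -ltr_sqr ?nnegrE ?sqrtr_ge0// sqr_sqrtr//.
by rewrite addr_ge0 ?sqr_ge0.
Qed.

(** [opsqrt] falls back on 0 when there is no root; existence rules this out for positive
    operators. *)
Lemma opsqrtP A : positive_op dot A -> opsqrt dot A *o opsqrt dot A = A.
Proof.
move=> pA; have [B sB] := opsqrt_exists dot_norm pA.
by have [_] : is_opsqrt dot A (opsqrt dot A) by apply: xgetPex; exists B.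
Qed.

(** Tests the integral with the rank one state of v. The integrand contains the square of
    [opsqrt (D x)], which is D x only where D x is positive, so the formula for [G] is
    conditional. *)
Lemma qintegral_rank1 f A v : nrm v = 1 ->
  is_qintegral dot e J nu rho D (fun x => f x *: bid H) A -> forall b,
  exists G : T -> R, [/\ L1 mu G, part b (dot (A v) v) = \int[mu]_x G x &
    forall x, positive_op dot (D x) -> G x = part b (f x) * rdot dot (D x v) v].
Proof.
move=> v1 /(_ _ (rank1_state dot_norm basis_e v1)) [[I1 I2] trE] b.
have trv C : trace dot e J (rank1 dot_norm v *o C) = dot (C v) v.
  by have [_ ->] := rank1_trace dot_norm basis_e v C.
exists (fun x => part b (f x * dot (opsqrt dot (D x) (opsqrt dot (D x) v)) v)).
have GE x : trace dot e J (rank1 dot_norm v *o (opsqrt dot (D x) *o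
    ((f x *: bid H) *o opsqrt dot (D x)))) =
    f x * dot (opsqrt dot (D x) (opsqrt dot (D x) v)) v.
  by rewrite trv !bcompE bopZE bopZ dotZl.
split.
- have E1 : (fun x => (complex.Re (trace dot e J (rank1 dot_norm v *o (opsqrt dot (D x) *o
    ((f x *: bid H) *o opsqrt dot (D x))))))%:E) =
    EFin \o (fun x => part true (f x * dot (opsqrt dot (D x) (opsqrt dot (D x) v)) v)).
    by apply/funext => x; rewrite GE.
  have E2 : (fun x => (complex.Im (trace dot e J (rank1 dot_norm v *o (opsqrt dot (D x) *o
    ((f x *: bid H) *o opsqrt dot (D x))))))%:E) =
    EFin \o (fun x => part false (f x * dot (opsqrt dot (D x) (opsqrt dot (D x) v)) v)).
    by apply/funext => x; rewrite GE.
  rewrite E1 in I1; rewrite E2 in I2.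
  by case: b; apply: (eq_setfun_integrable muE).
- rewrite -trv trE /cintegral !(eq_setfun_integral muE).
  rewrite /Rintegral; case: b => /=; congr fine; apply: eq_integral => x _;
    by rewrite GE.
- move=> x pD; rewrite -bcompE opsqrtP//.
  have -> : dot (D x v) v = (rdot dot (D x v) v)%:C.
    by rewrite /rdot RRe_real// ger0_real// pD.
  by rewrite mulrC partZ mulrC.
Qed.

Lemma bprojZ n c w : bproj n (c *: w) = c *: bproj n w.
Proof.
rewrite /bproj scaler_sumr; apply: eq_bigr => k _.
by rewrite dotZl scalerA.
Qed.

Lemma dens_dot_self n w : dens_dot dot nu D mu (bproj n w) (bproj n w).
Proof. exact: (dens_dot_bproj D_derivative muE). Qed.

(** The difference of two functions with equal integrals is annihilated by each <D v, v>. These are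
    real almost everywhere, so its real and imaginary parts are annihilated separately, and one of
    them is not null. *)
Lemma real_annihilator E : measurable E -> mu E != 0 ->
  exists r : T -> R, [/\ measurable_fun setT r, exists M, forall x, `|r x| <= M,
    forall x, ~ E x -> r x = 0, mu [set x | r x != 0] != 0 &
    forall n w, \int[mu]_x (r x * rdot dot (D x (bproj n w)) (bproj n w)) = 0].
Proof.
move=> mE muE0.
have nuE0 : nu E <> 0.
  by move=> nuE; move/eqP: muE0; apply; exact: (povm_null_measure muE mE nuE).
have [f [g [[mf fE [Mf Mf0 fM]] [mg gE [Mg Mg0 gM]] fg [A [fA gA]]]]] := nu_noninj mE nuE0.
have mfg b : measurable [set x | part b (f x) != part b (g x)].
  have mB : measurable_fun setT (fun x => part b (f x) - part b (g x)).
    by apply: measurable_funB; exact: cmeasurable_part.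
  rewrite (_ : [set x | _] = setT `&` (fun x => part b (f x) - part b (g x)) @^-1` (~` [set 0])).
    by apply: mB => //; exact: measurableC.
  rewrite setTI; apply/seteqP; split => x /=.
    by move=> h; apply/eqP; rewrite subr_eq0.
  by move=> /eqP; rewrite subr_eq0.
have [b bn0] : exists b, mu [set x | part b (f x) != part b (g x)] != 0.
  apply: contrapT => /forallNP h; apply: fg.
  have fgE : [set x | f x <> g x] = [set x | part true (f x) != part true (g x)] `|`
      [set x | part false (f x) != part false (g x)].
    apply/seteqP; split => x /=.
      move=> nfg; apply: contrapT => /not_orP[/negP h1 /negP h2]; apply: nfg.
      by apply: part_ext; case; apply/eqP; rewrite -[_ == _]negbK.
    by move=> [] /eqP nfg fgx; apply: nfg; rewrite fgx.
  rewrite fgE; apply: (povm_null basis_e D_derivative muE); first exact: measurableU.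
  apply/eqP; rewrite -measure_le0; apply: le_trans (measureU2 mu (mfg true) (mfg false)) _.
  have /negP/negPn/eqP h1 := h true; have /negP/negPn/eqP h2 := h false.
  by rewrite [X in (X + _)%E]h1 [X in (_ + X)%E]h2 adde0.
(* [f] and [g] are bounded only off a null set, whereas [r] must be bounded everywhere. *)
pose Bc := [set x | Mf%:C < `|f x|] `|` [set x | Mg%:C < `|g x|].
have mBf := cmeasurable_norm_gt Mf0 mf; have mBg := cmeasurable_norm_gt Mg0 mg.
have mBc : measurable Bc by exact: measurableU.
have Bc0 : mu Bc = 0.
  have h1 := povm_null_measure muE mBf fM.
  have h2 := povm_null_measure muE mBg gM.
  apply/eqP; rewrite -measure_le0; apply: le_trans (measureU2 mu mBf mBg) _.
  by rewrite [X in (X + _)%E]h1 [X in (_ + X)%E]h2 adde0.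
pose r x := \1_(~` Bc) x * (part b (f x) - part b (g x)).
have mr : measurable_fun setT r.
  apply: measurable_funM; first exact/measurable_indic/measurableC.
  by apply: measurable_funB; exact: cmeasurable_part.
have rBc x : ~ Bc x -> r x = part b (f x) - part b (g x).
  by move=> nB; rewrite /r indicE mem_set// mul1r.
have rB x : Bc x -> r x = 0.
  by move=> B; rewrite /r indicE memNset ?mul0r//; exact.
have br : exists M, forall x, `|r x| <= M.
  exists (Mf + Mg) => x; have [B|nB] := pselect (Bc x).
    by rewrite rB// normr0 addr_ge0.
  rewrite rBc//; apply: le_trans (ler_normB _ _) _; apply: lerD.
    rewrite -lecR; apply: le_trans (part_le_norm _ _) _.
    by apply: norm_leNgt => h; apply: nB; left.
  rewrite -lecR; apply: le_trans (part_le_norm _ _) _.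
  by apply: norm_leNgt => h; apply: nB; right.
exists r; split => //.
- move=> x nE; rewrite /r fE// gE// subrr mulr0 //.
- apply/negP => /eqP r0; move/negP: bn0; apply; apply/eqP.
  have mr0 : measurable [set x | r x != 0].
    rewrite (_ : [set x | _] = setT `&` r @^-1` (~` [set 0])).
      by apply: mr => //; exact: measurableC.
    by rewrite setTI; apply/seteqP; split => x /eqP.
  apply: (@subset_measure0 _ _ _ mu _ ([set x | r x != 0] `|` Bc)) => //.
  + exact: measurableU.
  + move=> x /= h; have [B|nB] := pselect (Bc x); [by right | left].
    by rewrite rBc// subr_eq0.
  + apply/eqP; rewrite -measure_le0; apply: le_trans (measureU2 mu mr0 mBc) _.
    by rewrite [X in (X + _)%E]r0 [X in (_ + X)%E]Bc0 adde0.
- have [N [mN N0] DN] := derivative_positive_ae dot_norm basis_e sepH nu_povm D_derivative muE.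
  have unit n w : nrm (bproj n w) = 1 ->
      \int[mu]_x (r x * rdot dot (D x (bproj n w)) (bproj n w)) = 0.
    move=> v1; set v := bproj n w.
    have [Gf [If EfG Gf_ae]] := qintegral_rank1 v1 fA b.
    have [Gg [Ig EgG Gg_ae]] := qintegral_rank1 v1 gA b.
    have [Iq _] := dens_dot_self n w true.
    have -> : \int[mu]_x (r x * rdot dot (D x v) v) = \int[mu]_x (Gf x - Gg x).
      rewrite /Rintegral; congr fine; apply: ae_eq_integral => //.
      - apply/measurable_EFinP; apply: measurable_funM => //; exact: (L1_measurable Iq).
      - apply/measurable_EFinP; apply: measurable_funB; [exact: (L1_measurable If)|exact: (L1_measurable Ig)].
      exists (N `|` Bc); split.
      - exact: measurableU.
      - apply/eqP; rewrite -measure_le0; apply: le_trans (measureU2 mu mN mBc) _.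
        by rewrite [X in (X + _)%E]N0 [X in (_ + X)%E]Bc0 adde0.
      - move=> x /= nx; apply: contrapT => /not_orP[nN nB]; apply: nx => _.
        by rewrite rBc// (Gf_ae _ (DN x nN)) (Gg_ae _ (DN x nN)) -mulrBl.
    by rewrite RintB// -EfG -EgG subrr.
  move=> n w; set v := bproj n w.
  have [v0|v0] := eqVneq v 0.
    rewrite v0 (_ : (fun x => _) = fun=> 0) ?Rintegral_cst ?mul0r//.
    by apply/funext => x; rewrite rdotC rdot0l mulr0.
  have nv : 0 < nrm v by rewrite lt0r nrm_eq0 v0 nrm_ge0.
  (* Only unit vectors give states; [bproj] is homogeneous, so the normalized vector is again a
     truncation and the form merely scales. *)
  have E1 : bproj n ((nrm v)^-1%:C *: w) = (nrm v)^-1%:C *: v by rewrite bprojZ.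
  have [Iq _] := dens_dot_self n w true.
  have := unit n ((nrm v)^-1%:C *: w); rewrite E1 nrmZr normfV (ger0_norm (nrm_ge0 _)).
  rewrite mulVf ?gt_eqF// => /(_ erefl).
  under eq_Rintegral do rewrite bopZ rdotZl rdotZr mulrA mulrCA.
  rewrite RintZ; last exact: L1M.
  move=> /eqP; rewrite mulf_eq0 => /orP[|/eqP //].
  by rewrite mulf_eq0 orbb invr_eq0 gt_eqF.
Qed.

End Annihilator.

(** Neighbourhoods come from the target: a point of [A] lying over a cluster point of the image
    filter is a cluster point of the original filter. *)
Lemma compact_initial (S : choiceType) (U : topologicalType) (f : S -> U) (A : set S) :
  compact (f @` A) -> compact (A : set (initial_topology f)).
Proof.
move=> cfA F PF FA.
have FS B : F B -> (f @ F) (f @` B).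
  by move=> FB; apply: (@filterS S F _ B (f @^-1` (f @` B))) FB => x Bx; exists x.
have [_ [[a Aa <-] Fa]] := cfA (f @ F) (fmap_proper_filter f PF) (FS _ FA).
exists a; split => // B V FB [W [[Z oZ <-] Za] ZV].
have nZ : nbhs (f a) Z by exact: open_nbhs_nbhs.
have [_ [[x Bx <-] Zfx]] := Fa _ _ (FS _ FB) nZ.
by exists x; split => //; exact: ZV.
Qed.

Lemma continuous_complex (Z : topologicalType) (R : realType) (a b : Z -> R) :
  continuous a -> continuous b -> continuous (fun z => a z +i* b z : R[i]^o).
Proof.
move=> ca cb z.
apply: (proj2 (@cvgrPdist_lt R[i] R[i]^o _ _ _ (fun z => a z +i* b z) (a z +i* b z))) => eps eps0.
have [e1 eE] : 0 < complex.Re eps /\ eps = (complex.Re eps)%:C.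
  by case: eps eps0 => p q; rewrite ltcE /= => /andP[/eqP -> p0].
have e2 : 0 < complex.Re eps / 2 by lra.
have /cvgrPdist_lt /(_ _ e2) ha := ca z.
have /cvgrPdist_lt /(_ _ e2) hb := cb z.
near=> y.
have h1 : `|a z - a y| < complex.Re eps / 2 by near: y.
have h2 : `|b z - b y| < complex.Re eps / 2 by near: y.
have -> : (a z +i* b z) - (a y +i* b y) = (a z - a y)%:C + 'i * (b z - b y)%:C by simpc.
rewrite eE; apply: le_lt_trans (ler_normD _ _) _.
rewrite normrM !normc_def /= !expr0n !expr1n !addr0 !add0r sqrtr1 mul1r !sqrtr_sqr.
rewrite -rmorphD /= ltcR; lra.
Unshelve. all: by end_near.
Qed.

Lemma small_eq0 (R : realType) (x K : R) :
  (forall n : nat, (0 < n)%N -> `|x| <= n%:R^-1 * K) -> x = 0.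
Proof.
move=> h; apply/eqP; rewrite -normr_le0.
have hK : (fun n : nat => n.+1%:R^-1 * K) @ \oo --> 0 * K.
  by apply: cvgMr_tmp; exact: cvg_harmonic.
rewrite mul0r in hK; apply: (limr_ge_cvg hK); apply: nearW => n; exact: h.
Qed.

(** * Compactness and convexity of the range *)

Section Range.
Context d (T : measurableType d) (R : realType).
Context (H : completeNormedModType R[i]) (dot : {dot H for conjC}).
Hypothesis dot_norm : forall x : H, `|x| ^+ 2 = dot x x.
Variables (e : nat -> H) (J : set nat).
Hypothesis basis_e : orthonormal_basis dot e J.
Hypothesis sepH : separable H.
Variable nu : set T -> bop H.
Hypothesis nu_povm : is_povm dot e J nu.
Variables (rho : bop H) (D : T -> bop H).
Hypothesis D_derivative : is_RN_derivative dot e J nu rho D.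
Variable mu : {finite_measure set T -> \bar R}.
Hypothesis muE : forall E, measurable E -> povm_state dot e J nu rho E = mu E.
Implicit Types (E F G : set T) (s A B : bop H) (u v w : H) (h : T -> R).

Local Notation trace := (trace dot e J).
Local Notation tr_cvg := (tr_cvg dot e J).
Local Notation bproj := (bproj dot e J).
Local Notation qform n w := (fun x => rdot dot (D x (bproj n w)) (bproj n w)).

Lemma positive_sum (A : nat -> bop H) n :
  (forall k, positive_op dot (A k)) -> positive_op dot (\sum_(0 <= k < n) A k).
Proof.
move=> pA; elim: n => [|n IH].
  by rewrite big_geq// => x; rewrite bop0E linear0l.
rewrite big_nat_recr; last by [].
by apply: positiveD; [exact: IH | exact: pA].
Qed.

Lemma rdot_sum (A : nat -> bop H) n v w :
  rdot dot ((\sum_(0 <= k < n) A k : bop H) v) w = \sum_(0 <= k < n) rdot dot (A k v) w.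
Proof.
elim: n => [|n IH]; first by rewrite !big_geq// bop0E rdot0l.
rewrite big_nat_recr; last by [].
by rewrite bopDE rdotDl IH [in RHS]big_nat_recr.
Qed.

(** Nothing relates this density to D pointwise; it is known through its integrals over sets
    only. *)
Lemma trace_density b s : trace_class dot e J s ->
  exists2 h, L1 mu h & forall E, measurable E -> part b (trace (s *o nu E)) = \int[mu]_(x in E) h x.
Proof.
move=> sT; apply: radon_nikodym_real.
  by move=> F mF tF; exact: (povm_part_sigma dot_norm basis_e nu_povm).
move=> A mA muA0; rewrite (povm_null basis_e D_derivative muE mA muA0).
by have [_ ->] := tr_zero dot e J s; case: b.
Qed.

(* Simple functions close to u turn the hypothesis into smallness of a positive
   operator, which the trace against s controls. *)
Lemma half_transfer (u : T -> R) b s h : unit_fun u ->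
  (forall n w, \int[mu]_x (u x * qform n w x) = 2^-1 * \int[mu]_x qform n w x) ->
  trace_class dot e J s -> L1 mu h ->
  (forall E, measurable E -> part b (trace (s *o nu E)) = \int[mu]_(x in E) h x) ->
  \int[mu]_x (u x * h x) = 2^-1 * \int[mu]_x h x.
Proof.
move=> uu uq sT Ih hE.
have [C C0 sC] := trace_class_cvg dot_norm basis_e sT.
pose N := nu setT; have pN : positive_op dot N := povm_positive nu_povm measurableT.
have [c c0 Nc] := bop_bounded N.
(* The three terms bound n times three errors: the trace of [P], the shift by [N] / n, and the
   replacement of [u] by [un]. *)
pose K := C * (c + 1) + `|\int[mu]_x h x| + \int[mu]_x `|h x|.
apply/eqP; rewrite -subr_eq0; apply/eqP; apply: (@small_eq0 _ _ K) => n n0.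
have n0' : 0 < n%:R :> R by rewrite ltr0n.
have ni : 0 < n%:R^-1 :> R by rewrite invr_gt0.
have [E mE uE] := layer_cake uu n0.
pose un x : R := n%:R^-1 * \sum_(0 <= k < n) \1_(E k) x.
have uun : unit_fun un := simple_unit_fun R n0 mE.
pose S := \sum_(0 <= k < n) nu (E k).
have pS : positive_op dot S.
  apply: positive_sum => k; exact: (povm_positive nu_povm (mE k)).
pose A := (n%:R^-1)%:C *: S.
(* The integral of un + 1/n - 1/2. As un <= u <= un + 1/n and [u] integrates each form to half of
   its total, the form of [P] lies between 0 and 1/n times that of [N]. *)
pose P := A + (n%:R^-1)%:C *: N + (- 2^-1)%:C *: N.
have [sS trS] : tr_cvg s S /\ trace (s *o S) = \sum_(0 <= k < n) trace (s *o nu (E k)).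
  apply: tr_sum => k; exact: (povm_tr_cvg dot_norm basis_e nu_povm sT (mE k)).
have sN : tr_cvg s N := povm_tr_cvg dot_norm basis_e nu_povm sT measurableT.
have [sA trA] := tr_scale (n%:R^-1)%:C sS.
have [s1 tr1] := tr_scale (n%:R^-1)%:C sN.
have [s2 tr2] := tr_scale (- 2^-1)%:C sN.
have [s3 tr3] := tr_add sA s1.
have [s4 tr4] := tr_add s3 s2.
have hP : part b (trace (s *o P)) = \int[mu]_x (un x * h x) +
    n%:R^-1 * \int[mu]_x h x - 2^-1 * \int[mu]_x h x.
  rewrite /P /A tr4 tr3 tr2 tr1 trA trS !partD !partZ part_sum (hE _ measurableT).
  rewrite mulNr; congr (_ + _ - _); rewrite /un Rint_simple//; congr (_ * _).
  by apply: eq_bigr => k _; exact: hE.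
have quad m w : let v := bproj m w in
    0 <= rdot dot (P v) v <= n%:R^-1 * rdot dot (N v) v.
  move=> v.
  have [Iq qE] := dens_dot_self D_derivative muE m w true.
  have q0 F : measurable F -> 0 <= \int[mu]_(x in F) qform m w x.
    by move=> mF; exact: (dens_bproj_ge0 nu_povm D_derivative muE).
  have NE : rdot dot (N v) v = \int[mu]_x qform m w x by exact: (qE _ measurableT).
  have AE : rdot dot (A v) v = \int[mu]_x (un x * qform m w x).
    rewrite /A bopZE rdotZl /un Rint_simple//; congr (_ * _).
    rewrite /S rdot_sum; apply: eq_bigr => k _; exact: (qE _ (mE k)).
  have -> : rdot dot (P v) v = \int[mu]_x (un x * qform m w x) +
      n%:R^-1 * \int[mu]_x qform m w x - \int[mu]_x (u x * qform m w x).
    by rewrite /P !bopDE !rdotDl AE !bopZE !rdotZl NE uq mulNr.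
  have le1 : \int[mu]_x (un x * qform m w x) <= \int[mu]_x (u x * qform m w x).
    apply: le_Rint_of_sets => //; [by case: uun|exact: unit_fun_bounded|by case: uu|exact: unit_fun_bounded|].
    by move=> x; have /andP[] := uE x; rewrite subr_ge0.
  have le2 : \int[mu]_x (u x * qform m w x) <= \int[mu]_x ((un x + n%:R^-1) * qform m w x).
    apply: le_Rint_of_sets => //; [by case: uu|exact: unit_fun_bounded| | |].
    - by apply: measurable_funD => //; case: uun.
    - have [M unM] := unit_fun_bounded uun; exists (M + n%:R^-1) => x.
      apply: le_trans (ler_normD _ _) _; apply: lerD => //.
      by rewrite ger0_norm// ltW.
    - by move=> x; have /andP[_] := uE x; rewrite lerBlDl.
  have E2 : \int[mu]_x ((un x + n%:R^-1) * qform m w x) =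
      \int[mu]_x (un x * qform m w x) + n%:R^-1 * \int[mu]_x qform m w x.
    rewrite -RintZ// -RintD; [|exact: L1_unit|exact: L1Z].
    by congr Rintegral; apply/funext => x; rewrite mulrDl.
  by rewrite NE; apply/andP; split; lra.
(* [quad] reaches only truncated vectors; both forms are continuous, so m tending to infinity covers
   every [w]. *)
have quadH w : 0 <= rdot dot (P w) w <= n%:R^-1 * rdot dot (N w) w.
  have cv := bproj_cvg basis_e (x := w).
  have cP := cvg_rdot dot_norm (cvg_bop (A := P) cv) cv.
  have cN := cvg_rdot dot_norm (cvg_bop (A := N) cv) cv.
  apply/andP; split.
    by apply: (limr_ge_cvg cP); apply: nearW => m; have /andP[] := quad m w.
  rewrite -subr_ge0.
  have cNP : n%:R^-1 * rdot dot (N (bproj m w)) (bproj m w) -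
      rdot dot (P (bproj m w)) (bproj m w) @[m --> \oo] -->
      n%:R^-1 * rdot dot (N w) w - rdot dot (P w) w.
    by apply: cvgB => //; exact: cvgMl_tmp.
  by apply: (limr_ge_cvg cNP); apply: nearW => m; rewrite subr_ge0; have /andP[] := quad m w.
have pP : positive_op dot P.
  apply: selfadjoint_positive => [x y|x]; last by have /andP[] := quadH x.
  rewrite !bopDE !bopZE !dotDl !dotDr !dotZl !dotZr !conjc_real.
  by rewrite (positive_selfadjoint pN) (positive_selfadjoint pS).
have a0 : 0 < n%:R^-1 * (c + 1) by rewrite mulr_gt0//; lra.
have Pa x : rdot dot (P x) x <= n%:R^-1 * (c + 1) * nrm x ^+ 2.
  have /andP[_ h2] := quadH x; apply: le_trans h2 _; rewrite -mulrA ler_pM2l//.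
  by apply: (opbound_positive_rdot dot_norm); apply: opbound_le Nc; lra.
have [_ [bR bI]] := sC P _ pP a0 Pa.
have bP : `|part b (trace (s *o P))| <= C * (n%:R^-1 * (c + 1)) by case: b {hE hP}.
have close : `|\int[mu]_x (u x * h x) - \int[mu]_x (un x * h x)| <= n%:R^-1 * \int[mu]_x `|h x|.
  rewrite -RintB; [|exact: L1_unit|exact: L1_unit].
  have Id : L1 mu (fun x => (u x - un x) * h x).
    apply: L1M => //; first by apply: measurable_funB; [case: uu|case: uun].
    exists n%:R^-1 => x; have /andP[d0 d1] := uE x; by rewrite ger0_norm.
  have -> : Rintegral mu setT (fun x => u x * h x - un x * h x) =
      \int[mu]_x ((u x - un x) * h x).
    by congr Rintegral; apply/funext => x; rewrite mulrBl.
  apply: le_trans (le_normr_Rintegral measurableT Id) _.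
  rewrite -RintZ; last exact: L1_norm.
  apply: le_Rint; [exact: L1_norm|by apply: L1Z; exact: L1_norm|].
  move=> x; rewrite normrM ler_wpM2r//; have /andP[d0 d1] := uE x; by rewrite ger0_norm.
rewrite hP in bP.
have bn : `|n%:R^-1 * \int[mu]_x h x| <= n%:R^-1 * `|\int[mu]_x h x|.
  by rewrite normrM ger0_norm// ltW.
rewrite /K 2!mulrDr; move: bP close bn.
rewrite [C * (_ * _)]mulrCA.
move: (\int[mu]_x (u x * h x)) (\int[mu]_x (un x * h x)) (\int[mu]_x h x) => X Y Z.
move: (n%:R^-1 * Z) (n%:R^-1 * `|Z|) (n%:R^-1 * \int[mu]_x `|h x|) (n%:R^-1 * (C * (c + 1))) => p q r t.
rewrite !ler_norml => /andP[? ?] /andP[? ?] /andP[? ?]; apply/andP; split; lra.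
Qed.

Hypothesis nu_noninj : classically_noninjective dot e J nu rho D.

(** One real density for each trace class operator and each part: together they record every
    coordinate of [trace_pairing]. *)
Let index := (set_type (trace_class dot e J) * bool)%type.

Let idx_class (i : index) : trace_class dot e J (set_val i.1).
Proof. exact: set_valP. Qed.

Let dh (i : index) : T -> R := projT1 (cid2 (trace_density i.2 (idx_class i))).

Let dh_L1 i : L1 mu (dh i).
Proof. by rewrite /dh; case: (cid2 _). Qed.

Let dhE i E : measurable E ->
  part i.2 (trace (set_val i.1 *o nu E)) = \int[mu]_(x in E) dh i x.
Proof. by rewrite /dh; case: (cid2 _) => h Ih hE /= mE; exact: hE. Qed.

Let annihilator E : measurable E -> mu E != 0 ->
  exists r : T -> R, [/\ measurable_fun setT r, exists M, forall x, `|r x| <= M,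
    forall x, ~ E x -> r x = 0, mu [set x | r x != 0] != 0 &
    forall i, \int[mu]_x (r x * dh i x) = 0].
Proof.
move=> mE muE0.
have [r [mr [M rM] rE r0 rq]] := real_annihilator dot_norm basis_e sepH nu_povm
  D_derivative muE nu_noninj mE muE0.
exists r; split => // [|i]; first by exists M.
pose M' := `|M| + 1; have M0 : 0 < M' by rewrite /M'; have := normr_ge0 M; lra.
have rM' x : `|r x| <= M'.
  by apply: le_trans (rM x) _; rewrite /M'; have := ler_norm M; lra.
pose u x := (2 * M')^-1 * (r x + M').
have uu : unit_fun u.
  split; first by apply: measurable_funM => //; apply: measurable_funD.
  move=> x; have := rM' x; rewrite ler_norml => /andP[h1 h2].
  rewrite /u; apply/andP; split; first by rewrite mulr_ge0 ?invr_ge0; lra.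
  by rewrite mulrC ler_pdivrMr; lra.
have ru (k : T -> R) : L1 mu k -> \int[mu]_x (u x * k x) =
    (2 * M')^-1 * \int[mu]_x (r x * k x) + 2^-1 * \int[mu]_x k x.
  move=> Ik; have Irk : L1 mu (fun x => r x * k x) by apply: L1M => //; exists M.
  rewrite -!RintZ// -RintD; [|exact: L1Z|exact: L1Z].
  congr Rintegral; apply/funext => x; rewrite /u.
  by field; rewrite gt_eqF.
have := @half_transfer u i.2 (set_val i.1) (dh i) uu _ (idx_class i) (dh_L1 i) (@dhE i).
rewrite ru//.
have h n w : \int[mu]_x (u x * qform n w x) = 2^-1 * \int[mu]_x qform n w x.
  have [Iq _] := dens_dot_self D_derivative muE n w true.
  by rewrite ru// rq mulr0 add0r.
move=> /(_ h) /eqP; rewrite -subr_eq0 addrK mulf_eq0 => /orP[|/eqP //].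
by rewrite invr_eq0 gt_eqF//; lra.
Qed.

(** The ultraweak topology is initial for [trace_pairing], so it suffices that the image is compact;
    [Fc] reassembles it continuously from the real family [K]. *)
Lemma povm_range_compact : compact (povm_range nu : set (ultraweak dot e J)).
Proof.
apply: compact_initial.
pose K : set {ptws index -> R} :=
  [set (fun i => \int[mu]_(x in G) dh i x) | G in measurable].
have cK : compact K := compact_range dh_L1 annihilator.
pose Fc (phi : {ptws index -> R}) : {ptws trace_class dot e J -> R[i]^o} :=
  fun s : set_type (trace_class dot e J) => phi (s, true) +i* phi (s, false).
have -> : (@trace_pairing R H dot e J : bop H -> _) @` povm_range nu = Fc @` K.
  have E G : measurable G -> Fc (fun i => \int[mu]_(x in G) dh i x) = trace_pairing (nu G).
    move=> mG; apply: (@funext (set_type (trace_class dot e J)) R[i]) => s.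
    rewrite /Fc -!dhE// /trace_pairing /=.
    by case: (trace _).
  apply/seteqP; split => [_ [_ [G mG <-] <-]|_ [_ [G mG <-] <-]].
    by exists (fun i => \int[mu]_(x in G) dh i x); [exists G | exact: E].
  by exists (nu G); [exists G | rewrite E].
apply: continuous_compact => //.
apply: continuous_subspaceT; apply: continuous_ptws => s.
apply: (@continuous_complex {ptws index -> R} R (fun phi => phi (s, true)) (fun phi => phi (s, false))).
  exact: (@proj_continuous index (fun=> R) (s, true)).
exact: (@proj_continuous index (fun=> R) (s, false)).
Qed.

(** The same convex combination of the two indicators has values in [0, 1], so some set [G] has the
    same integrals against all the densities. *)
Lemma povm_range_convex : convex_set (povm_range nu).
Proof.
move=> _ _ l /set_mem[E mE <-] /set_mem[F mF <-]; apply/mem_set.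
have l0 : 0 <= l%:num by [].
have l1 : l%:num <= 1 by [].
(* The weight is an element of [R[i]] between 0 and 1, and the order forces it to be real. *)
have [t tE] : exists t : R, l%:num = t%:C.
  by exists (complex.Re l%:num); rewrite RRe_real// ger0_real.
rewrite tE in l0 l1; rewrite ler0c in l0; rewrite -[1]/((1 : R)%:C) lecR in l1.
pose g x := t * \1_E x + (1 - t) * \1_F x.
have ug : unit_fun g.
  split.
    by apply: measurable_funD; apply: measurable_funM => //; exact: measurable_indic.
  move=> x; rewrite /g !indicE.
  by case: (x \in E); case: (x \in F); rewrite ?mulr1 ?mulr0; apply/andP; split; lra.
have [G mG GE] := unit_fun_set dh_L1 annihilator ug.
exists G => //.
change (nu G = l%:num *: nu E + (1 - l%:num) *: nu F).
rewrite tE; have -> : 1 - t%:C = (1 - t)%:C by rewrite rmorphB.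
have pos := povm_positive nu_povm.
apply: (positive_eq dot_norm) => [||w].
- exact: pos.
- by apply: positiveD; apply: positiveZ; rewrite ?subr_ge0//; exact: pos.
(* Rank one operators are among the indices, so the integrals determine the quadratic form at every
   [w]. *)
have wT := rank1_trace_class dot_norm basis_e w.
pose i : index := (SigSub (mem_set wT), true).
have trE A : part true (trace (set_val i.1 *o A)) = rdot dot (A w) w.
  by have [_ ->] := rank1_trace dot_norm basis_e w A.
have dE E' : measurable E' -> rdot dot (nu E' w) w = \int[mu]_(x in E') dh i x.
  by move=> mA; rewrite -dhE// trE.
rewrite bopDE !bopZE rdotDl !rdotZl !dE// GE.
have Ii := dh_L1 i; have IE := L1_in mE Ii; have IF := L1_in mF Ii.
rewrite (Rint_in mu E) (Rint_in mu F) -(RintZ t IE) -(RintZ (1 - t) IF).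
rewrite -(RintD (L1Z t IE) (L1Z (1 - t) IF)).
by congr Rintegral; apply/funext => x; rewrite /g mulrDl !mulrA.
Qed.

End Range.

Theorem theorem3p1 (R : realType) (X : ptopologicalType)
    (H : completeNormedModType R[i]) (dot : {dot H for conjC})
    (e : nat -> H) (J : set nat)
    (nu : set (borelType X) -> bop H) (rho : bop H) (D : borelType X -> bop H)
    (hausX : hausdorff_space X)
    (dot_norm : forall x : H, `|x| ^+ 2 = dot x x)
    (sepH : separable H)
    (basis_e : orthonormal_basis dot e J)
    (nu_povm : is_povm dot e J nu)
    (nu_nonatomic : nonatomic nu)
    (rho_state : is_state dot e J rho)
    (rho_full_rank : full_rank rho)
    (D_derivative : is_RN_derivative dot e J nu rho D)
    (nu_noninj : classically_noninjective dot e J nu rho D) :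
  compact (povm_range nu : set (ultraweak dot e J)) /\
  convex_set (povm_range nu).
Proof.
have [mu muE] := povm_state_measure dot_norm basis_e nu_povm rho_state.
split; first exact: (povm_range_compact dot_norm basis_e sepH nu_povm D_derivative muE nu_noninj).
exact: (povm_range_convex dot_norm basis_e sepH nu_povm D_derivative muE nu_noninj).
Qed.
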